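(* Let $(M,\Phi,F)$ be an integrable Hamiltonian system with $2$ degrees of freedom, with compatible almost complex structure $J$ on $M$, and let $\bar o=o\cup\{p_0\}\subset M$ be a Lagrangian pinched torus which is a singular orbit (fiber) of the system, consisting of a fixed point $p_0$ of $\Phi$ and a regular orbit $o$ of $\Phi$. Then $\mu_+=\mu_-$, where $\mu_\pm$ are the Maslov indices of the loops $\lambda_\pm$ on $\bar o$ near $p_0$, and thus the bundle $\Gamma_J^2|_{\bar o}$ is isomorphic to $\bar o\times S^1$.
   Context: An integrable Hamiltonian system with $2$ degrees of freedom is a triple $(M,\Phi,F)$ with $(M,\omega)$ a $4$-dimensional symplectic manifold, $\Phi$ a Hamiltonian $\mathbb{R}^2$ action on $M$, and $F=(F_1,F_2):M\to\mathbb{R}^2$ with $F\circ\Phi^u=F$ for all $u\in\mathbb{R}^2$, $\{F_1,F_2\}=0$, and $dF_1\wedge dF_2\neq0$ almost everywhere. Lagrangian pinched torus (singly pinched): it is represented by a continuous map $\mathfrak p:S^1\times[-1,1]\to M$ whose restriction to $S^1\times(-1,1)$ is a Lagrangian embedding and which factors through an embedding of $(S^1\times[-1,1])/(S^1\times\{\pm1\})$ (all of $S^1\times\{-1,1\}$ identified to one point) into $M$. Its image is $\bar o$, $\{p_0\}=\mathfrak p(S^1\times\{\pm1\})$, and $o=\bar o\setminus\{p_0\}\cong S^1\times\mathbb{R}$. Such sets appear as singular fibers of integrable systems containing a focus-focus equilibrium $p_0$. Maslov bundle (here $n=2$): $J$ is compatible if $g_J(u,v)=\omega(Ju,v)$ is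 a Riemannian metric. A unitary frame is a basis $(u_1,\dots,u_n,v_1,\dots,v_n)$ of $T_pM$ with $v_i=-Ju_i$, $g_J(u_i,u_j)=\delta_{ij}$, $g_J(u_i,v_j)=0$. $\mathbb{U}(n)$ is identified with the real matrices $C=\begin{bmatrix} A & -B \\ B & A \end{bmatrix}$, $A+iB$ unitary, acting on frames from the right; $\det_{\mathbb C}C=\det(A+iB)$; $\mathbb{O}(n)=\{B=0\}$; $\mathbb{EU}(n)=\{\det_{\mathbb C}=\pm1\}$. $Fr^u_J$ is the principal bundle of unitary frames, $\Lambda_J=Fr_J^u/\mathbb{O}(n)$ is identified with the bundle of Lagrangian planes via $[(u,v)]\mapsto\mathrm{span}\{u_1,\dots,u_n\}$, and $\Gamma_J^2=Fr^u_J/\mathbb{EU}(n)\to M$ is a principal $S^1$ bundle with inherent action $[f]\cdot z=[f\cdot C]$ for any $C$ with $(\det_{\mathbb C}C)^2=z$. $det_J^2:\Lambda_J\to\Gamma_J^2$ is the natural quotient map. Indices $\mu_\pm$: let $B$ be an open contractible neighbourhood of $p_0$ in $M$ and $a\in(0,1)$ such that $\mathfrak p(S^1\times[a,1])\cup\mathfrak p(S^1\times[-1,-a])\subset B$. Let $\lambda_\pm:S^1\to o$, $\lambda_\pm(z)=\mathfrak p(z,\pm a)$. Choose a section $\mathfrak s:B\to\Gamma_J^2|_B$, with trivialization $tr_{\mathfrak s}:\mathfrak s(q)\cdot z\mapsto(q,z)$. Then $\mu_\pm$ is the degree of $S^1\to S^1$, $z\mapsto pr_{S^1}\circ tr_{\mathfrak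 s}\circ det_J^2(T_{\lambda_\pm(z)}o)$; it does not depend on $\mathfrak s$. *)

(* Defs.v *)
From HB Require Import structures.
From mathcomp Require Import all_boot all_order all_algebra.
From mathcomp Require Import spectral.
From mathcomp Require Import complex.
From mathcomp Require Import all_classical all_reals all_analysis.

Set Implicit Arguments.
Unset Strict Implicit.
Unset Printing Implicit Defensive.

Import Order.TTheory GRing.Theory Num.Theory.
Import numFieldNormedType.Exports.

Local Open Scope classical_set_scope.
Local Open Scope ring_scope.
Local Open Scope complex_scope.

Section calculus.
Context {R : realType}.

Fixpoint Ck_on {V W : normedModType R} (k : nat) (U : set V) (f : V -> W) : Prop :=
  if k is k'.+1 then
    (forall x, U x -> differentiable f x) /\
    (forall v, Ck_on k' U (fun x => 'D_v f x))
  else {in U, continuous f}.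

(* The set U is always open where this is used. *)
Definition smooth_on {V W : normedModType R} (U : set V) (f : V -> W) : Prop :=
  forall k, Ck_on k U f.

(* The norm of 'rV[R]_n is the sup norm, so that [ball x r] is an open cube of
   side 2r. *)
Definition null_set n (N : set 'rV[R]_n) : Prop :=
  forall eps : R, 0 < eps ->
  exists (x : nat -> 'rV[R]_n) (r : nat -> R),
    [/\ forall k, 0 <= r k,
        N `<=` \bigcup_k ball (x k) (r k) &
        forall l, \sum_(k < l) (2 * r k) ^+ n <= eps].

End calculus.

Section topology.

Definition embedding {X Y : topologicalType} (f : X -> Y) : Prop :=
  injective f /\
  forall U : set X, open U <-> exists2 V : set Y, open V & U = f @^-1` V.

Definition contractible {R : realType} {M : topologicalType} (B : set M) : Prop :=
  exists (b : M) (h : M * R -> M),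
    [/\ B b,
        {within B `*` `[0, 1]%classic, continuous h},
        forall x (t : R), B x -> 0 <= t <= 1 -> B (h (x, t)),
        forall x, B x -> h (x, 0) = x &
        forall x, B x -> h (x, 1) = b].

End topology.

Section circle.
Context (R : realType).

Definition unit_circle : set R[i]^o := [set z | `|z| = 1].

Definition S1 : Type := set_type unit_circle.
HB.instance Definition _ := Topological.copy S1 (set_type unit_circle).

Lemma expi_subproof (t : R) :
  (cos (2 * pi * t) +i* sin (2 * pi * t)) \in unit_circle.
Proof. by rewrite inE /unit_circle/= /Num.norm/= cos2Dsin2 sqrtr1. Qed.

(* t |-> exp (2 pi i t) *)
Definition expi (t : R) : S1 :=
  exist (fun z => z \in unit_circle) _ (expi_subproof t).

Definition is_degree (f : S1 -> S1) (d : int) : Prop :=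
  exists g : R -> R,
    [/\ continuous g, forall t, f (expi t) = expi (g t) & g 1 = g 0 + d%:~R].

End circle.

Section manifold.
Context {R : realType}.

Record chart (M : topologicalType) (m : nat) := Chart {
  cdom : set M;
  cmap : M -> 'rV[R]_m;
  cinv : 'rV[R]_m -> M;
  cdom_open : open cdom;
  cimg_open : open (cmap @` cdom);
  cmapK : forall q, cdom q -> cinv (cmap q) = q;
  cmap_continuous : {in cdom, continuous cmap};
  cinv_continuous : {in cmap @` cdom, continuous cinv} }.

Definition cimg {M m} (c : chart M m) : set 'rV[R]_m := @cmap M m c @` @cdom M m c.

(* The preferred charts [chart_at] are only used to represent tangent vectors:
   an element of T_qM is a row vector, namely its coordinates in the chart
   [chart_at q]. *)
Record manifold (M : topologicalType) (m : nat) := Manifold {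
  atlas : set (chart M m);
  chart_at : M -> chart M m;
  chart_at_atlas : forall q, atlas (chart_at q);
  chart_at_dom : forall q, cdom (chart_at q) q;
  atlas_smooth : forall c c', atlas c -> atlas c' ->
    smooth_on (cmap c @` (cdom c `&` cdom c')) (cmap c' \o cinv c);
  manifold_hausdorff : hausdorff_space M;
  manifold_second_countable : @second_countable M }.

Context {M : topologicalType} {m : nat} (X : manifold M m).

Definition smooth_from k (F : M -> 'rV[R]_k) : Prop :=
  forall c, atlas X c -> smooth_on (cimg c) (F \o cinv c).

(* smoothness of a map from an open subset of a normed space to M *)
Definition smooth_into {V : normedModType R} (U : set V) (f : V -> M) : Prop :=
  {in U, continuous f} /\
  forall c, atlas X c -> smooth_on (U `&` f @^-1` cdom c) (cmap c \o f).

(* The matrix of the differential of F at q, acting on row vectors from the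
   right: u in T_qM is mapped to u *m dfrom F q. *)
Definition dfrom k (F : M -> 'rV[R]_k) (q : M) : 'M[R]_(m, k) :=
  jacobian (F \o cinv (chart_at X q)) (cmap (chart_at X q) q).

(* The rows are the partial derivatives of f at x, in T_{f x}M. *)
Definition dinto k (f : 'rV[R]_k -> M) (x : 'rV[R]_k) : 'M[R]_(k, m) :=
  jacobian (cmap (chart_at X (f x)) \o f) x.

(* Change of coordinates for tangent vectors, from the chart c to the preferred
   chart of the point with coordinates x in c. *)
Definition tchange (c : chart M m) (x : 'rV[R]_m) : 'M[R]_m := dinto (cinv c) x.

Definition form_in (w : M -> 'M[R]_m) (c : chart M m) (x : 'rV[R]_m) : 'M[R]_m :=
  tchange c x *m w (cinv c x) *m (tchange c x)^T.

Definition endo_in (J : M -> 'M[R]_m) (c : chart M m) (x : 'rV[R]_m) : 'M[R]_m :=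
  tchange c x *m J (cinv c x) *m invmx (tchange c x).

(* The form is (u, v) |-> u *m w q *m v^T on T_qM. *)
Record symplectic (w : M -> 'M[R]_m) : Prop := Symplectic {
  symplectic_smooth : forall c, atlas X c -> smooth_on (cimg c) (form_in w c);
  symplectic_alt : forall q, (w q)^T = - w q;
  symplectic_nondegenerate : forall q, w q \in unitmx;
  symplectic_closed : forall c x (i j k : 'I_m), atlas X c -> cimg c x ->
    'D_(delta_mx 0 i) (fun y => form_in w c y j k) x
    + 'D_(delta_mx 0 j) (fun y => form_in w c y k i) x
    + 'D_(delta_mx 0 k) (fun y => form_in w c y i j) x = 0 }.

(* J maps the tangent vector u at q to u *m J q. *)
Record almost_complex (J : M -> 'M[R]_m) : Prop := AlmostComplex {
  almost_complex_smooth : forall c, atlas X c -> smooth_on (cimg c) (endo_in J c);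
  almost_complex_sqr : forall q, J q *m J q = - 1%:M }.

(* g_J (u, v) = w (J u, v) *)
Definition gJ (w J : M -> 'M[R]_m) (q : M) : 'M[R]_m := J q *m w q.

Definition compatible (w J : M -> 'M[R]_m) : Prop :=
  forall q, (gJ w J q)^T = gJ w J q /\
    forall u : 'rV[R]_m, u != 0 -> 0 < (u *m gJ w J q *m u^T) 0 0.

(* The i-th row is the Hamiltonian vector field of F_i, with the convention
   w (X_h, v) = dh (v). *)
Definition hamvf (w : M -> 'M[R]_m) k (F : M -> 'rV[R]_k) (q : M) : 'M[R]_(k, m) :=
  (dfrom F q)^T *m invmx (w q).

(* The entry (i, j) is {F_i, F_j} = w (X_{F_i}, X_{F_j}). *)
Definition poisson (w : M -> 'M[R]_m) k (F : M -> 'rV[R]_k) (q : M) : 'M[R]_k :=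
  hamvf w F q *m w q *m (hamvf w F q)^T.

(* The i-th row is the value at q of the i-th infinitesimal generator. *)
Definition generators k (Phi : 'rV[R]_k -> M -> M) (q : M) : 'M[R]_(k, m) :=
  dinto (fun u => Phi u q) 0.

Record hamiltonian_action (w : M -> 'M[R]_m) k (Phi : 'rV[R]_k -> M -> M) : Prop :=
  HamiltonianAction {
  action0 : forall q, Phi 0 q = q;
  actionD : forall u v q, Phi (u + v) q = Phi u (Phi v q);
  action_smooth : forall c, atlas X c ->
    smooth_into (setT `*` cimg c)
      (fun ux : 'rV[R]_k * 'rV[R]_m => Phi ux.1 (cinv c ux.2));
  action_momentum : exists H : M -> 'rV[R]_k,
    [/\ smooth_from H,
        forall q, generators Phi q = hamvf w H q &
        forall u q, H (Phi u q) = H q] }.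

(* dF_1 /\ ... /\ dF_k <> 0 at q *)
Definition independent_at k (F : M -> 'rV[R]_k) (q : M) : Prop :=
  \rank (dfrom F q) = k.

Record integrable_system (w : M -> 'M[R]_m) k
  (Phi : 'rV[R]_k -> M -> M) (F : M -> 'rV[R]_k) : Prop := IntegrableSystem {
  integrable_dim : m = (k + k)%N;
  integrable_symplectic : symplectic w;
  integrable_action : hamiltonian_action w Phi;
  integrable_smooth : smooth_from F;
  integrable_invariant : forall u, F \o Phi u = F;
  integrable_involution : forall q, poisson w F q = 0;
  integrable_independent : forall c, atlas X c ->
    null_set (cmap c @` [set q | cdom c q /\ ~ independent_at F q]) }.

End manifold.

Section unitary_group.
Context {R : realType} {n : nat}.
Implicit Types C : 'M[R]_(n + n).

(* A + iB, where A and B are the left blocks of C *)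
Definition complex_of C : 'M[R[i]]_n :=
  map_mx (real_complex R) (ulsubmx C) + 'i *: map_mx (real_complex R) (dlsubmx C).

Definition detC C : R[i] := \det (complex_of C).

Definition Ugroup : set 'M[R]_(n + n) :=
  [set C | C = block_mx (ulsubmx C) (- dlsubmx C) (dlsubmx C) (ulsubmx C) /\
           complex_of C \is unitarymx].

Definition Ogroup : set 'M[R]_(n + n) := Ugroup `&` [set C | dlsubmx C = 0].

Definition EUgroup : set 'M[R]_(n + n) :=
  Ugroup `&` [set C | detC C = 1 \/ detC C = -1].

End unitary_group.

Section unitary_group_theory.
Context {R : realType} {n : nat}.
Implicit Types C D : 'M[R]_(n + n).

Let blocks C := C = block_mx (ulsubmx C) (- dlsubmx C) (dlsubmx C) (ulsubmx C).

Let complex_of_inj C D : blocks C -> blocks D -> complex_of C = complex_of D -> C = D.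
Proof.
move=> hC hD /matrixP CD.
have h i j : ulsubmx C i j = ulsubmx D i j /\ dlsubmx C i j = dlsubmx D i j.
  move: (CD i j); rewrite /complex_of !mxE -complexiE => /eqP.
  rewrite eq_complex /= !(mul0r, mul1r, mulr0, subr0, sub0r, addr0, add0r, oppr0).
  by move=> /andP[/eqP -> /eqP ->].
rewrite hC hD; congr block_mx; try congr (- _);
  by apply/matrixP => i j; have [] := h i j.
Qed.

Let mul_blocks C D : blocks C -> blocks D ->
  C *m D = block_mx (ulsubmx C *m ulsubmx D - dlsubmx C *m dlsubmx D)
                    (- (dlsubmx C *m ulsubmx D + ulsubmx C *m dlsubmx D))
                    (dlsubmx C *m ulsubmx D + ulsubmx C *m dlsubmx D)
                    (ulsubmx C *m ulsubmx D - dlsubmx C *m dlsubmx D).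
Proof.
move=> hC hD; rewrite {1}hC {1}hD mulmx_block; congr block_mx.
- by rewrite mulNmx.
- by rewrite mulmxN mulNmx opprD addrC.
- by rewrite mulmxN addrC.
Qed.

Let complex_mulmx (K : numClosedFieldType) (a b c d : 'M[K]_n) :
  a *m c - b *m d + 'i *: (b *m c + a *m d) = (a + 'i *: b) *m (c + 'i *: d).
Proof.
rewrite mulmxDl !mulmxDr -!scalemxAl -!scalemxAr scalerA -expr2 sqrCi scaleN1r.
by rewrite scalerDr [_ *: (b *m c) + _]addrC addrACA; congr (_ + _); exact: addrC.
Qed.

Let complex_ofM C D : blocks C -> blocks D ->
  complex_of (C *m D) = complex_of C *m complex_of D.
Proof.
move=> hC hD; rewrite /complex_of mul_blocks// block_mxKul block_mxKdl.
by rewrite map_mxB map_mxD !map_mxM /= complex_mulmx.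
Qed.

Let tr_blocks C : blocks C ->
  C^T = block_mx (ulsubmx C)^T (dlsubmx C)^T (- (dlsubmx C)^T) (ulsubmx C)^T.
Proof. by move=> hC; rewrite {1}hC tr_block_mx linearN. Qed.

Let complex_of_tr C : blocks C -> complex_of C^T = ((complex_of C)^t* )%sesqui.
Proof.
move=> hC; rewrite /complex_of tr_blocks// block_mxKul block_mxKdl.
apply/matrixP => i j; rewrite !mxE -complexiE.
apply/eqP; rewrite eq_complex /= !(mul0r, mul1r, mulr0, subr0, sub0r, addr0, add0r, oppr0).
by rewrite !eqxx.
Qed.

Let complex_of1 : complex_of (1%:M : 'M[R]_(n + n)) = 1%:M.
Proof.
rewrite /complex_of (scalar_mx_block n n (1 : R)) block_mxKul block_mxKdl.
by rewrite map_mx1 map_mx0 scaler0 addr0.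
Qed.

Let detC1 : detC (1%:M : 'M[R]_(n + n)) = 1.
Proof. by rewrite /detC complex_of1 det1. Qed.

Let Ugroup1 : Ugroup (1%:M : 'M[R]_(n + n)).
Proof.
split; last by rewrite complex_of1; apply/unitarymxP; rewrite mul1mx trmx1 map_mx1.
by rewrite (scalar_mx_block n n (1 : R)) block_mxKul block_mxKdl oppr0.
Qed.

Let UgroupM C D : Ugroup C -> Ugroup D -> Ugroup (C *m D).
Proof.
move=> [hC uC] [hD uD]; split; last by rewrite (complex_ofM hC hD); exact: (mul_unitarymx uC uD).
rewrite (mul_blocks hC hD) block_mxKul block_mxKdl; exact: erefl.
Qed.

Let UgroupT C : Ugroup C -> Ugroup C^T.
Proof.
move=> [hC uC]; split; last by rewrite (complex_of_tr hC) trmxC_unitary.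
rewrite (tr_blocks hC) block_mxKul block_mxKdl opprK; exact: erefl.
Qed.

Let UgroupV C : Ugroup C -> C *m C^T = 1%:M.
Proof.
move=> uC; have uT := UgroupT uC; apply: complex_of_inj.
- by case: (UgroupM uC uT).
- by case: Ugroup1.
case: uC uT => hC uC [hT uT]; rewrite (complex_ofM hC hT).
rewrite (complex_of_tr hC) complex_of1; exact: (elimT unitarymxP uC).
Qed.

Record orthogonal_subgroup (G : set 'M[R]_(n + n)) : Prop := OrthogonalSubgroup {
  subgroup1 : G 1%:M;
  subgroupM : forall C D, G C -> G D -> G (C *m D);
  subgroupT : forall C, G C -> G C^T;
  subgroupV : forall C, G C -> C *m C^T = 1%:M }.

Lemma Ogroup_subgroup : orthogonal_subgroup Ogroup.
Proof.
split.
- split=> //; change (dlsubmx (1%:M : 'M[R]_(n + n)) = 0).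
  by rewrite (scalar_mx_block n n (1 : R)) block_mxKdl.
- move=> C D [uC oC] [uD oD]; split; first exact: UgroupM.
  change (dlsubmx (C *m D) = 0).
  by rewrite (mul_blocks uC.1 uD.1) block_mxKdl oC oD mul0mx mulmx0 addr0.
- move=> C [uC oC]; split; first exact: UgroupT.
  change (dlsubmx C^T = 0).
  by rewrite (tr_blocks uC.1) block_mxKdl oC trmx0 oppr0.
- by move=> C [uC _]; exact: UgroupV.
Qed.

Lemma EUgroup_subgroup : orthogonal_subgroup EUgroup.
Proof.
have detCM C D : Ugroup C -> Ugroup D -> detC (C *m D) = detC C * detC D.
  by move=> [hC _] [hD _]; rewrite /detC (complex_ofM hC hD) det_mulmx.
split.
- by split=> //; left; exact: detC1.
- move=> C D [uC eC] [uD eD]; split; first exact: UgroupM.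
  change (detC (C *m D) = 1 \/ detC (C *m D) = -1).
  rewrite (detCM _ _ uC uD); case: eC => ->; case: eD => ->;
    rewrite ?mulr1 ?mul1r ?mulrNN ?mulr1; by [left|right].
- move=> C [uC eC]; split; first exact: UgroupT.
  change (detC C^T = 1 \/ detC C^T = -1).
  have := detCM _ _ uC (UgroupT uC); rewrite (UgroupV uC) detC1.
  case: eC => -> /esym; rewrite ?mul1r ?mulN1r; first by left.
  by move=> /eqP; rewrite eqr_oppLR => /eqP ->; right.
- by move=> C [uC _]; exact: UgroupV.
Qed.

End unitary_group_theory.

Section frames.
Context {R : realType} {M : topologicalType} {m : nat}.

(* The total space of the Whitney sum of m copies of TM: pairs of a point q and
   m tangent vectors at q, the rows of the matrix. *)
Definition mframes (X : @manifold R M m) : Type := (M * 'M[R]_m)%type.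

Context (X : @manifold R M m).

HB.instance Definition _ := Choice.copy (mframes X) (M * 'M[R]_m)%type.

(* The topology is the one of the vector bundle (in general not the product
   topology, since [chart_at] need not be continuous): a set is open iff it
   is open in the local trivialization given by each chart. *)
Definition mframes_in (c : chart M m) (W : set (mframes X)) : set ('rV[R]_m * 'M[R]_m) :=
  [set xA | cimg c xA.1 /\ W (cinv c xA.1, xA.2 *m tchange X c xA.1)].

Definition mframes_open (W : set (mframes X)) : Prop :=
  forall c, atlas X c -> open (mframes_in c W).

Let mframes_openT : mframes_open setT.
Proof.
move=> c _; rewrite (_ : mframes_in _ _ = fst @^-1` (@cimg R M m c)).
  by apply: open_comp; [move=> x _; exact: cvg_fst | exact: cimg_open].
by apply/seteqP; split=> x //= -[].
Qed.

Let mframes_openI (V W : set (mframes X)) :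
  mframes_open V -> mframes_open W -> mframes_open (V `&` W).
Proof.
move=> oV oW c Xc.
rewrite (_ : mframes_in _ _ = mframes_in c V `&` mframes_in c W).
  by apply: openI; [exact: oV | exact: oW].
by apply/seteqP; split=> x /=; [move=> -[? []]|move=> -[[? ?] [? ?]]].
Qed.

Let mframes_open_bigU (I : Type) (W : I -> set (mframes X)) :
  (forall i, mframes_open (W i)) -> mframes_open (\bigcup_i W i).
Proof.
move=> oW c Xc; rewrite (_ : mframes_in _ _ = \bigcup_i mframes_in c (W i)).
  by apply: bigcup_open => i _; exact: oW.
apply/seteqP; split=> x /=.
  by move=> [? [i _ ?]]; exists i.
by move=> [i _ [? ?]]; split=> //; exists i.
Qed.

HB.instance Definition _ := isOpenTopological.Build (mframes X)
  mframes_openT mframes_openI mframes_open_bigU.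

End frames.

Section maslov_bundle.
Context {R : realType} {M : topologicalType} {n : nat}.
Context (X : @manifold R M (n + n)) (w J : M -> 'M[R]_(n + n)).

(* The rows of f.2 are u_1, ..., u_n, v_1, ..., v_n. *)
Definition unitary_frames : set (mframes X) :=
  [set f | let g := gJ w J f.1 in
           let u : 'M[R]_(n, n + n) := usubmx f.2 in
           let v : 'M[R]_(n, n + n) := dsubmx f.2 in
    [/\ f.2 \in unitmx, v = - (u *m J f.1),
        u *m g *m u^T = 1%:M & u *m g *m v^T = 0]].

Definition Fr : Type := set_type unitary_frames.
HB.instance Definition _ := Topological.copy Fr (set_type unitary_frames).

Definition frame_base (f : Fr) : M := (val f).1.
Definition frame_mx (f : Fr) : 'M[R]_(n + n) := (val f).2.

(* f' = f . C; since the vectors of a frame are the rows of its matrix, the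
   right action (f . C)_j = \sum_i f_i C_ij is multiplication by C^T. *)
Definition frame_act (f : Fr) (C : 'M[R]_(n + n)) (f' : Fr) : Prop :=
  frame_base f' = frame_base f /\ frame_mx f' = C^T *m frame_mx f.

Definition orbit_rel (G : set 'M[R]_(n + n)) : rel Fr :=
  fun f f' => `[< exists2 C, G C & frame_act f C f' >].

Section orbit.
Context (G : set 'M[R]_(n + n)) (hG : orthogonal_subgroup G).

Lemma orbit_refl : reflexive (orbit_rel G).
Proof.
move=> f; apply/asboolP; exists 1%:M; first exact: subgroup1.
by split=> //; rewrite trmx1 mul1mx.
Qed.

Lemma orbit_sym : symmetric (orbit_rel G).
Proof.
suff h f f' : orbit_rel G f f' -> orbit_rel G f' f.
  by move=> f f'; apply/idP/idP; exact: h.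
move=> /asboolP[C GC [bE mE]]; apply/asboolP; exists C^T; first exact: subgroupT.
by split; rewrite ?bE// mE mulmxA trmxK (subgroupV hG)// mul1mx.
Qed.

Lemma orbit_trans : transitive (orbit_rel G).
Proof.
move=> f2 f1 f3 /asboolP[C GC [bC mC]] /asboolP[D GD [bD mD]]; apply/asboolP.
exists (C *m D); first exact: subgroupM.
by split; rewrite ?bD ?bC// mD mC mulmxA trmx_mul.
Qed.

Definition orbit_equiv : equiv_rel Fr :=
  EquivRel (orbit_rel G) orbit_refl orbit_sym orbit_trans.

End orbit.

Local Open Scope quotient_scope.

(* Lambda_J = Fr / O(n) *)
Definition Lam : Type := quotient_topology {eq_quot (orbit_equiv Ogroup_subgroup)}.
HB.instance Definition _ := Topological.copy Lam
  (quotient_topology {eq_quot (orbit_equiv Ogroup_subgroup)}).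

(* Gamma_J^2 = Fr / EU(n) *)
Definition Gam : Type := quotient_topology {eq_quot (orbit_equiv EUgroup_subgroup)}.
HB.instance Definition _ := Topological.copy Gam
  (quotient_topology {eq_quot (orbit_equiv EUgroup_subgroup)}).

Definition Lam_class (f : Fr) : Lam :=
  \pi_{eq_quot (orbit_equiv Ogroup_subgroup)} f.
Definition Lam_repr (l : Lam) : Fr :=
  repr (l : {eq_quot (orbit_equiv Ogroup_subgroup)}).
Definition Gam_class (f : Fr) : Gam :=
  \pi_{eq_quot (orbit_equiv EUgroup_subgroup)} f.
Definition Gam_repr (g : Gam) : Fr :=
  repr (g : {eq_quot (orbit_equiv EUgroup_subgroup)}).

Definition Gam_base (g : Gam) : M := frame_base (Gam_repr g).

(* [f] . z = [f . C] for any C in U(n) with (det_C C)^2 = z *)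
Definition Gam_act (g : Gam) (z : S1 R) (g' : Gam) : Prop :=
  exists f f' C, [/\ g = Gam_class f, g' = Gam_class f', Ugroup C,
    detC C ^+ 2 = val z & frame_act f C f'].

(* The quotient map Lambda_J -> Gamma_J^2; Lam_repr is harmless here because
   O(n) is contained in EU(n). *)
Definition det2 (l : Lam) : Gam := Gam_class (Lam_repr l).

(* l is the element of Lambda_J identified with the plane spanned by the rows of
   T in T_qM. *)
Definition is_plane k (l : Lam) (q : M) (T : 'M[R]_(k, n + n)) : Prop :=
  exists f, [/\ l = Lam_class f, frame_base f = q &
                ((usubmx (frame_mx f) : 'M[R]_(n, n + n)) == T)%MS].

Definition is_section (B : set M) (s : M -> Gam) : Prop :=
  {within B, continuous s} /\ forall q, B q -> Gam_base (s q) = q.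

(* The restriction of Gamma_J^2 to A is isomorphic, as a principal S^1 bundle,
   to A x S^1. *)
Definition Gam_trivial_over (A : set M) : Prop :=
  exists (h : set_type (Gam_base @^-1` A) -> set_type A * S1 R)
         (k : set_type A * S1 R -> set_type (Gam_base @^-1` A)),
    [/\ continuous h /\ continuous k,
        cancel h k /\ cancel k h,
        forall g, val (h g).1 = Gam_base (val g) &
        forall g z g', Gam_act (val g) z (val g') ->
          val (h g').2 = val (h g).2 * val z].

End maslov_bundle.

Section pinched_torus.
Context {R : realType} {M : topologicalType} {m : nat}.
Context (X : @manifold R M m) (w : M -> 'M[R]_m).

Definition cylinder : set (S1 R * R) := [set y | -1 <= y.2 <= 1].
Definition open_cylinder : set (S1 R * R) := [set y | -1 < y.2 < 1].

Definition pinch_rel : rel (set_type cylinder) :=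
  fun y y' => `[< y = y' \/ `|(val y).2| = 1 /\ `|(val y').2| = 1 >].

Lemma pinch_refl : reflexive pinch_rel.
Proof. by move=> y; apply/asboolP; left. Qed.

Lemma pinch_sym : symmetric pinch_rel.
Proof.
by move=> y y'; apply/idP/idP => /asboolP h; apply/asboolP;
  case: h => [->|[]]; [left|right|left|right].
Qed.

Lemma pinch_trans : transitive pinch_rel.
Proof.
move=> y2 y1 y3 /asboolP[->//|[h1 h2]] /asboolP[<-|[h3 h4]];
  by apply/asboolP; right.
Qed.

Definition pinch_equiv : equiv_rel (set_type cylinder) :=
  EquivRel pinch_rel pinch_refl pinch_sym pinch_trans.

Local Open Scope quotient_scope.

Definition pinched_cylinder : Type := quotient_topology {eq_quot pinch_equiv}.
HB.instance Definition _ := Topological.copy pinched_cylinder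
  (quotient_topology {eq_quot pinch_equiv}).

Definition pinch (y : set_type cylinder) : pinched_cylinder :=
  \pi_{eq_quot pinch_equiv} y.

(* Differentiability on S^1 x R is expressed on the universal cover. *)
Definition unroll (p : S1 R * R -> M) (x : 'rV[R]_2) : M :=
  p (expi (x 0 0), x 0 1).

(* Coordinates (t, r), corresponding to the point (exp (2 pi i t), r). *)
Definition cyl_coord (t r : R) : 'rV[R]_2 := \row_(j < 2) if j == 0 then t else r.

(* The parametrization p is only meaningful on S^1 x [-1, 1]. *)
Record lagrangian_pinched_torus (p : S1 R * R -> M) (p0 : M) : Prop :=
  LagrangianPinchedTorus {
  pinched_continuous : {within cylinder, continuous p};
  pinched_smooth : smooth_into X [set x : 'rV[R]_2 | -1 < x 0 1 < 1] (unroll p);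
  pinched_immersion : forall x : 'rV[R]_2, -1 < x 0 1 < 1 -> \rank (dinto X (unroll p) x) = 2%N;
  pinched_embedding : embedding (fun y : set_type open_cylinder => p (val y));
  pinched_lagrangian : forall x : 'rV[R]_2, -1 < x 0 1 < 1 ->
    dinto X (unroll p) x *m w (unroll p x) *m (dinto X (unroll p) x)^T = 0;
  pinched_factor : exists2 e : pinched_cylinder -> M,
    embedding e & forall y, p (val y) = e (pinch y);
  pinched_point : forall z, p (z, 1) = p0 /\ p (z, -1) = p0 }.

End pinched_torus.

Section maslov_index.
Context {R : realType} {M : topologicalType}.
Context (X : @manifold R M (2 + 2)) (w J : M -> 'M[R]_(2 + 2)).

(* B, a and s are the choices entering the definition of the indices. *)
Definition maslov_data (p : S1 R * R -> M) (p0 : M)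
    (B : set M) (a : R) (s : M -> Gam X w J) : Prop :=
  [/\ open B /\ contractible (R := R) B, B p0, 0 < a < 1,
      forall z r, a <= r <= 1 \/ -1 <= r <= - a -> B (p (z, r)) &
      is_section B s].

(* mu is the degree of the map f : S^1 -> S^1 characterized by
   det2 (T_{p (z, r)} o) = s (p (z, r)) . f z, for z = exp (2 pi i t). *)
Definition is_maslov_index (p : S1 R * R -> M) (s : M -> Gam X w J)
    (r : R) (mu : int) : Prop :=
  exists2 f : S1 R -> S1 R,
    forall t, exists2 l : Lam X w J,
      is_plane l (p (expi t, r)) (dinto X (unroll p) (cyl_coord t r)) &
      Gam_act (s (p (expi t, r))) (f (expi t)) (det2 l) &
    is_degree f mu.

End maslov_index.

(* Main.v *)
(* Near p0 the bundle Gamma_J^2 is trivialized by the squared phase of a complex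
   determinant of Lagrangian planes. The generators G of the action span the tangent
   planes of o, so mu_+ and mu_- are twice the winding numbers of det G along loops
   near the two ends of o, up to a common contribution of the section, and one has to
   show that these two winding numbers agree.
   The core circle of o is traced by t |-> Phi^{u(t)} (p (1, 0)) for a path u from 0 to
   an element u(1) fixing o pointwise. For tau close to 1 or -1, the loop
   t |-> Phi^{u(t)} (p (1, tau)) stays near p0 and is homotopic, within the end, to
   the circle z |-> p (z, tau); along it the generators are G (p (1, tau)) transported by
   dPhi^{u(t)}. As tau tends to 1 or -1, the plane spanned by G subconverges to a plane
   X_+ or X_- of T_{p0}M, and the winding numbers become those of the loops of
   Lagrangian planes X_+ A(t) and X_- A(t) with the same A(t) = dPhi^{u(t)} at p0.
   Two loops of Lagrangian planes obtained from fixed planes by one path of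
   linear maps have the same winding number: either the planes share a line, and a
   segment joins the loops, or they are transverse, and the ratio of the determinants
   avoids a half line.
   The equality of the degrees allows one to multiply the section [T o] of Gamma_J^2 over
   o by a circle-valued function so that it extends continuously to p0. *)
Require Import Defs.
From mathcomp Require Import all_boot all_order all_algebra.
From mathcomp Require Import spectral.
From mathcomp Require Import complex.
From mathcomp Require Import all_classical all_reals all_analysis.
From mathcomp Require Import ring lra.

Set Implicit Arguments.
Unset Strict Implicit.
Unset Printing Implicit Defensive.

Import Order.TTheory GRing.Theory Num.Theory.
Import numFieldNormedType.Exports.

Local Open Scope classical_set_scope.
Local Open Scope ring_scope.
Local Open Scope complex_scope.

(** The generators vanish at the fixed point p0, so det G tends to 0 there and its winding number
    cannot be read off at p0 from G itself. Along one orbit loop, however, G at Phi^{u(t)}(q) is G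
    at q times dPhi^{u(t)}. Replacing G at q by an orthonormal basis of the same plane therefore
    multiplies the determinant by one nonzero real constant for the whole loop, and after this
    rescaling the limit q -> p0 keeps the winding number. The group R^2 is abelian, so the period
    u(1) found on the core circle fixes every point of o. One path u thus serves loops near both
    ends, and this is why A(t) is common to the two limit planes. The map A(1) may differ from the
    identity, but it fixes both limit planes vector by vector: dPhi^{u(1)} carries the generators at
    a point q of o to themselves, and this equation is closed. The limit loops are closed for this
    reason. *)

(** * Limits along filters *)

Lemma cvg_pairl {T} {U V : topologicalType} {F : set_system T} {FF : Filter F}
    (f : T -> U) (g : T -> V) (u : U) (v : V) :
  f @ F --> u -> g @ F --> v -> (fun t => (f t, g t)) @ F --> (u, v).
Proof. by move=> fu gv; exact: cvg_pair. Qed.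

(** The source of all uniform choices below: K is a time segment, a cube of matrices, or a rectangle
    covering the closed cylinder. *)
Lemma tube {X Y : topologicalType} (K : set X) (y0 : Y) (P : X -> Y -> Prop) :
  compact K -> (forall x, K x -> \forall z \near (x, y0), P z.1 z.2) ->
  \forall y \near y0, forall x, K x -> P x y.
Proof.
move=> /compact_near_coveringP cK h.
have := cK Y (nbhs y0) (fun y x => P x y) _; apply=> x Kx; exact: h.
Qed.

Lemma cvg_near_eq {T} {U : topologicalType} {F : set_system T} {FF : Filter F}
    (f g : T -> U) (l : U) :
  (\forall x \near F, g x = f x) -> f @ F --> l -> g @ F --> l.
Proof.
move=> fg; apply: cvg_trans; apply: near_eq_cvg.
by apply: filterS fg => x ->.
Qed.

(** * Real and imaginary parts of limits *)

Section complex_continuity.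
Context {R : realType}.
Local Notation C := (R[i]^o).

Lemma re_cvg {T} {F : set_system T} {FF : Filter F} (z : T -> C) (l : C) :
  z @ F --> l -> (fun t => complex.Re (z t)) @ F --> complex.Re l.
Proof.
move=> /cvgrPdist_lt zl; apply/cvgrPdist_lt => e e0.
have := zl e%:C; rewrite ltcR => /(_ e0); apply: filterS => t.
rewrite -ltcR; apply: le_lt_trans.
by apply: le_trans (normc_ge_Re (l - z t)); case: (l) (z t) => a b [c d].
Qed.

Lemma im_cvg {T} {F : set_system T} {FF : Filter F} (z : T -> C) (l : C) :
  z @ F --> l -> (fun t => complex.Im (z t)) @ F --> complex.Im l.
Proof.
move=> zl; have /re_cvg : (fun t => - ('i%C : C) * z t) @ F --> (- 'i%C : C) * l.
  by apply: cvgM; [exact: cvg_cst|exact: zl].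
have E (u : R[i]) : complex.Re (- 'i%C * u) = complex.Im u.
  by case: u => a b; simpc => /=; rewrite ?mul0r ?mulN1r; ring.
by rewrite E; under eq_fun do rewrite E.
Qed.

Lemma cplx_cvg {T} {F : set_system T} {FF : Filter F} (x y : T -> R) (l : C) :
  x @ F --> complex.Re l -> y @ F --> complex.Im l ->
  (fun t => (x t +i* y t : C)) @ F --> l.
Proof.
move=> /cvgrPdist_lt xl /cvgrPdist_lt yl; apply/cvgrPdist_lt => e e0.
have [er er0 eE] : exists2 r : R, 0 < r & e = r%:C.
  move: e0; rewrite ltcE /= => /andP[/eqP h1 h2]; exists (complex.Re e) => //.
  by case: e h1 h2 => a b /= ->.
rewrite {}eE; near=> t.
apply: le_lt_trans (_ : (`|complex.Re l - x t| + `|complex.Im l - y t|)%:C < _).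
  rewrite rmorphD /=; case: (l) => a b.
  have -> : (a +i* b - (x t +i* y t)) = (a - x t)%:C + 'i%C * (b - y t)%:C :> R[i].
    by simpc.
  apply: le_trans (ler_normD _ _) _; rewrite normrM.
  have -> : `|'i%C : R[i]| = 1 by rewrite normc_def /= expr0n add0r expr1n sqrtr1.
  by rewrite mul1r !normc_def /= !expr0n !addr0 !sqrtr_sqr.
rewrite ltcR [ltRHS]splitr ltrD //; near: t; [apply: xl|apply: yl]; exact: divr_gt0.
Unshelve. all: by end_near. Qed.

End complex_continuity.

(** * The exponential map of the circle and pointwise arguments *)

Section circle_arguments.
Context {R : realType}.
Local Notation C := (R[i]^o).

Definition cis (t : R) : C := cos (2 * pi * t) +i* sin (2 * pi * t).

Lemma val_expi t : val (expi t) = cis t. Proof. by []. Qed.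

Lemma cisD s t : cis (s + t) = cis s * cis t.
Proof.
rewrite /cis mulrDr cosD sinD; apply/eqP; rewrite eq_complex /=.
by rewrite eqxx /= addrC.
Qed.

Lemma cis0 : cis 0 = 1.
Proof. by rewrite /cis mulr0 cos0 sin0. Qed.

Lemma norm_cis t : `|cis t| = 1.
Proof. by rewrite /cis normc_def /= cos2Dsin2 sqrtr1. Qed.

Lemma cis_neq0 t : cis t != 0.
Proof. by rewrite -normr_eq0 norm_cis oner_eq0. Qed.

Lemma cisN t : cis (- t) = (cis t)^-1.
Proof.
by apply: (mulfI (cis_neq0 t)); rewrite -cisD subrr cis0 divff // cis_neq0.
Qed.

Lemma cis_continuous : continuous cis.
Proof.
move=> t; apply: cplx_cvg => /=; (apply: continuous_comp; first by
  apply: cvgM; [exact: cvg_cst|exact: cvg_id]).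
- exact: continuous_cos.
- exact: continuous_sin.
Qed.

Lemma cisz (n : int) : cis n%:~R = 1.
Proof.
have cisn (m : nat) : cis m%:R = 1.
  elim: m => [|m IH]; first exact: cis0.
  by rewrite -natr1 cisD IH mul1r /cis mulr1 mulrC mulr_natr cos2pi sin2pi.
by case: n => n; rewrite ?NegzE ?mulrNz ?cisN -?pmulrn cisn ?invr1.
Qed.

(** Once the integer part is removed, cos (2 pi s) = 1 - 2 sin (pi s)^2 is less than 1 for 0 < s <
    1, because sin (pi s) > 0 there. *)
Lemma cis1P t : cis t = 1 -> exists n : int, t = n%:~R.
Proof.
move=> t1; exists (Num.floor t).
set s := t - (Num.floor t)%:~R.
have s1 : cis s = 1 by rewrite /s cisD cisN cisz t1 invr1 mulr1.
have /andP[s0 s1'] : 0 <= s < 1.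
  have /andP[] := floor_itv t; rewrite intrD rmorph1 /s => h1 h2; apply/andP; split; lra.
apply/eqP; rewrite -subr_eq0 -/s; apply: contraT => sn0.
have sp : 0 < s by rewrite lt_neqAle eq_sym sn0.
have : 0 < sin (pi * s).
  have pi0 := pi_gt0 R.
  apply: sin_gt0_pi; rewrite mulr_gt0 //= -[ltRHS]mulr1 ltr_pM2l //.
have : complex.Re (cis s) = 1 by rewrite s1.
rewrite /cis /= -mulrA mulr_natl mulr2n cosD -!expr2 cos2sin2.
set u := sin _ => h1 h2; have : 0 < u * u by exact: mulr_gt0.
nra.
Qed.

(* On the right half-plane this is the principal argument, in turns. *)
Definition harg (z : C) : R := atan (complex.Im z / complex.Re z) / (2 * pi).

Lemma hargE (z : C) : 0 < complex.Re z -> z = `|z| * cis (harg z).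
Proof.
case: z => x y /= x0.
have pi0 := pi_gt0 R.
rewrite /cis /harg /= mulrCA divff ?mulr1 ?mulf_neq0 ?pnatr_eq0 ?gt_eqF //.
set a := atan _.
have ca : cos a = (Num.sqrt (1 + (y / x) ^+ 2))^-1 by exact: cos_atan.
have sa : sin a = (y / x) * cos a.
  rewrite -[y / x]atanK -/a /tan divfK // ca invr_eq0 gt_eqF // sqrtr_gt0.
  by rewrite ltr_wpDr ?sqr_ge0.
have e : Num.sqrt (x ^+ 2 + y ^+ 2) = x * Num.sqrt (1 + (y / x) ^+ 2).
  have -> : x ^+ 2 + y ^+ 2 = x ^+ 2 * (1 + (y / x) ^+ 2).
    by field; rewrite gt_eqF.
  by rewrite sqrtrM ?sqr_ge0 // sqrtr_sqr gtr0_norm.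
have s0 : Num.sqrt (1 + (y / x) ^+ 2) != 0.
  by rewrite gt_eqF // sqrtr_gt0 ltr_wpDr ?sqr_ge0.
rewrite normc_def /= e sa ca; simpc.
congr (_ +i* _); field; rewrite ?s0 ?gt_eqF //.
Qed.

Lemma re_continuous : continuous (@complex.Re R : C -> R).
Proof. by move=> z; exact: (@re_cvg R C (nbhs z) _ id z (@cvg_id _ (nbhs z))). Qed.

Lemma im_continuous : continuous (@complex.Im R : C -> R).
Proof. by move=> z; exact: (@im_cvg R C (nbhs z) _ id z (@cvg_id _ (nbhs z))). Qed.

Lemma harg_continuous (z : C) : 0 < complex.Re z -> {for z, continuous harg}.
Proof.
move=> x0; apply: (@cvgM R C (nbhs z)); last exact: cvg_cst.
apply: (@continuous_comp C R R (fun z : C => complex.Im z / complex.Re z) atan).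
  apply: (@cvgM R C (nbhs z)); first exact: im_continuous.
  by apply: cvgV; [rewrite gt_eqF|exact: re_continuous].
exact: continuous_atan.
Qed.

(** A quarter turn either way, or a half turn, brings z into the right half-plane, where [harg]
    gives the argument. *)
Lemma arg_exists (z : C) : z != 0 -> exists t, z = `|z| * cis t.
Proof.
move=> z0.
have pi0 := pi_gt0 R.
have c4 : cis (1 / 4) = 'i%C.
  rewrite /cis; have -> : 2 * pi * (1 / 4) = pi / 2 :> R by field.
  by rewrite cos_pihalf sin_pihalf.
have c4' : cis (- (1 / 4)) = - 'i%C.
  by rewrite /cis mulrN cosN sinN; case: c4 => -> ->; apply/eqP; rewrite eq_complex /= oppr0 !eqxx.
have rot (w : C) (s : R) t : w * cis s = `|w * cis s| * cis t ->
    w = `|w| * cis (t - s).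
  rewrite normrM norm_cis mulr1 cisD cisN => h.
  by apply: (mulIf (cis_neq0 s)); rewrite h mulrA divfK ?cis_neq0.
have [x0|] := boolP (0 < complex.Re z); first by exists (harg z); exact: hargE.
rewrite -leNgt => x0.
have [y0|] := boolP (0 < complex.Im z).
  have e : 0 < complex.Re (z * cis (- (1 / 4))).
    by rewrite c4'; case: (z) y0 => a b /= b0; simpc => /=; lra.
  by exists (harg (z * cis (- (1/4))) - - (1/4)); apply: rot; exact: hargE.
rewrite -leNgt => y0.
have [y1|] := boolP (complex.Im z < 0).
  have e : 0 < complex.Re (z * cis (1 / 4)).
    by rewrite c4; case: (z) y1 => a b /= b0; simpc => /=; lra.
  by exists (harg (z * cis (1/4)) - (1/4)); apply: rot; exact: hargE.
rewrite -leNgt => y1; have yE : complex.Im z = 0 by lra.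
have x1 : complex.Re z < 0.
  rewrite lt_neqAle x0 andbT; apply: contra z0 => /eqP xE.
  by rewrite eq_complex xE yE !eqxx.
have e : 0 < complex.Re (z * cis (1 / 4 + 1 / 4)).
  by rewrite cisD c4; case: (z) x1 yE => a b /= a0 b0; simpc => /=; lra.
by exists (harg (z * cis (1/4+1/4)) - (1/4+1/4)); apply: rot; exact: hargE.
Qed.

End circle_arguments.

(** * Winding numbers *)

Section winding.
Context {R : realType}.
Local Notation C := (R[i]^o).
Implicit Types (g h : R -> C) (th : R -> R).

(** Paths and homotopies are defined on the whole line and frozen outside a segment by this
    retraction, which keeps subspace topologies out of the proofs. *)
Definition clamp (a b t : R) : R := Num.max a (Num.min b t).

Lemma clamp_continuous a b : continuous (clamp a b).
Proof.
move=> t; apply: (@continuous_max R R (cst a) (fun t => Num.min b t)).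
  exact: cst_continuous.
by apply: (@continuous_min R R (cst b) id); [exact: cst_continuous|exact: cvg_id].
Qed.

Lemma clamp_itv a b t : a <= b -> a <= clamp a b t <= b.
Proof.
move=> ab; rewrite /clamp le_max lexx /= ge_max ab ge_min lexx //.
Qed.

Lemma clamp_id a b t : a <= t <= b -> clamp a b t = t.
Proof. by move=> /andP[at_ tb]; rewrite /clamp min_r // max_r. Qed.

(** Two distinct integer values would force, by the intermediate value theorem, the value one half
    above the smaller of them. *)
Lemma int_valued_constant (f : R -> R) : continuous f ->
  (forall t, exists n : int, f t = n%:~R) -> forall x y, f x = f y.
Proof.
move=> fc fz.
suff h x y : x <= y -> f x = f y by move=> x y; case: (leP x y) => [|/ltW] /h.
move=> xy; apply: contrapT => /eqP fxy.
have [m fx] := fz x; have [n fy] := fz y.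
have key (u v : int) : (u%:~R : R) < v%:~R -> (u%:~R : R) + 1 <= v%:~R.
  by rewrite ltr_int -{2}[1](rmorph1 intr) -rmorphD /= ler_int lezD1.
have [c _ fcE] : exists2 c, c \in `[x, y] & f c = Num.min (f x) (f y) + 1/2.
  apply: IVT => //; first exact: continuous_subspaceT.
  rewrite fx fy in fxy *; move: fxy; rewrite neq_lt => /orP[] l; have k := key _ _ l.
    by rewrite min_l ?max_r ?(ltW l) //; apply/andP; split; lra.
  by rewrite min_r ?max_l ?(ltW l) //; apply/andP; split; lra.
have [k fk] := fz c.
have [l lE] : exists l : int, Num.min (f x) (f y) = l%:~R.
  by rewrite fx fy; case: leP => _; [exists m|exists n].
move: fcE; rewrite fk lE => e.
have l1 : (l%:~R : R) < k%:~R by lra.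
by have := key _ _ l1; lra.
Qed.

Definition is_arg g th := continuous th /\ forall t, g t = `|g t| * cis (th t).

(** The variation of an argument over [0, 1], counted in turns. It is a real number because g need
    not close up; for loops it is an integer ([winding_loop_int]). *)
Definition winding g (d : R) := exists2 th, is_arg g th & th 1 - th 0 = d.

Lemma cis_arg_eq (z : C) s t : z != 0 -> z = `|z| * cis s -> z = `|z| * cis t ->
  exists n : int, s - t = n%:~R.
Proof.
move=> z0 zs zt; apply: cis1P; rewrite cisD cisN.
have : cis s = cis t by apply: (mulfI (x := `|z|)); rewrite ?normr_eq0 // -zs.
by move=> ->; rewrite divff // cis_neq0.
Qed.

Lemma is_arg_unique g th th' : (forall t, g t != 0) -> is_arg g th -> is_arg g th' ->
  forall s t, th s - th' s = th t - th' t.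
Proof.
move=> g0 [tc tE] [tc' tE']; apply: (@int_valued_constant (th \- th')).
  by move=> t; apply: cvgB; [exact: tc|exact: tc'].
by move=> t; exact: (cis_arg_eq (g0 t) (tE t) (tE' t)).
Qed.

Lemma winding_unique g d d' : (forall t, g t != 0) ->
  winding g d -> winding g d' -> d = d'.
Proof.
move=> g0 [th gth <-] [th' gth' <-].
have := is_arg_unique g0 gth gth' 1 0; lra.
Qed.

(** The segment from 0 to t is cut into n + 1 equal pieces. The quotient of g at consecutive points
    lies in the right half-plane, so its [harg] is continuous in t, and the sum of these arguments
    is an argument of g t. *)
Lemma arg_local (g : R -> C) (b : R) : continuous g -> (forall t, g t != 0) -> 0 < b ->
  exists2 th, continuous th & forall t, - b <= t <= b -> g t = `|g t| * cis (th t).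
Proof.
move=> gc g0 b0.
pose P (n : nat) (s : R) := forall s', `|s' - s| <= b / n.+1%:R -> 0 < complex.Re (g s' / g s).
(* Uniform continuity in the form needed: one step length b / (n + 1) serves the whole segment. *)
have [n Pn] : exists n, forall s, `[-b, b]%classic s -> P n s.
  suff : \forall n \near \oo, `[-b, b]%classic `<=` P n.
    by move=> [n _ h]; exists n => s sb; exact: (h n (leqnn n)).
  have /compact_near_coveringP := @segment_compact R (-b) b; apply => s0 _.
  have : \forall z \near (s0, s0), 0 < complex.Re (g z.2 / g z.1).
    have : (fun z : R * R => complex.Re (g z.2 / g z.1)) @ (s0, s0) --> (1 : R).
      have -> : 1 = complex.Re (g s0 / g s0) by rewrite divff.
      apply: (@re_cvg R _ (nbhs (s0, s0)) _ (fun z : R * R => g z.2 / g z.1)).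
      apply: (@cvgM R[i] _ (nbhs (s0, s0))).
        by apply: (@cvg_comp _ _ _ (fun z : R * R => z.2) g); [exact: cvg_snd|exact: gc].
      apply: cvgV => //.
      by apply: (@cvg_comp _ _ _ (fun z : R * R => z.1) g); [exact: cvg_fst|exact: gc].
    by move=> /cvgr_gt; apply; exact: ltr01.
  move=> /nbhs_ballP[e /= e0 he].
  exists ([set s | `|s0 - s| < e / 2], [set n | b / n.+1%:R < e / 2]) => /=.
    split.
      by apply/nbhs_ballP; exists (e / 2) => //=; rewrite divr_gt0.
    have : (fun n : nat => b * n.+1%:R^-1) @ \oo --> b * 0.
      by apply: cvgM; [exact: cvg_cst|exact: cvg_harmonic].
    by rewrite mulr0 => /cvgr_lt; apply; exact: divr_gt0.
  move=> [s k] /= [h1 h2] s' h3; apply: (he (s, s')); split; rewrite /ball /=.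
    by apply: lt_le_trans h1 _; rewrite ler_pdivrMr //; lra.
  rewrite (splitr e) -(subrK s s0) -addrA.
  apply: le_lt_trans (ler_normD _ _) _; rewrite ltrD // distrC.
  exact: le_lt_trans h3 h2.
have [t0 t0E] := arg_exists (g0 0).
pose u (k : nat) t := k%:R / n.+1%:R * clamp (-b) b t.
have nb : - b <= b by lra.
have uc k : continuous (u k).
  by move=> t; apply: (@cvgM R _ (nbhs t)); [exact: cvg_cst|exact: clamp_continuous].
have uP k t : (k < n.+1)%N -> 0 < complex.Re (g (u k.+1 t) / g (u k t)).
  move=> kn; apply: Pn.
    rewrite /= in_itv /=.
    have /andP[c1 c2] := clamp_itv t nb.
    rewrite -ler_norml /u normrM ger0_norm; last by rewrite divr_ge0.
    have cb : `|clamp (-b) b t| <= b by rewrite ler_norml c1.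
    rewrite -[leRHS]mul1r ler_pM ?divr_ge0 //.
    by rewrite ler_pdivrMr // mul1r ler_nat ltnW.
  rewrite /u -mulrBl -mulrBl -[k.+1]addn1 natrD addrAC subrr add0r mul1r.
  rewrite normrM gtr0_norm ?invr_gt0 // mulrC ler_pM2r ?invr_gt0 //.
  by rewrite ler_norml clamp_itv.
exists (fun t => t0 + \sum_(k < n.+1) harg (g (u k.+1 t) / g (u k t))).
  move=> t; apply: cvgD; first exact: cvg_cst.
  apply: (cvg_big (op := +%R)) => [|k _]; first exact: add_continuous.
  apply: (@cvg_comp _ _ _ (fun t => g (u k.+1 t) / g (u k t)) harg); last first.
    exact: harg_continuous (uP _ _ (ltn_ord k)).
  apply: (@cvgM R[i] _ (nbhs t)).
    by apply: (@cvg_comp _ _ _ (u k.+1) g); [exact: uc|exact: gc].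
  apply: cvgV => //; by apply: (@cvg_comp _ _ _ (u k) g); [exact: uc|exact: gc].
move=> t tb.
have main m : (m <= n.+1)%N -> g (u m t) / `|g (u m t)| =
    cis (t0 + \sum_(k < m) harg (g (u k.+1 t) / g (u k t))).
  elim: m => [_|m IH mn].
    rewrite big_ord0 addr0 /u mul0r mul0r {1}t0E mulrC mulKf //.
    by rewrite normr_eq0.
  rewrite big_ord_recr /= addrA cisD -IH ?(ltnW mn) //.
  have := hargE (uP m t mn); set c := cis _.
  rewrite normrM normfV => e.
  have -> : c = (g (u m.+1 t) / g (u m t)) / (`|g (u m.+1 t)| / `|g (u m t)|).
    rewrite e mulrC mulKf // mulf_neq0 ?invr_neq0 ?normr_eq0 //.
  have a0 : `|g (u m t)| != 0 by rewrite normr_eq0.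
  have b0' : `|g (u m.+1 t)| != 0 by rewrite normr_eq0.
  move: (`|g (u m t)|) (`|g (u m.+1 t)|) (g0 (u m t)) a0 b0' => x y c0 a0 b0'.
  by field; rewrite a0 b0' c0.
have := main n.+1 (leqnn _); rewrite /u divff ?mul1r ?pnatr_eq0 // clamp_id // => <-.
by rewrite mulrC divfK // normr_eq0.
Qed.

(** Arguments on the segments [- n - 1, n + 1] are shifted by integers so as to agree at 0. On a
    common segment the difference of two of them is continuous, integer-valued and zero at 0, hence
    zero. *)
Lemma arg_lift g : continuous g -> (forall t, g t != 0) -> exists th, is_arg g th.
Proof.
move=> gc g0.
have /choice[f fP] (n : nat) : exists th, continuous th /\
    forall t, `|t| <= n.+1%:R -> g t = `|g t| * cis (th t).
  have [th thc thE] := arg_local gc g0 (ltr0Sn R n).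
  by exists th; split=> // t; rewrite ler_norml => /thE.
pose F n t := f n t - f n 0 + f 0%N 0.
have Fc n : continuous (F n).
  move=> t; apply: cvgD; last exact: cvg_cst.
  by apply: cvgB; [exact: (fP n).1|exact: cvg_cst].
have FE n t : `|t| <= n.+1%:R -> g t = `|g t| * cis (F n t).
  move=> tn; rewrite /F -addrA cisD.
  have z0 m : `|0 : R| <= m.+1%:R by rewrite normr0.
  have [k kE] := cis_arg_eq (g0 0) ((fP 0%N).2 0 (z0 _)) ((fP n).2 0 (z0 _)).
  by rewrite [- _ + _]addrC kE cisz mulr1; exact: (fP n).2.
have agree n m t : `|t| <= n.+1%:R -> `|t| <= m.+1%:R -> F n t = F m t.
  move=> tn tm; pose b := `|t|.
  have nb : - b <= b by rewrite /b; have := normr_ge0 t; lra.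
  have tb : - b <= t <= b by rewrite -ler_norml.
  have zb : - b <= 0 <= b by rewrite /b oppr_le0 normr_ge0.
  suff : F n (clamp (- b) b t) - F m (clamp (- b) b t) =
         F n (clamp (- b) b 0) - F m (clamp (- b) b 0).
    rewrite !clamp_id // /F (subrr (f n 0)) (subrr (f m 0)) subrr => h.
    by apply/eqP; rewrite -subr_eq0; apply/eqP.
  apply: (@int_valued_constant (fun s => F n (clamp (- b) b s) - F m (clamp (- b) b s))) => s.
    by apply: cvgB; apply: continuous_comp;
      [exact: clamp_continuous|exact: Fc|exact: clamp_continuous|exact: Fc].
  have sb : `|clamp (- b) b s| <= b by rewrite ler_norml clamp_itv.
  by apply: (cis_arg_eq (g0 (clamp (- b) b s))); apply: FE; apply: le_trans sb _.
have tr (t : R) : `|t| <= (Num.truncn `|t|).+1%:R by exact: ltW (truncnS_gt _).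
(* The index of the segment depends on t, but by [agree] one fixed segment, that of N, gives the
   same values on the unit ball around t0. *)
exists (fun t => F (Num.truncn `|t|) t); split=> [t0|t]; last exact: FE.
pose N := (Num.truncn `|t0|).+1.
have near_eq : \near t0, F N t0 = F (Num.truncn `|t0|) t0.
  have : \forall t \near t0, ball t0 1 t by exact: nbhsx_ballx.
  apply: filterS => t; rewrite /ball /= => tt0; apply: agree; last exact: tr.
  rewrite /N -natr1 -(subrK t0 t).
  apply: le_trans (ler_normD _ _) _; rewrite addrC lerD ?tr // distrC ltW //.
have := Fc N t0; rewrite /continuous_at {2}/N.
rewrite (_ : F _ t0 = F (Num.truncn `|t0|) t0); last first.
  by apply: agree => //; rewrite -/N; apply: le_trans (tr t0) _; rewrite ler_nat.
by apply: cvg_trans; apply: near_eq_cvg; apply: filterS near_eq => t ->.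
Qed.

Lemma winding_exists g : continuous g -> (forall t, g t != 0) -> exists d, winding g d.
Proof.
by move=> gc g0; have [th thP] := arg_lift gc g0; exists (th 1 - th 0), th.
Qed.

Lemma winding_loop_int g d : g 0 != 0 -> g 0 = g 1 -> winding g d ->
  exists n : int, d = n%:~R.
Proof.
move=> g0 g01 [th [_ thE] <-].
apply: (cis_arg_eq g0); [rewrite g01|]; exact: thE.
Qed.

Lemma windingM g h d e : winding g d -> winding h e -> winding (g \* h) (d + e).
Proof.
move=> [th [tc tE] <-] [th' [tc' tE'] <-]; exists (th \+ th') => /=; last by ring.
split=> [t|t /=]; first by apply: cvgD; [exact: tc|exact: tc'].
by rewrite {1}tE {1}tE' normrM cisD mulrACA.
Qed.

Lemma windingV g d : winding g d -> winding (fun t => (g t)^-1) (- d).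
Proof.
move=> [th [tc tE] <-]; exists (\- th) => /=; last by ring.
split=> [t|t /=]; first by apply: cvgN; exact: tc.
by rewrite {1}tE invfM normfV cisN.
Qed.

(** A nonzero integer variation makes the argument pass through some k + 1/2, and there g takes a
    nonpositive real value. *)
Lemma winding_slit g d : g 0 = g 1 -> g 0 != 0 ->
  (forall t x, 0 <= t <= 1 -> x <= 0 -> g t <> x%:C) ->
  winding g d -> d = 0.
Proof.
move=> g01 g0 gs wd; have [n nE] := winding_loop_int g0 g01 wd.
case: wd => th [tc tE] dE.
apply: contrapT => d0.
pose a := Num.min (th 0) (th 1); pose k := Num.floor (a + 1 / 2).
have ab : a + 1 <= Num.max (th 0) (th 1).
  have n0 : n != 0 by apply/eqP => n0; apply: d0; rewrite nE n0.
  have : (1 : R) <= `|n%:~R|.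
    by rewrite -intr_norm -[1](rmorph1 intr) ler_int -gtz0_ge1 normr_gt0.
  rewrite -nE -dE /a; case: (leP (th 0) (th 1)) => l.
    by rewrite ger0_norm ?subr_ge0 //; lra.
  by rewrite ltr0_norm ?subr_lt0 //; lra.
have [t t01 tv] : exists2 t, t \in `[0, 1] & th t = k%:~R + 1 / 2.
  apply: IVT => //; first exact: continuous_subspaceT.
  have := floor_itv (a + 1 / 2); rewrite intrD rmorph1 -/k -/a => /andP[k1 k2].
  by apply/andP; split; lra.
have c2 : cis (1 / 2 : R) = -1.
  rewrite /cis; have -> : 2 * pi * (1 / 2) = pi :> R by field.
  by rewrite cospi sinpi; apply/eqP; rewrite eq_complex /= oppr0 !eqxx.
move: t01; rewrite in_itv /= => t01.
apply: (gs t (- Num.sqrt (complex.Re (g t) ^+ 2 + complex.Im (g t) ^+ 2)) t01).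
  by rewrite oppr_le0 sqrtr_ge0.
by rewrite [LHS]tE tv cisD cisz c2 mul1r mulrN1 rmorphN /= normc_def.
Qed.

(* The segments from h to the ray of g avoid 0, so that h + s g is a homotopy up
   to rescaling. *)
Lemma winding_segment g h d e : g 0 = g 1 -> h 0 = h 1 -> g 0 != 0 ->
  (forall t, 0 <= t <= 1 -> g t != 0) ->
  (forall t s, 0 <= t <= 1 -> 0 <= s -> h t + s%:C * g t != 0) ->
  winding g d -> winding h e -> d = e.
Proof.
move=> g01 h01 g0 gn0 seg wg wh; apply/eqP; rewrite eq_sym -subr_eq0; apply/eqP.
apply: (@winding_slit (h \* (fun t => (g t)^-1))).
- by rewrite /= g01 h01.
- rewrite /= mulf_neq0 ?invr_neq0 //.
  by have := seg 0 0 _ (lexx 0); rewrite mul0r addr0; apply; rewrite lexx ler01.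
- move=> t x t01 x0 /= hg; have := seg t (- x) t01; rewrite oppr_ge0 => /(_ x0) /eqP; apply.
  by rewrite rmorphN /= -hg mulNr divfK ?gn0 // subrr.
- exact: windingM wh (windingV wg).
Qed.

(** For s close to s0 the quotient of the two loops has positive real part for all t in [0, 1], so
    no segment between them meets 0 and [winding_segment] applies. The winding number is thus
    locally constant in s, hence has zero derivative. *)
Lemma winding_homotopy (H : R -> R -> C) d0 d1 :
  continuous (fun z : R * R => H z.1 z.2) -> (forall t s, H t s != 0) ->
  (forall s, H 0 s = H 1 s) ->
  winding (H ^~ 0) d0 -> winding (H ^~ 1) d1 -> d0 = d1.
Proof.
move=> Hc H0 Hl w0 w1.
have Hs s : continuous (H ^~ s).
  move=> t; apply: (@continuous_comp _ _ _ (fun t => (t, s)) (fun z : R * R => H z.1 z.2)).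
    by apply: cvg_pairl; [exact: cvg_id|exact: cvg_cst].
  exact: Hc.
have /choice[d dP] s : exists d, winding (H ^~ s) d by apply: winding_exists.
have loc (s0 : R) : \forall s \near s0, d s = d s0.
  pose P (s t : R) := 0 < complex.Re (H t s / H t s0).
  have : \forall s \near s0, forall t, `[0, 1]%classic t -> P s t.
    apply: (tube (P := fun t s => P s t) (@segment_compact R 0 1)) => t0 _.
    have HH : (fun z : R * R => complex.Re (H z.1 z.2 / H z.1 s0)) @ (t0, s0) --> (1 : R).
      have -> : 1 = complex.Re (H t0 s0 / H t0 s0) by rewrite divff.
      apply: (@re_cvg R _ (nbhs (t0, s0)) _ (fun z : R * R => H z.1 z.2 / H z.1 s0)).
      apply: (@cvgM R[i] _ (nbhs (t0, s0))); first exact: (Hc (t0, s0)).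
      apply: cvgV => //.
      by apply: (@cvg_comp _ _ _ (fun z : R * R => z.1) (H ^~ s0)); [exact: cvg_fst|exact: Hs].
    exact: (cvgr_gt _ HH _ ltr01).
  apply: filterS => s sP; apply/esym; apply: (winding_segment _ _ _ _ _ (dP s0) (dP s)) => //.
  move=> t u t01 u0; apply/eqP => e.
  have := sP t; rewrite /= in_itv /= => /(_ t01); rewrite /P.
  have -> : H t s / H t s0 = (- u)%:C.
    move/eqP: e; rewrite addr_eq0 => /eqP ->.
    by rewrite mulNr mulfK // rmorphN.
  by rewrite /= ltNge oppr_le0 u0.
have e s t : d s = d t.
  apply: is_derive_0_is_cst => u.
  by apply: (near_eq_is_derive (f := cst (d u))) => //; apply: filterS (loc u) => x ->.
rewrite (winding_unique (fun t => H0 t 0) w0 (dP 0)).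
by rewrite (winding_unique (fun t => H0 t 1) w1 (dP 1)).
Qed.

End winding.

(** * Subspaces, and the circle as a subspace of the complex plane *)

Lemma set_type_cvg {T : Type} {X : topologicalType} {A : set X} {F : set_system T}
    {FF : Filter F} (g : T -> set_type A) (y : set_type A) :
  (fun t => val (g t)) @ F --> val y -> g @ F --> y.
Proof.
move=> gy W; rewrite nbhsE => -[U [[V oV <-] Vy] UW].
apply: filterS UW _; apply: gy; exact: open_nbhs_nbhs.
Qed.

Lemma val_continuous {X : topologicalType} (A : set X) :
  continuous (val : set_type A -> X).
Proof. exact: initial_continuous. Qed.

Section circle.
Context {R : realType}.
Local Notation C := (R[i]^o).

Lemma S1_norm (z : S1 R) : `|val z| = 1.
Proof. by case: z => z h; exact: (set_mem h). Qed.

Lemma S1_neq0 (z : S1 R) : val z != 0.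
Proof. by rewrite -normr_eq0 S1_norm oner_eq0. Qed.

Lemma normalize_subproof (z : C) :
  (if z == 0 then 1 else z / `|z|) \in @unit_circle R.
Proof.
rewrite inE /unit_circle /=; case: ifPn => [_|z0]; first by rewrite normr1.
by rewrite normrM normfV normr_id divff // normr_eq0.
Qed.

(** The phase of z; its value 1 at z = 0 is a default that makes the map total. *)
Definition normalize (z : C) : S1 R :=
  exist (fun z => z \in @unit_circle R) _ (normalize_subproof z).

Lemma val_normalize z : z != 0 -> val (normalize z) = z / `|z|.
Proof. by move=> /= /negbTE ->. Qed.

Lemma normalizeE z : `|z| = 1 -> val (normalize z) = z.
Proof.
move=> z1; rewrite val_normalize ?z1 ?invr1 ?mulr1 //.
by rewrite -normr_eq0 z1 oner_eq0.
Qed.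

Lemma phase_cvg {T} {F : set_system T} {FF : Filter F} (z : T -> C) (l : C) :
  l != 0 -> z @ F --> l -> (fun t => z t / `|z t| : C) @ F --> (l / `|l| : C).
Proof.
move=> l0 zl.
have nz : (fun t => `|z t| : C) @ F --> (`|l| : C) by exact: (cvg_norm zl).
apply: (@cvgM R[i] T F FF z (fun t => (`|z t|)^-1) l (`|l|^-1) zl).
by apply: (@cvgV R[i] T F FF (fun t => `|z t|) `|l| _ nz); rewrite normr_eq0.
Qed.

Lemma S1_cvg {T} {F : set_system T} {FF : Filter F} (z : T -> S1 R) (l : S1 R) :
  (fun t => val (z t) : C) @ F --> (val l : C) -> z @ F --> l.
Proof. exact: set_type_cvg. Qed.

Lemma normalize_cvg {T} {F : set_system T} {FF : Filter F} (z : T -> C) (l : C) :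
  l != 0 -> z @ F --> l -> (fun t => normalize (z t)) @ F --> normalize l.
Proof.
move=> l0 zl; apply: S1_cvg.
have vl : (val (normalize l) : C) = l / `|l| by exact: val_normalize.
have : \forall t \near F, z t != 0 by exact: (cvgr_neq0 _ zl).
move=> zn0; rewrite [X in _ --> X]vl; apply: cvg_trans (phase_cvg l0 zl).
by apply: near_eq_cvg; apply: filterS zn0 => t t0; exact: (esym (val_normalize t0)).
Qed.

Lemma val_S1_continuous : continuous (fun z : S1 R => val z : C).
Proof. exact: val_continuous. Qed.

Lemma expi_continuous : continuous (@expi R).
Proof. by move=> t; apply: S1_cvg; exact: cis_continuous. Qed.

Lemma expi_surj (z : S1 R) : exists t, z = expi t.
Proof.
have [t tE] := arg_exists (S1_neq0 z); exists t; apply: val_inj.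
by rewrite tE S1_norm mul1r.
Qed.

Lemma expi_shift t (n : int) : expi (t + n%:~R) = expi t :> S1 R.
Proof. by apply: val_inj; rewrite !val_expi cisD cisz mulr1. Qed.

Lemma expi_eq s t : expi s = expi t :> S1 R -> exists n : int, s = t + n%:~R.
Proof.
move=> /(congr1 val); rewrite !val_expi => st.
have [n nE] : exists n : int, s - t = n%:~R.
  by apply: cis1P; rewrite cisD cisN st divff // cis_neq0.
by exists n; rewrite -nE addrC subrK.
Qed.

End circle.

(** * Complex determinants of Lagrangian planes *)

Section complex_matrices.
Context {R : realType}.

Definition cplx_mx m n (P Q : 'M[R]_(m, n)) : 'M[R[i]]_(m, n) :=
  \matrix_(i, j) (P i j +i* Q i j).

Lemma cplx_mx_coef m n (P Q : 'M[R]_(m, n)) i j : cplx_mx P Q i j = P i j +i* Q i j.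
Proof. by rewrite mxE. Qed.

Lemma cplx_mxE m n (P Q : 'M[R]_(m, n)) :
  cplx_mx P Q = map_mx (real_complex R) P + 'i%C *: map_mx (real_complex R) Q.
Proof. by apply/matrixP => i j; rewrite !mxE; simpc. Qed.

Lemma complex_ofE n (C : 'M[R]_(n + n)) : complex_of C = cplx_mx (ulsubmx C) (dlsubmx C).
Proof. by rewrite cplx_mxE /complex_of -complexiE. Qed.

Lemma mul_cplx_mx m n p (A B : 'M[R]_(m, n)) (P Q : 'M[R]_(n, p)) :
  cplx_mx A B *m cplx_mx P Q = cplx_mx (A *m P - B *m Q) (A *m Q + B *m P).
Proof.
rewrite !cplx_mxE map_mxB map_mxD !map_mxM /= mulmxDl !mulmxDr.
rewrite -!scalemxAl -!scalemxAr scalerA -expr2 sqr_i scaleN1r scalerDr.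
by rewrite -!addrA; congr (_ + _); rewrite addrA addrC addrA -addrA addrCA.
Qed.

Lemma tr_cplx_mx m n (P Q : 'M[R]_(m, n)) : (cplx_mx P Q)^T = cplx_mx P^T Q^T.
Proof. by apply/matrixP => i j; rewrite !mxE. Qed.

Lemma det_mx2 (K : comNzRingType) (A : 'M[K]_2) :
  \det A = A 0 0 * A 1 1 - A 0 1 * A 1 0.
Proof.
rewrite (expand_det_row _ ord0) !big_ord_recl big_ord0 addr0 /cofactor !det_mx11 !mxE.
rewrite (_ : (-1) ^+ (ord0 + ord0) = 1) // (_ : (-1) ^+ (ord0 + lift ord0 ord0) = -1) //.
rewrite mul1r mulN1r mulrN.
by congr (A _ _ * A _ _ - A _ _ * A _ _); apply: val_inj.
Qed.

(* Right multiplication by J plays the role of -i: the columns of the complex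
   matrix Y + i J Y span the (-i)-eigenspace of J, so that cdet is C-multilinear
   and alternating in the rows of T. *)
Definition cdet m (J : 'M[R]_m) (Y : 'M[R]_(m, 2)) (T : 'M[R]_(2, m)) : R[i] :=
  \det (cplx_mx (T *m Y) (T *m J *m Y)).

(** The rows A T - B T J are those of (A + iB) T, where i acts on tangent vectors as - J. *)
Lemma cdet_mul m (J : 'M[R]_m) Y (A B : 'M[R]_2) T : J *m J = - 1%:M ->
  cdet J Y (A *m T - B *m (T *m J)) = \det (cplx_mx A B) * cdet J Y T.
Proof.
move=> JJ; rewrite /cdet -det_mulmx mul_cplx_mx; congr (\det (cplx_mx _ _)).
  by rewrite mulmxBl !mulmxA.
rewrite !mulmxBl -!mulmxA (mulmxA J J) JJ mulNmx mul1mx !mulmxN opprK.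
by rewrite !mulmxA.
Qed.

Lemma cdet_real m (J : 'M[R]_m) Y (A : 'M[R]_2) T :
  cdet J Y (A *m T) = (\det A)%:C * cdet J Y T.
Proof.
rewrite /cdet -det_map_mx -det_mulmx; congr (\det _).
by rewrite !cplx_mxE mulmxDr -scalemxAr -!map_mxM /= !mulmxA.
Qed.

(** The two complex coordinates of a vector that enter [cdet]; they are complex linear for the
    structure in which J acts as -i ([zetaJ]). *)
Definition zeta m (J : 'M[R]_m) (Y : 'M[R]_(m, 2)) (a : 'rV[R]_m) (j : 'I_2) : R[i] :=
  (a *m Y) 0 j +i* (a *m J *m Y) 0 j.

Lemma cdet_rows m (J : 'M[R]_m) Y (a b : 'rV[R]_m) :
  cdet J Y (col_mx a b : 'M[R]_(1 + 1, m)) =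
  zeta J Y a 0 * zeta J Y b 1 - zeta J Y a 1 * zeta J Y b 0.
Proof.
rewrite /cdet det_mx2 !cplx_mx_coef /zeta.
have h (Z : 'M[R]_(m, 2)) j : ((col_mx a b : 'M[R]_(1 + 1, m)) *m Z) 0 j = (a *m Z) 0 j /\
   ((col_mx a b : 'M[R]_(1 + 1, m)) *m Z) 1 j = (b *m Z) 0 j.
  rewrite mul_col_mx; split.
    by rewrite (_ : 0 = lshift 1 (0 : 'I_1)) ?col_mxEu //; apply: val_inj.
  by rewrite (_ : 1 = rshift 1 (0 : 'I_1)) ?col_mxEd //; apply: val_inj.
by rewrite -!mulmxA !(h _ _).1 !(h _ _).2.
Qed.

Lemma col_mx_rows m (T : 'M[R]_(2, m)) : T = col_mx (row 0 T) (row 1 T) :> 'M[R]_(1 + 1, m).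
Proof.
rewrite -[LHS](@vsubmxK _ 1 1); congr col_mx; apply/rowP => j; rewrite !mxE;
  by congr (T _ _); apply: val_inj.
Qed.

Lemma zetaD m (J : 'M[R]_m) Y a b j : zeta J Y (a + b) j = zeta J Y a j + zeta J Y b j.
Proof. by rewrite /zeta !mulmxDl !mxE; simpc. Qed.

Lemma zetaZ m (J : 'M[R]_m) Y r a j : zeta J Y (r *: a) j = r%:C * zeta J Y a j.
Proof. by rewrite /zeta -!scalemxAl !mxE; simpc. Qed.

Lemma zetaN m (J : 'M[R]_m) Y a j : zeta J Y (- a) j = - zeta J Y a j.
Proof. by rewrite -scaleN1r zetaZ rmorphN1 mulN1r. Qed.

Lemma zetaJ m (J : 'M[R]_m) Y a j : J *m J = - 1%:M ->
  zeta J Y (a *m J) j = - 'i%C * zeta J Y a j.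
Proof.
move=> JJ; rewrite /zeta -(mulmxA a J J) JJ mulmxN mulmx1 mulNmx !mxE; simpc.
by [].
Qed.

End complex_matrices.

(** * Compatible triples on one tangent space *)

Section compatible_triples.
Context {R : realType} {m : nat}.
Implicit Types (w J : 'M[R]_m) (a b : 'rV[R]_m).

Definition compatible_mx w J : Prop :=
  [/\ w^T = - w, J *m J = - 1%:M, (J *m w)^T = J *m w &
      forall u : 'rV[R]_m, u != 0 -> 0 < (u *m (J *m w) *m u^T) 0 0].

Context (w J : 'M[R]_m) (wJ : compatible_mx w J).

Let g := J *m w.
Definition ip w J (a b : 'rV[R]_m) : R := (a *m (J *m w) *m b^T) 0 0.

Lemma mulmx_trJ : w *m J^T = - (J *m w).
Proof.
have [w_alt JJ gT _] := wJ.
by move: gT; rewrite trmx_mul w_alt mulNmx => <-; rewrite opprK.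
Qed.

Lemma form_J_inv : J *m w *m J^T = w.
Proof.
have [w_alt JJ gT _] := wJ.
by rewrite -mulmxA mulmx_trJ mulmxN mulmxA JJ mulNmx mul1mx opprK.
Qed.

Lemma ipC a b : ip w J a b = ip w J b a.
Proof.
have [w_alt JJ gT _] := wJ.
by rewrite /ip -[in LHS](trmxK (_ *m b^T)) mxE trmx_mul trmxK trmx_mul gT mulmxA.
Qed.

Lemma ipDl a b c : ip w J (a + b) c = ip w J a c + ip w J b c.
Proof. by rewrite /ip !mulmxDl !mxE. Qed.

Lemma ipZl r a b : ip w J (r *: a) b = r * ip w J a b.
Proof. by rewrite /ip -!scalemxAl !mxE. Qed.

Lemma ipZr r a b : ip w J a (r *: b) = r * ip w J a b.
Proof. by rewrite ipC ipZl ipC. Qed.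

Lemma ipNl a b : ip w J (- a) b = - ip w J a b.
Proof. by rewrite -scaleN1r ipZl mulN1r. Qed.

Lemma ip_formJ a b : ip w J a (b *m J) = (a *m w *m b^T) 0 0.
Proof. by rewrite /ip trmx_mul !mulmxA -(mulmxA a J) -(mulmxA a) form_J_inv. Qed.

Lemma form_alt a b : (a *m w *m b^T) 0 0 = - (b *m w *m a^T) 0 0.
Proof.
have [w_alt JJ gT _] := wJ.
rewrite -[in LHS](trmxK (_ *m b^T)) mxE trmx_mul trmxK trmx_mul w_alt mulmxA.
by rewrite mulmxN mulNmx mxE.
Qed.

Lemma ipJ a b : ip w J (a *m J) (b *m J) = ip w J a b.
Proof.
by rewrite ip_formJ /ip -!mulmxA.
Qed.

Lemma ip_selfJ a : ip w J a (a *m J) = 0.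
Proof. by rewrite ip_formJ; have := form_alt a a; lra. Qed.

Lemma ip_gt0 a : a != 0 -> 0 < ip w J a a.
Proof. by have [_ _ _] := wJ; apply. Qed.

(** A Lagrangian plane is totally real. A kernel vector x + iy of the complex matrix would give x T
    = y T J, a vector lying both in the plane and in its image under J; these are orthogonal for the
    metric, so the vector is 0. *)
Lemma cdet_neq0 (Y : 'M[R]_(m, 2)) (T : 'M[R]_(2, m)) :
  (forall a, a *m Y = 0 -> a *m J *m Y = 0 -> a = 0) ->
  T *m w *m T^T = 0 -> row_free T -> cdet J Y T != 0.
Proof.
move=> Y0 Tw Tf; have [_ JJ _ _] := wJ.
apply/negP => /det0P[v v0 vT].
pose x : 'rV[R]_2 := \row_j complex.Re (v 0 j).
pose y : 'rV[R]_2 := \row_j complex.Im (v 0 j).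
have vE : v = cplx_mx x y.
  by apply/rowP => j; rewrite !mxE; case: (v 0 j).
move: vT; rewrite vE mul_cplx_mx => /matrixP h.
have h1 : x *m (T *m Y) - y *m (T *m J *m Y) = 0.
  by apply/rowP => j; have := h 0 j; rewrite !mxE => -[].
have h2 : x *m (T *m J *m Y) + y *m (T *m Y) = 0.
  by apply/rowP => j; have := h 0 j; rewrite !mxE => -[].
pose k := x *m T - y *m T *m J.
have k0 : k = 0.
  apply: Y0; first by rewrite /k mulmxBl -h1 !mulmxA.
  rewrite /k !mulmxBl -(mulmxA _ J J) JJ mulmxN mulmx1 mulNmx opprK -h2 !mulmxA //.
have TT p q : (p *m T *m w *m (q *m T)^T) 0 0 = 0.
  rewrite trmx_mul !mulmxA -(mulmxA p T w) -(mulmxA p (T *m w)) Tw mulmx0 mul0mx mxE //.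
have xT : x *m T = y *m T *m J by apply/eqP; rewrite -subr_eq0 -/k k0.
have yT : y *m T = 0.
  apply/eqP; apply: contraT => /ip_gt0; rewrite -ipJ -{1}xT ip_formJ.
  by rewrite TT ltxx.
have xT0 : x *m T = 0 by rewrite xT yT mul0mx.
have free0 (p : 'rV_2) : p *m T = 0 -> p = 0.
  by move=> pT; apply: (row_free_inj Tf); rewrite pT mul0mx.
move/eqP: v0; apply; rewrite vE (free0 x) // (free0 y) //.
by apply/rowP => j; rewrite !mxE.
Qed.

End compatible_triples.

(** * Gram-Schmidt for the Hermitian structure *)

Section gram_schmidt.
Context {R : realType} {m : nat}.
Variables (w J : 'M[R]_m) (wJ : compatible_mx w J).
Implicit Types (a b u : 'rV[R]_m) (T : 'M[R]_(2, m)) (Y : 'M[R]_(m, 2)).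
Local Notation ip := (ip w J).

Lemma ip_entry k l (T : 'M[R]_(k, m)) (S : 'M[R]_(l, m)) i j :
  (T *m (J *m w) *m S^T) i j = ip (row i T) (row j S).
Proof.
by rewrite /ip !mxE; apply: eq_bigr => x _; rewrite -row_mul !mxE.
Qed.

Lemma form_entry k l (T : 'M[R]_(k, m)) (S : 'M[R]_(l, m)) i j :
  (T *m w *m S^T) i j = (row i T *m w *m (row j S)^T) 0 0.
Proof. by rewrite !mxE; apply: eq_bigr => x _; rewrite -row_mul !mxE. Qed.

Definition orthonormal_lagrangian T : Prop :=
  T *m (J *m w) *m T^T = 1%:M /\ T *m w *m T^T = 0.

Definition gs_normal a : 'rV[R]_m := (Num.sqrt (ip a a))^-1 *: a.

(** The component along u J is removed as well, which projects off the complex line of u. The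
    outcome then spans a Lagrangian plane even when the rows of T do not. *)
Definition gs_ortho u b : 'rV[R]_m := b - ip b u *: u - ip b (u *m J) *: (u *m J).

Definition gram_schmidt T : 'M[R]_(2, m) :=
  let u := gs_normal (row 0 T) in
  col_mx u (gs_normal (gs_ortho u (row 1 T))) : 'M[R]_(1 + 1, m).

Lemma ip_gs_normal a : a != 0 -> ip (gs_normal a) (gs_normal a) = 1.
Proof.
move=> /(ip_gt0 wJ) a0; rewrite /gs_normal ipZl (ipZr wJ) mulrA -invfM -expr2.
by rewrite sqr_sqrtr ?ltW // mulVf // gt_eqF.
Qed.

Lemma ip_gs_ortho u b : ip u u = 1 -> ip (gs_ortho u b) u = 0.
Proof.
move=> uu; rewrite /gs_ortho !ipDl !ipNl !ipZl uu (ipC wJ (u *m J)) (ip_selfJ wJ).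
by rewrite mulr1 mulr0 oppr0 addr0 subrr.
Qed.

Lemma ip_gs_orthoJ u b : ip u u = 1 -> ip (gs_ortho u b) (u *m J) = 0.
Proof.
move=> uu; rewrite /gs_ortho !ipDl !ipNl !ipZl (ip_selfJ wJ) (ipJ wJ) uu.
by rewrite mulr1 mulr0 oppr0 addr0 subrr.
Qed.

Lemma row0_col_mx a b : row 0 (col_mx a b : 'M[R]_(1 + 1, m)) = a.
Proof.
have -> : (0 : 'I_2) = lshift 1 (0 : 'I_1) by apply: val_inj.
exact: etrans (rowKu (0 : 'I_1) a b) (row_id _ _).
Qed.

Lemma row1_col_mx a b : row 1 (col_mx a b : 'M[R]_(1 + 1, m)) = b.
Proof.
have -> : (1 : 'I_2) = rshift 1 (0 : 'I_1) by apply: val_inj.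
exact: etrans (rowKd (0 : 'I_1) a b) (row_id _ _).
Qed.

Lemma ord2P (P : 'I_2 -> Prop) : P 0 -> P 1 -> forall i, P i.
Proof.
move=> P0 P1 [[|[|//]] h].
  by rewrite (_ : Ordinal h = 0) //; apply: val_inj.
by rewrite (_ : Ordinal h = 1) //; apply: val_inj.
Qed.

Lemma gs_ortho_zeta u b Y j :
  zeta J Y (gs_ortho u b) j =
  zeta J Y b j - ((ip b u)%:C - 'i%C * (ip b (u *m J))%:C) * zeta J Y u j.
Proof.
have [_ JJ _ _] := wJ.
by rewrite /gs_ortho !zetaD !zetaN !zetaZ (zetaJ _ _ _ JJ); ring.
Qed.

(** Otherwise one row vanishes or the second is a complex multiple of the first, and the complex
    determinant is 0. *)
Lemma gs_nondeg Y T : cdet J Y T != 0 ->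
  row 0 T != 0 /\ gs_ortho (gs_normal (row 0 T)) (row 1 T) != 0.
Proof.
move=> d0.
have z0 j : zeta J Y 0 j = 0 by rewrite -(scale0r (0 : 'rV[R]_m)) zetaZ mul0r.
have a0 : row 0 T != 0.
  apply: contra d0 => /eqP a0.
  by rewrite (col_mx_rows T) cdet_rows a0 !z0 !mul0r subr0.
split=> //; apply: contra d0 => /eqP b0.
have zb j : zeta J Y (row 1 T) j = ((ip (row 1 T) (gs_normal (row 0 T)))%:C
    - 'i%C * (ip (row 1 T) (gs_normal (row 0 T) *m J))%:C) * zeta J Y (gs_normal (row 0 T)) j.
  by apply/eqP; rewrite -subr_eq0 -gs_ortho_zeta b0 z0.
rewrite (col_mx_rows T) cdet_rows !zb /gs_normal !zetaZ; apply/eqP; ring.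
Qed.

Lemma gram_schmidt_unitary T :
  row 0 T != 0 -> gs_ortho (gs_normal (row 0 T)) (row 1 T) != 0 ->
  orthonormal_lagrangian (gram_schmidt T).
Proof.
move=> a0 b0; rewrite /gram_schmidt /=.
set a := row 0 T in a0 b0 *; set b := row 1 T in b0 *.
set u := gs_normal a in b0 *; set c := gs_ortho u b in b0 *; set v := gs_normal c.
have uu : ip u u = 1 := ip_gs_normal a0.
have vv : ip v v = 1 := ip_gs_normal b0.
have vu : ip v u = 0 by rewrite /v /gs_normal ipZl ip_gs_ortho // mulr0.
have uv : ip u v = 0 by rewrite (ipC wJ).
have vuJ : ip v (u *m J) = 0 by rewrite /v /gs_normal ipZl ip_gs_orthoJ // mulr0.
have wE x y : (x *m w *m y^T) 0 0 = ip x (y *m J) by rewrite (ip_formJ wJ).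
have uuJ := ip_selfJ wJ u; have vvJ := ip_selfJ wJ v.
have uvJ : ip u (v *m J) = 0 by rewrite -wE (form_alt wJ) wE vuJ oppr0.
have e1 i : (1%:M : 'M[R]_2) i i = 1 by rewrite mxE eqxx.
split; apply/matrixP; apply: ord2P; apply: ord2P.
- by rewrite ip_entry row0_col_mx uu e1.
- by rewrite ip_entry row0_col_mx row1_col_mx uv mxE.
- by rewrite ip_entry row0_col_mx row1_col_mx vu mxE.
- by rewrite ip_entry row1_col_mx vv e1.
- by rewrite form_entry row0_col_mx wE uuJ mxE.
- by rewrite form_entry row0_col_mx row1_col_mx wE uvJ mxE.
- by rewrite form_entry row0_col_mx row1_col_mx wE vuJ mxE.
- by rewrite form_entry row1_col_mx wE vvJ mxE.
Qed.

(** Orthonormalization subtracts a complex multiple of the first row from the second and rescales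
    the rows by positive reals, so the phase of [cdet] is kept. *)
Lemma gram_schmidt_cdet Y T : cdet J Y T != 0 ->
  exists2 k : R, 0 < k & cdet J Y (gram_schmidt T) = k%:C * cdet J Y T.
Proof.
move=> /gs_nondeg[a0 b0]; rewrite /gram_schmidt /=.
set a := row 0 T in a0 b0 *; set b := row 1 T in b0 *.
set c := gs_ortho _ b in b0 *.
have sa : 0 < (Num.sqrt (ip a a))^-1 by rewrite invr_gt0 sqrtr_gt0 ip_gt0.
have sc : 0 < (Num.sqrt (ip c c))^-1 by rewrite invr_gt0 sqrtr_gt0 ip_gt0.
exists ((Num.sqrt (ip a a))^-1 * (Num.sqrt (ip c c))^-1); first exact: mulr_gt0.
rewrite (col_mx_rows T) !cdet_rows -/a -/b {2 4}/gs_normal !(zetaZ _ _ _ c).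
rewrite !gs_ortho_zeta /gs_normal !zetaZ rmorphM /=; ring.
Qed.

Lemma gram_schmidt_id T : orthonormal_lagrangian T -> gram_schmidt T = T.
Proof.
move=> [/matrixP u1 /matrixP u0].
have ip00 : ip (row 0 T) (row 0 T) = 1 by rewrite -ip_entry u1 mxE.
have ip10 : ip (row 1 T) (row 0 T) = 0 by rewrite -ip_entry u1 mxE.
have ip11 : ip (row 1 T) (row 1 T) = 1 by rewrite -ip_entry u1 mxE.
have w10 : (row 1 T *m w *m (row 0 T)^T) 0 0 = 0 by rewrite -form_entry u0 mxE.
have n0 a : ip a a = 1 -> gs_normal a = a.
  by move=> aa; rewrite /gs_normal aa sqrtr1 invr1 scale1r.
rewrite [RHS](col_mx_rows T) /gram_schmidt /= n0 //.
have -> : gs_ortho (row 0 T) (row 1 T) = row 1 T.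
  by rewrite /gs_ortho ip10 (ip_formJ wJ) w10 !scale0r !subr0.
by rewrite n0.
Qed.

(** On a Lagrangian plane the component along u J is already zero, so every operation is real and
    stays within the plane. *)
Lemma gram_schmidt_span Y T : cdet J Y T != 0 -> T *m w *m T^T = 0 ->
  exists2 A : 'M[R]_2, A \in unitmx & gram_schmidt T = A *m T.
Proof.
move=> d0 /matrixP T0.
have w10 : (row 1 T *m w *m (row 0 T)^T) 0 0 = 0 by rewrite -form_entry T0 mxE.
have [a0 b0] := gs_nondeg d0; move: b0; rewrite /gram_schmidt /=.
set a := row 0 T in a0 w10 *; set b := row 1 T in w10 *.
set c := gs_ortho _ b => b0.
pose s := (Num.sqrt (ip a a))^-1; pose r := (Num.sqrt (ip c c))^-1.
have sa : 0 < s by rewrite invr_gt0 sqrtr_gt0 ip_gt0.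
have sc : 0 < r by rewrite invr_gt0 sqrtr_gt0 ip_gt0.
have cE : c = b - (ip b (s *: a) * s) *: a.
  rewrite /c /gs_ortho /gs_normal -/s -scalemxAl (ipZr wJ s b (a *m J)).
  by rewrite (ip_formJ wJ) w10 mulr0 scale0r subr0 scalerA.
pose A : 'M[R]_2 := \matrix_(i, j)
  (if i == 0 then if j == 0 then s else 0
   else if j == 0 then - (r * (ip b (s *: a) * s)) else r).
exists A.
  by rewrite unitmxE det_mx2 !mxE /= mul0r subr0 unitfE mulf_neq0 ?gt_eqF.
have comb (p x : R) (c' d : 'rV[R]_m) j : (p *: (c' - x *: d)) 0 j = p * (c' 0 j - x * d 0 j).
  by rewrite !mxE.
have aE j : a 0 j = T 0 j by rewrite mxE.
have bE j : b 0 j = T 1 j by rewrite mxE.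
have l1 : lift ord0 ord0 = 1 :> 'I_2 by apply: val_inj.
have AE i j : (A *m T) i j = A i 0 * T 0 j + A i 1 * T 1 j.
  by rewrite mxE big_ord_recl big_ord1 l1.
rewrite /gs_normal -/s -/r cE.
apply/row_matrixP; apply: ord2P; rewrite ?row0_col_mx ?row1_col_mx;
  apply/rowP => j; rewrite [RHS]mxE AE.
  by rewrite [A _ _]mxE [A _ _]mxE /= mul0r addr0 mxE aE.
by rewrite [A _ _]mxE [A _ _]mxE /= comb aE bE; ring.
Qed.

End gram_schmidt.

(** * Unitary frames of one tangent space *)

Section unitary_frames.
Context {R : realType}.
Local Notation m := (2 + 2)%N.
Variables (w J : 'M[R]_(2 + 2)) (wJ : compatible_mx w J).
Implicit Types (u : 'M[R]_(2, 2 + 2)).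

Definition frame_of (J : 'M[R]_(2 + 2)) (u : 'M[R]_(2, 2 + 2)) : 'M[R]_(2 + 2) := col_mx u (- (u *m J)).

Lemma orthonormal_lagrangianP u :
  orthonormal_lagrangian w J u <->
  u *m (J *m w) *m u^T = 1%:M /\ u *m (J *m w) *m (- (u *m J))^T = 0.
Proof.
have [_ JJ _ _] := wJ.
have -> : u *m (J *m w) *m (- (u *m J))^T = - (u *m w *m u^T).
  rewrite linearN /= trmx_mul mulmxN; congr (- _).
  by rewrite !mulmxA -(mulmxA u J w) -(mulmxA u (J *m w)) form_J_inv.
rewrite /orthonormal_lagrangian; split=> -[h1 h2]; split=> //; first by rewrite h2 oppr0.
by rewrite -[LHS]opprK h2 oppr0.
Qed.

Lemma frame_of_orthogonal u : orthonormal_lagrangian w J u ->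
  frame_of J u *m (J *m w) *m (frame_of J u)^T = 1%:M.
Proof.
have [_ JJ gT _] := wJ.
move=> /orthonormal_lagrangianP[u1 u0].
rewrite /frame_of tr_col_mx mul_col_mx mul_col_row u1 u0.
have v0 : (- (u *m J)) *m (J *m w) *m u^T = 0.
  apply: trmx_inj; rewrite trmx0 -u0 trmx_mul trmxK trmx_mul gT mulmxA //.
have v1 : (- (u *m J)) *m (J *m w) *m (- (u *m J))^T = 1%:M.
  rewrite linearN /= mulmxN !mulNmx opprK trmx_mul -u1 !mulmxA; congr (_ *m _).
  by rewrite -!mulmxA (mulmxA J w) form_J_inv // JJ; congr (_ *m _).
by rewrite v0 v1 -scalar_mx_block.
Qed.

Lemma frame_of_unit u : orthonormal_lagrangian w J u -> frame_of J u \in unitmx.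
Proof.
by move=> /frame_of_orthogonal; rewrite -mulmxA => /mulmx1_unit[].
Qed.

(** Any b outside the span of a and a J is complex independent of a, which is all that Gram-Schmidt
    asks for. *)
Lemma orthonormal_lagrangian_exists : exists u, orthonormal_lagrangian w J u.
Proof.
pose a : 'rV[R]_(2 + 2) := delta_mx 0 0.
have a0 : a != 0.
  by apply/eqP => /rowP/(_ 0); rewrite !mxE /= => /eqP; rewrite oner_eq0.
pose A := col_mx a (a *m J).
have [b bA] : exists b : 'rV[R]_(2 + 2), ~~ (b <= A)%MS.
  have : ~~ ((1%:M : 'M[R]_(2 + 2)) <= A)%MS.
    apply/negP => /mxrankS; rewrite mxrank1.
    by move/leq_trans => /(_ _ (rank_leq_row A)).
  by move=> /row_subPn[i hi]; exists (row i 1%:M).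
pose T : 'M[R]_(2, 2 + 2) := (col_mx a b : 'M[R]_(1 + 1, 2 + 2)).
exists (gram_schmidt w J T); apply: gram_schmidt_unitary => //; rewrite /T row0_col_mx //.
rewrite row1_col_mx; apply: contra bA => /eqP.
rewrite /gs_ortho /gs_normal => /eqP; rewrite subr_eq0 => /eqP.
move=> /(canRL (subrK _)) ->.
rewrite -scalemxAl !scalerA; apply: addmx_sub; apply: scalemx_sub.
  by rewrite /A -addsmxE addsmxSr.
by rewrite /A -addsmxE addsmxSl.
Qed.

(** Y records inner products with the half u of a unitary frame. Then a J Y records those of a with
    the other half - u J, and a vector orthogonal to the whole frame is 0. *)
Lemma reference_exists : exists Y : 'M[R]_(2 + 2, 2),
  forall a : 'rV[R]_(2 + 2), a *m Y = 0 -> a *m J *m Y = 0 -> a = 0.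
Proof.
have [_ JJ gT _] := wJ.
have [u uP] := orthonormal_lagrangian_exists.
have E1 := frame_of_orthogonal uP.
exists (J *m w *m u^T) => a aY aJY.
have : a *m ((J *m w) *m (frame_of J u)^T) = 0.
  rewrite /frame_of tr_col_mx mul_mx_row [a *m _]mul_mx_row aY.
  rewrite (_ : a *m _ = 0) ?row_mx0 // linearN /= trmx_mul !mulmxN -[RHS]aJY.
  by rewrite !mulmxA -(mulmxA (a *m J) w) mulmx_trJ // mulmxN mulNmx opprK !mulmxA.
have : frame_of J u *m (J *m w *m (frame_of J u)^T) = 1%:M by rewrite mulmxA.
move=> /mulmx1C h aE; rewrite -[a]mulmx1 -[1%:M]h mulmxA aE mul0mx //.
Qed.

Lemma cdet_frame_neq0 Y u : (forall a : 'rV[R]_(2 + 2), a *m Y = 0 -> a *m J *m Y = 0 -> a = 0) ->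
  orthonormal_lagrangian w J u -> cdet J Y u != 0.
Proof.
move=> Y0 [u1 u0]; apply: (cdet_neq0 wJ Y0 u0).
by move: u1; rewrite -mulmxA => u1; apply/row_freeP; exists (J *m w *m u^T).
Qed.

(** Expanding u' in the frame of u gives u' = P u - Q u J, that is (P + iQ) u, and orthonormality of
    both frames makes P + iQ unitary. The blocks of C are transposed because a frame matrix is
    multiplied by C^T. *)
Lemma orthonormal_transition u (u' : 'M[R]_(2, 2 + 2)) :
  orthonormal_lagrangian w J u -> orthonormal_lagrangian w J u' ->
  exists C : 'M[R]_(2 + 2), [/\ Ugroup C, frame_of J u' = C^T *m frame_of J u &
    forall Y, cdet J Y u' = detC C * cdet J Y u].
Proof.
move=> uP uP'; have [_ JJ gT _] := wJ.
have E1 := frame_of_orthogonal uP; have E1' := frame_of_orthogonal uP'.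
pose P := u' *m (J *m w) *m u^T; pose Q := u' *m (J *m w) *m (- (u *m J))^T.
have uE : u' = P *m u - Q *m (u *m J).
  have : frame_of J u *m (J *m w *m (frame_of J u)^T) = 1%:M by rewrite mulmxA.
  move=> /mulmx1C h; have : u' *m (J *m w) *m (frame_of J u)^T *m frame_of J u = u'.
    by rewrite -[RHS]mulmx1 -h !mulmxA.
  by rewrite /frame_of tr_col_mx mul_mx_row mul_row_col -/P -/Q mulmxN => <-.
have vE : - (u' *m J) = - Q *m u + P *m (- (u *m J)).
  have -> : u' *m J = P *m (u *m J) + Q *m u.
    by rewrite {1}uE mulmxBl -!mulmxA JJ !mulmxN mulmx1 opprK.
  by rewrite opprD addrC mulNmx mulmxN.
pose C : 'M[R]_(2 + 2) := block_mx P^T (- Q^T) Q^T P^T.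
have CT : C^T = block_mx P Q (- Q) P.
  by rewrite tr_block_mx !trmxK linearN /= trmxK.
have CE : frame_of J u' = C^T *m frame_of J u.
  by rewrite CT /frame_of mul_block_col -vE {1}uE mulmxN.
have CC : C^T *m C = 1%:M.
  have : C^T *m (frame_of J u *m (J *m w) *m (frame_of J u)^T) *m C = 1%:M.
    by rewrite -E1' CE trmx_mul trmxK !mulmxA.
  by rewrite E1 mulmx1.
have uC : Ugroup C.
  split; first by rewrite /C block_mxKul block_mxKdl.
  rewrite complex_ofE /C block_mxKul block_mxKdl; apply/unitarymxP.
  have -> : (cplx_mx P^T Q^T ^t* )%sesqui = cplx_mx P (- Q).
    by apply/matrixP => i j; rewrite !mxE.
  rewrite mul_cplx_mx.
  move: (mulmx1C CC); rewrite CT mulmx_block (scalar_mx_block 2 2).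
  move=> /eq_block_mx[h1 h2 _ _].
  rewrite mulmxN opprK (_ : _ + Q^T *m Q = 1%:M); last first.
    by rewrite -h1 mulNmx mulmxN opprK.
  rewrite (_ : _ + Q^T *m P = 0); last first.
    by rewrite -[RHS]oppr0 -h2 opprD mulNmx opprK mulmxN.
  by apply/matrixP => i j; rewrite !mxE; case: (i == j).
exists C; split=> // Y.
rewrite {1}uE (cdet_mul Y P Q u JJ); congr (_ * _).
by rewrite /detC complex_ofE /C block_mxKul block_mxKdl -tr_cplx_mx det_tr.
Qed.

Lemma cdet_transition u (u' : 'M[R]_(2, 2 + 2)) (C : 'M[R]_(2 + 2)) Y : Ugroup C ->
  frame_of J u' = C^T *m frame_of J u -> cdet J Y u' = detC C * cdet J Y u.
Proof.
have [_ JJ _ _] := wJ.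
move=> [CE _]; set P := ulsubmx C in CE; set Q := dlsubmx C in CE.
have CT : C^T = block_mx P^T Q^T (- Q)^T P^T by rewrite {1}CE tr_block_mx.
rewrite CT /frame_of mul_block_col => /eq_col_mx[uE _].
have -> : u' = P^T *m u - Q^T *m (u *m J) by rewrite uE mulmxN.
rewrite (cdet_mul Y P^T Q^T u JJ) /detC complex_ofE; congr (_ * _).
by rewrite -tr_cplx_mx det_tr -/P -/Q.
Qed.

End unitary_frames.

(** * Limits of matrix expressions *)

Section matrix_limits.
Context {R : realType} {T : Type} {F : set_system T} {FF : Filter F}.
Local Notation C := (R[i]^o).

Lemma cvg_mxP m n (M : T -> 'M[R]_(m, n)) (L : 'M[R]_(m, n)) :
  M @ F --> L <-> forall i j, (fun t => M t i j) @ F --> L i j.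
Proof.
split=> [ML i j|h].
  exact: (cvg_comp _ _ ML (@coord_continuous R m n i j L)).
apply/cvg_ballP => e e0.
have : \forall t \near F, forall i j, ball (L i j) e (M t i j).
  apply: filter_forall => i; apply: filter_forall => j.
  by have /cvg_ballP := h i j; apply.
by apply: filterS => t Mt; split.
Qed.

Lemma mulmx_cvg m n p (A : T -> 'M[R]_(m, n)) (B : T -> 'M[R]_(n, p))
    (a : 'M[R]_(m, n)) (b : 'M[R]_(n, p)) :
  A @ F --> a -> B @ F --> b -> (fun t => A t *m B t) @ F --> a *m b.
Proof.
move=> /cvg_mxP Aa /cvg_mxP Bb; apply/cvg_mxP => i j.
rewrite mxE; under eq_fun do rewrite mxE.
by apply: (cvg_big (op := +%R)) => [|k _]; [exact: add_continuous|exact: cvgM].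
Qed.

Lemma trmx_cvg m n (A : T -> 'M[R]_(m, n)) (a : 'M[R]_(m, n)) : A @ F --> a -> (fun t => (A t)^T) @ F --> a^T.
Proof.
move=> /cvg_mxP Aa; apply/cvg_mxP => i j.
by rewrite mxE; under eq_fun do rewrite mxE; exact: Aa.
Qed.

Lemma usubmx_cvg m1 m2 n (A : T -> 'M[R]_(m1 + m2, n)) (a : 'M[R]_(m1 + m2, n)) :
  A @ F --> a -> (fun t => usubmx (A t)) @ F --> usubmx a.
Proof.
move=> /cvg_mxP Aa; apply/cvg_mxP => i j.
by rewrite mxE; under eq_fun do rewrite mxE; exact: Aa.
Qed.

Lemma col_mx_cvg m1 m2 n (A : T -> 'M[R]_(m1, n)) (B : T -> 'M[R]_(m2, n))
    (a : 'M[R]_(m1, n)) (b : 'M[R]_(m2, n)) :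
  A @ F --> a -> B @ F --> b -> (fun t => col_mx (A t) (B t)) @ F --> col_mx a b.
Proof.
move=> /cvg_mxP Aa /cvg_mxP Bb; apply/cvg_mxP => i j.
by rewrite mxE; under eq_fun do rewrite mxE; case: splitP => k _; [exact: Aa|exact: Bb].
Qed.

Lemma row_cvg m n (A : T -> 'M[R]_(m, n)) (a : 'M[R]_(m, n)) i :
  A @ F --> a -> (fun t => row i (A t)) @ F --> row i a.
Proof.
move=> /cvg_mxP Aa; apply/cvg_mxP => k j.
by rewrite mxE; under eq_fun do rewrite mxE; exact: Aa.
Qed.

Lemma det_cvg n (A : T -> 'M[R]_n) (a : 'M[R]_n) : A @ F --> a -> (fun t => \det (A t)) @ F --> \det a.
Proof.
move=> /cvg_mxP Aa; rewrite /determinant.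
apply: (cvg_big (op := +%R)) => [|s _]; first exact: add_continuous.
apply: cvgM; first exact: cvg_cst.
by apply: (@cvg_big R _ *%R 1 xpredT) => [|i _]; [exact: mul_continuous|exact: Aa].
Qed.

(** Near an invertible limit the inverse is the adjugate divided by the determinant, and both are
    polynomial in the entries. *)
Lemma invmx_cvg n (A : T -> 'M[R]_n) (a : 'M[R]_n) : a \in unitmx ->
  A @ F --> a -> (fun t => invmx (A t)) @ F --> invmx a.
Proof.
move=> au Aa; have da : \det a != 0 by move: au; rewrite unitmxE unitfE.
have dA := det_cvg Aa.
apply: (cvg_near_eq (f := fun t => (\det (A t))^-1 *: \adj (A t))).
  have : \forall t \near F, \det (A t) != 0 by exact: (cvgr_neq0 _ dA).
  by apply: filterS => t t0; rewrite /invmx unitmxE unitfE t0.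
rewrite /invmx au; apply/cvg_mxP => i j.
rewrite !mxE; under eq_fun do rewrite !mxE.
apply: cvgM; first exact: cvgV.
apply: cvgM; first exact: cvg_cst.
apply: det_cvg; apply/cvg_mxP => k l; rewrite !mxE; under eq_fun do rewrite !mxE.
by move/cvg_mxP: Aa; apply.
Qed.

Lemma scalemx_cvg m n (r : T -> R) (A : T -> 'M[R]_(m, n)) (s : R)
    (a : 'M[R]_(m, n)) :
  r @ F --> s -> A @ F --> a -> (fun t => r t *: A t) @ F --> s *: a.
Proof. by move=> rs Aa; exact: cvgZ. Qed.

Lemma cdet_cvg m (J : T -> 'M[R]_m) (Y : T -> 'M[R]_(m, 2)) (S : T -> 'M[R]_(2, m))
    (j : 'M[R]_m) (y : 'M[R]_(m, 2)) (s : 'M[R]_(2, m)) :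
  J @ F --> j -> Y @ F --> y -> S @ F --> s ->
  (fun t => cdet (J t) (Y t) (S t) : C) @ F --> (cdet j y s : C).
Proof.
move=> Jj Yy Ss; rewrite /cdet det_mx2; under eq_fun do rewrite det_mx2.
have PP := mulmx_cvg Ss Yy; have QQ := mulmx_cvg (mulmx_cvg Ss Jj) Yy.
have h a b : (fun t => cplx_mx (S t *m Y t) (S t *m J t *m Y t) a b : C) @ F -->
    (cplx_mx (s *m y) (s *m j *m y) a b : C).
  rewrite cplx_mx_coef; under eq_fun do rewrite cplx_mx_coef.
  by apply: cplx_cvg; [move/cvg_mxP: PP|move/cvg_mxP: QQ]; apply.
apply: (@cvgB R[i] (R[i]^o) T F FF); exact: (@cvgM R[i] T F FF).
Qed.

End matrix_limits.

(** * Loops of Lagrangian planes *)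

Section lagrangian_loops.
Context {R : realType}.
Local Notation C := (R[i]^o).

Lemma winding_cst (c : C) : c != 0 -> winding (fun=> c) 0.
Proof.
move=> /arg_exists[t tE]; exists (cst t); last by rewrite subrr.
by split=> // s; exact: cvg_cst.
Qed.

Lemma windingZ (c : C) (g : R -> C) d : c != 0 -> winding g d ->
  winding (fun t => c * g t) d.
Proof. by move=> /winding_cst wc wg; rewrite -[d]add0r; exact: (windingM wc wg). Qed.

(* With S = Q^-1 P one has det (P + iQ) = det Q * (det S - 1 + i tr S), and S is
   self-adjoint for the metric G: if its trace vanishes, its determinant is
   nonpositive. *)
Lemma det_transverse (P Q G : 'M[R]_2) (s : R) : Q \in unitmx -> G^T = G ->
  (forall u : 'rV[R]_2, u != 0 -> 0 < (u *m G *m u^T) 0 0) ->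
  (P *m G *m Q^T)^T = P *m G *m Q^T -> 0 <= s ->
  \det (cplx_mx P Q) != s%:C * (\det Q)%:C.
Proof.
move=> Qu GT Gpos PQ s0.
pose S := invmx Q *m P.
have PE : P = Q *m S by rewrite /S mulmxA mulmxV // mul1mx.
have SG : (S *m G)^T = S *m G.
  have e : S *m G = invmx Q *m (P *m G *m Q^T) *m (invmx Q)^T.
    by rewrite trmx_inv /S !mulmxA mulmxK // unitmx_tr.
  by move: e; set N := P *m G *m Q^T in PQ * => ->; rewrite trmx_mul trmx_mul trmxK PQ mulmxA.
have detE : \det (cplx_mx P Q) = (\det Q)%:C * \det (cplx_mx S 1%:M).
  rewrite -det_map_mx -det_mulmx; congr (\det _).
  by rewrite {1}PE !cplx_mxE mulmxDr -scalemxAr -!map_mxM /= mulmx1.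
have q0 : (\det Q)%:C != 0 :> R[i].
  by rewrite -(rmorph0 (real_complex R)) (inj_eq (@complexI R)) -unitfE -unitmxE.
rewrite detE mulrC (inj_eq (mulIf q0)).
clear PE detE; clearbody S.
rewrite det_mx2 !cplx_mx_coef !mxE /=; simpc; apply/negP; rewrite eq_complex /= => /andP[/eqP re /eqP im].
(* Now det S = 1 + s and tr S = 0. The vector (S 1 0, - S 0 0) is chosen because, for trace 0 and S
   G symmetric, its squared G-length equals - G 1 1 times det S; hence det S <= 0, a
   contradiction. *)
have [d0 uGu] : 0 < G 1 1 /\ 0 <= G 0 0 * S 1 0 ^+ 2 - 2 * G 0 1 * S 0 0 * S 1 0 + G 1 1 * S 0 0 ^+ 2.
  have G10 : G 1 0 = G 0 1 by rewrite -[in LHS]GT mxE.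
  have quad (u : 'rV[R]_2) : (u *m G *m u^T) 0 0 =
      G 0 0 * u 0 0 ^+ 2 + 2 * G 0 1 * u 0 0 * u 0 1 + G 1 1 * u 0 1 ^+ 2.
    have l1 : lift ord0 ord0 = 1 :> 'I_2 by apply: val_inj.
    have o0 : ord0 = 0 :> 'I_2 by apply: val_inj.
    rewrite mxE !big_ord_recl big_ord0 !mxE !big_ord_recl !big_ord0 l1 o0 G10; ring.
  pose u (x y : R) : 'rV[R]_2 := \row_j if j == 0 then x else y.
  split.
    have u0 : u 0 1 != 0.
      by apply/eqP => /rowP/(_ 1); rewrite !mxE /= => /eqP; rewrite oner_eq0.
    by have := Gpos _ u0; rewrite quad !mxE /=; lra.
  have [u0|/Gpos /ltW] := eqVneq (u (S 1 0) (- S 0 0)) 0.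
    have := congr1 (fun v : 'rV[R]_2 => v 0 0) u0; have := congr1 (fun v : 'rV[R]_2 => v 0 1) u0.
    rewrite !mxE /= => h1 h2; rewrite h2 (_ : S 0 0 = 0); last lra.
    by rewrite expr0n /= !mulr0 !addr0 subr0.
  by rewrite quad !mxE /=; lra.
have sym : S 0 0 * G 0 1 + S 0 1 * G 1 1 = S 1 0 * G 0 0 + S 1 1 * G 0 1.
  have l1 : lift ord0 ord0 = 1 :> 'I_2 by apply: val_inj.
  have o0 : ord0 = 0 :> 'I_2 by apply: val_inj.
  have G10 : G 1 0 = G 0 1 by rewrite -[in LHS]GT mxE.
  have := congr1 (fun A : 'M[R]_2 => A 1 0) SG.
  by rewrite !mxE !big_ord_recl !big_ord0 l1 o0 G10 !addr0.
move: re im d0 uGu sym.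
move: (S 0 0) (S 0 1) (S 1 0) (S 1 1) (G 0 0) (G 0 1) (G 1 1) => x y z t a b d re im d0 uGu sym.
have tE : t = - x by lra.
have dd : d * (- x ^+ 2 - y * z) <= 0.
  have yd : y * d = z * a + t * b - x * b by lra.
  have -> : d * (- x ^+ 2 - y * z) = - (a * z ^+ 2 - 2 * b * x * z + d * x ^+ 2).
    have -> : d * (- x ^+ 2 - y * z) = - (d * x ^+ 2) - z * (y * d) by ring.
    by rewrite yd tE; ring.
  lra.
have : - x ^+ 2 - y * z <= 0 by rewrite -(pmulr_rle0 _ d0).
move: re; rewrite tE; nra.
Qed.

Variables (w J : 'M[R]_(2 + 2)) (wJ : compatible_mx w J) (Y : 'M[R]_(2 + 2, 2)).
Hypothesis Y0 : forall a : 'rV[R]_(2 + 2), a *m Y = 0 -> a *m J *m Y = 0 -> a = 0.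

Definition lagrangian (w : 'M[R]_(2 + 2)) (T : 'M[R]_(2, 2 + 2)) : Prop :=
  T *m w *m T^T = 0 /\ row_free T.

Lemma lagrangian_cdet T : lagrangian w T -> cdet J Y T != 0.
Proof. by move=> [T0 Tf]; exact (cdet_neq0 wJ Y0 T0 Tf). Qed.

Lemma lagrangian_pair (a b : 'rV[R]_(2 + 2)) :
  lagrangian w (col_mx a b : 'M[R]_(1 + 1, 2 + 2)) <->
  [/\ (b *m w *m a^T) 0 0 = 0, a != 0 & ~~ (b <= a)%MS].
Proof.
have freeE : row_free (col_mx a b : 'M[R]_(1 + 1, 2 + 2)) = (a != 0) && ~~ (b <= a)%MS.
  apply/idP/andP => [fr|[a0 ba]].
    split; apply/negP.
      move=> /eqP a0; have : (row_mx 1%:M 0 : 'M[R]_(1, 1 + 1)) *m col_mx a b = 0 *m col_mx a b.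
        by rewrite mul_row_col a0 !mul0mx mulmx0 addr0.
      move/(row_free_inj fr)/rowP/(_ (lshift 1 0)); rewrite row_mxEl !mxE => /eqP.
      by rewrite oner_eq0.
    move=> /submxP[D bE]; have : (row_mx D (- 1%:M) : 'M[R]_(1, 1 + 1)) *m col_mx a b = 0 *m col_mx a b.
      by rewrite mul_row_col mulNmx mul1mx bE subrr mul0mx.
    move/(row_free_inj fr)/rowP/(_ (rshift 1 0)); rewrite row_mxEr !mxE => /eqP.
    by rewrite oppr_eq0 oner_eq0.
  apply: inj_row_free => v; rewrite -[v]hsubmxK mul_row_col => h.
  have v1 : rsubmx v = 0.
    apply/eqP; apply: contraR ba => v1.
    have v00 : (rsubmx v : 'M[R]_1) 0 0 != 0.
      by apply: contra v1 => /eqP v1; apply/eqP/rowP => j; rewrite !ord1 v1 mxE.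
    have e : rsubmx v *m b = (rsubmx v : 'M[R]_1) 0 0 *: b.
      by rewrite {1}[rsubmx v]mx11_scalar mul_scalar_mx.
    rewrite -(scalerK v00 b) -e; apply: scalemx_sub.
    by move: h => /(canRL (addKr _)) ->; rewrite addr0 -mulNmx submxMl.
  move: h; rewrite v1 mul0mx addr0 => h.
  have -> : lsubmx v = 0; last by rewrite row_mx0.
  apply/rowP => j; rewrite ord1 [RHS]mxE; apply/eqP; apply: contraR a0 => v0.
  move: h; rewrite [lsubmx v]mx11_scalar mul_scalar_mx => /eqP.
  by rewrite scaler_eq0 (negbTE v0).
rewrite /lagrangian freeE; split=> [[/matrixP T0 /andP[a0 ba]]|[ab a0 ba]].
  by split=> //; have := T0 1 0; rewrite form_entry row0_col_mx row1_col_mx => ->; rewrite mxE.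
split; last by rewrite a0.
have alt (x : 'rV[R]_(2 + 2)) : (x *m w *m x^T) 0 0 = 0 by have := form_alt wJ x x; lra.
apply/matrixP; apply: ord2P; apply: ord2P;
  rewrite [RHS]mxE form_entry ?row0_col_mx ?row1_col_mx ?alt ?ab //.
by rewrite (form_alt wJ) ab oppr0.
Qed.

Variables (A : R -> 'M[R]_(2 + 2)).
Hypotheses (Ac : continuous A) (Au : forall t, A t \in unitmx).

Definition lagrangian_loop (X : 'M[R]_(2, 2 + 2)) : Prop :=
  (forall t, lagrangian w (X *m A t)) /\ X *m A 0 = X *m A 1.

Lemma loop_mul (M : 'M[R]_2) X : M \in unitmx -> lagrangian_loop X -> lagrangian_loop (M *m X).
Proof.
move=> Mu [XA X01]; split=> [t|]; last by rewrite -!mulmxA X01.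
rewrite -mulmxA; case: (XA t); move: (X *m A t) => Z T0 Tf; split.
  by rewrite trmx_mul !mulmxA -(mulmxA M Z w) -(mulmxA M (Z *m w)) T0 mulmx0 mul0mx.
have Mf : row_free M by rewrite row_free_unit.
by rewrite /row_free mxrankMfree //.
Qed.

Lemma winding_loop_mul (M : 'M[R]_2) (X : 'M[R]_(2, 2 + 2)) d : M \in unitmx ->
  winding (fun t => cdet J Y (X *m A t) : C) d ->
  winding (fun t => cdet J Y (M *m X *m A t) : C) d.
Proof.
move=> Mu wX.
have q0 : (\det M)%:C != 0 :> R[i].
  by rewrite -(rmorph0 (real_complex R)) (inj_eq (@complexI R)) -unitfE -unitmxE.
have := windingZ q0 wX; congr (winding _ _); apply/funext => t.
by rewrite -mulmxA cdet_real.
Qed.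

(** With a common first row, [cdet] is additive in the second one: adding s times the loop of b to
    that of c gives the loop of c + s b. The planes (a, c + s b) are Lagrangian, since b and c are
    both symplectically orthogonal to a, and c lies outside the span of a and b. So
    [winding_segment] applies. *)
Lemma winding_common_row (a b c : 'rV[R]_(2 + 2)) d e :
  ~~ (c <= (col_mx a b : 'M[R]_(1 + 1, 2 + 2)))%MS ->
  lagrangian_loop (col_mx a b : 'M[R]_(1 + 1, 2 + 2)) ->
  lagrangian_loop (col_mx a c : 'M[R]_(1 + 1, 2 + 2)) ->
  winding (fun t => cdet J Y ((col_mx a b : 'M[R]_(1 + 1, 2 + 2)) *m A t) : C) d ->
  winding (fun t => cdet J Y ((col_mx a c : 'M[R]_(1 + 1, 2 + 2)) *m A t) : C) e ->
  d = e.
Proof.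
move=> cab [lb b01] [lc c01].
apply: winding_segment; rewrite ?b01 ?c01 //; first by apply: lagrangian_cdet.
  by move=> t _; apply: lagrangian_cdet.
move=> t s _ s0.
have -> : cdet J Y ((col_mx a c : 'M[R]_(1 + 1, 2 + 2)) *m A t) +
    s%:C * cdet J Y ((col_mx a b : 'M[R]_(1 + 1, 2 + 2)) *m A t) =
    cdet J Y ((col_mx a (c + s *: b) : 'M[R]_(1 + 1, 2 + 2)) *m A t).
  by rewrite !mul_col_mx !cdet_rows mulmxDl -scalemxAl !zetaD !zetaZ; ring.
apply: lagrangian_cdet; rewrite mul_col_mx; apply/lagrangian_pair.
have mulE (x : 'rV[R]_(2 + 2)) : (col_mx a x : 'M[R]_(2, 2 + 2)) *m A t =
    col_mx (a *m A t) (x *m A t) by exact: (mul_col_mx a x (A t)).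
have := lb t; have := lc t; rewrite !mulE.
move=> /lagrangian_pair[ac a0 _] /lagrangian_pair[ab _ _]; split=> //.
  by rewrite !mulmxDl -!scalemxAl mxE ac add0r mxE ab mulr0.
apply: contra cab; move/(submxMr (invmx (A t))); rewrite !mulmxK // => h.
have -> : c = (c + s *: b) - s *: b by rewrite addrK.
apply: addmx_sub.
  by apply: submx_trans h _; rewrite -addsmxE addsmxSl.
by rewrite -scaleNr scalemx_sub // -addsmxE addsmxSr.
Qed.

(** The second row is p turned by a right angle, which makes the determinant the squared length of
    p. *)
Lemma row_complete (p : 'rV[R]_2) : p != 0 -> exists q : 'rV[R]_2,
  (col_mx p q : 'M[R]_(1 + 1, 2)) \in unitmx.
Proof.
move=> p0; exists (\row_j if j == 0 then - p 0 1 else p 0 0).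
have h (q : 'rV[R]_2) : \det (col_mx p q : 'M[R]_(1 + 1, 2)) = p 0 0 * q 0 1 - p 0 1 * q 0 0.
  rewrite det_mx2; have e0 j : (col_mx p q : 'M[R]_(1 + 1, 2)) 0 j = p 0 j.
    by rewrite -[in RHS](row0_col_mx p q) [RHS]mxE.
  have e1 j : (col_mx p q : 'M[R]_(1 + 1, 2)) 1 j = q 0 j.
    by rewrite -[in RHS](row1_col_mx p q) [RHS]mxE.
  by rewrite !e0 !e1.
rewrite unitmxE h !mxE /= unitfE mulrN opprK.
apply: contra p0 => /eqP pp; have := sqr_ge0 (p 0 0); have := sqr_ge0 (p 0 1).
rewrite !expr2 => h1 h2; apply/eqP/rowP; apply: ord2P; rewrite mxE; apply/eqP;
  rewrite -sqrf_eq0 expr2; apply/eqP; lra.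
Qed.

(** In a unitary frame with first half u spanning L, K reads P u - Q u J. Transversality makes Q
    invertible, K being Lagrangian makes P Q^T symmetric, and [det_transverse] applies with G = 1.
    The determinant of the basis change from L to u enters squared, so the factor of det Q stays
    nonnegative. *)
Lemma cdet_transverse (L K : 'M[R]_(2, 2 + 2)) (s : R) :
  lagrangian w L -> lagrangian w K -> row_free (col_mx L K) -> 0 <= s ->
  cdet J Y K != (s * \det (K *m w *m L^T))%:C * cdet J Y L /\
  \det (K *m w *m L^T) != 0.
Proof.
move=> lL lK LK s0; have [_ JJ gT _] := wJ.
have dL := lagrangian_cdet lL.
have [M Mu uE] := gram_schmidt_span wJ dL lL.1.
have uP : orthonormal_lagrangian w J (gram_schmidt w J L).
  by have [h1 h2] := gs_nondeg wJ dL; exact: gram_schmidt_unitary.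
move: uE uP; move: (gram_schmidt w J L) => u uE uP.
have LE : L = invmx M *m u by rewrite uE mulKmx.
have E1 := frame_of_orthogonal wJ uP.
pose P := K *m (J *m w) *m u^T; pose Q := K *m (J *m w) *m (- (u *m J))^T.
have QE : Q = - (K *m w *m u^T).
  rewrite /Q linearN /= trmx_mul mulmxN; congr (- _).
  by rewrite !mulmxA -(mulmxA K J w) -(mulmxA K (J *m w)) (form_J_inv wJ).
have KE : K = P *m u - Q *m (u *m J).
  have : frame_of J u *m (J *m w *m (frame_of J u)^T) = 1%:M by rewrite mulmxA.
  move=> /mulmx1C h; have : K *m (J *m w) *m (frame_of J u)^T *m frame_of J u = K.
    by rewrite -[RHS]mulmx1 -h !mulmxA.
  by rewrite /frame_of tr_col_mx mul_mx_row mul_row_col -/P -/Q mulmxN => <-.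
clearbody P Q.
have Qu : Q \in unitmx.
  rewrite -row_free_unit; apply: inj_row_free => v vQ.
  have : (row_mx (- (v *m P *m M)) v : 'rV[R]_(2 + 2)) *m col_mx L K = 0 *m col_mx L K.
    rewrite mul_row_col LE mulNmx -!mulmxA mulKVmx // {1}KE mulmxBr mul0mx.
    by rewrite (mulmxA v Q) vQ mul0mx subr0 mulmxA addNr.
  move/(row_free_inj LK); rewrite -[RHS]row_mx0 => /eq_row_mx[_].
  by [].
have detKL : \det (K *m w *m L^T) = \det Q * \det (invmx M).
  rewrite LE trmx_mul mulmxA det_mulmx det_tr; congr (_ * _).
  by rewrite QE -scaleN1r detZ sqrrN expr1n mul1r.
have Q0 : \det Q != 0 by rewrite -unitfE -unitmxE.
have M0 : \det (invmx M) != 0 by rewrite -unitfE -unitmxE unitmx_inv.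
split; last by rewrite detKL mulf_neq0.
have [u1 u0] := uP.
have PQ : (P *m 1%:M *m Q^T)^T = P *m 1%:M *m Q^T.
  rewrite mulmx1 trmx_mul trmxK; apply/eqP; rewrite -subr_eq0; apply/eqP.
  have KT : K^T = u^T *m P^T - J^T *m u^T *m Q^T by rewrite {1}KE linearB /= !trmx_mul.
  rewrite -[RHS]oppr0 -lK.1 KT {1}KE.
  have e1 : P *m u *m w *m (u^T *m P^T) = 0.
    by rewrite !mulmxA -(mulmxA P u w) -(mulmxA P (u *m w)) u0 mulmx0 mul0mx.
  have e2 : Q *m (u *m J) *m w *m (J^T *m u^T *m Q^T) = 0.
    rewrite !mulmxA -(mulmxA Q u J) -(mulmxA Q (u *m J) w) -(mulmxA Q _ J^T).
    rewrite -(mulmxA u J w) -(mulmxA u (J *m w)) (form_J_inv wJ).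
    by rewrite -(mulmxA Q (u *m w)) u0 mulmx0 mul0mx.
  have e3 : P *m u *m w *m (J^T *m u^T *m Q^T) = - (P *m Q^T).
    rewrite !mulmxA -(mulmxA (P *m u) w) (mulmx_trJ wJ) mulmxN !mulNmx -(mulmxA P u).
    by rewrite -(mulmxA P _ u^T) u1 mulmx1.
  have e4 : Q *m (u *m J) *m w *m (u^T *m P^T) = Q *m P^T.
    by rewrite !mulmxA -(mulmxA Q u J) -(mulmxA Q (u *m J) w) -(mulmxA u J w) -(mulmxA Q _ u^T) u1 mulmx1.
  by rewrite !mulmxBl !mulmxBr e1 e2 e3 e4 subr0 sub0r opprK opprB.
have dKE : cdet J Y K = \det (cplx_mx P Q) * cdet J Y u by rewrite {1}KE (cdet_mul Y P Q u JJ).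
have dLE : cdet J Y L = (\det (invmx M))%:C * cdet J Y u by rewrite {1}LE cdet_real.
have du : cdet J Y u != 0.
  by apply: contra dL; rewrite dLE => /eqP ->; rewrite mulr0.
rewrite dKE dLE detKL mulrA (inj_eq (mulIf du)).
have -> : (s * (\det Q * \det (invmx M)))%:C * (\det (invmx M))%:C =
    (s * \det (invmx M) ^+ 2)%:C * (\det Q)%:C :> R[i].
  by rewrite -!rmorphM /=; congr (_%:C); ring.
apply: (@det_transverse P Q 1%:M) => //; first exact: trmx1.
  move=> v v0; rewrite mulmx1 mxE; under eq_bigr do rewrite mxE -expr2.
  rewrite lt_neqAle sumr_ge0 ?andbT; last by move=> i _; exact: sqr_ge0.
  apply: contra v0 => /eqP/esym/psumr_eq0P v0; apply/eqP/rowP => i; rewrite mxE; apply/eqP.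
  by rewrite -sqrf_eq0 v0 // => j _; exact: sqr_ge0.
by rewrite mulr_ge0 ?sqr_ge0.
Qed.

(* The planes X and X' either coincide, share a line (then a segment of loops joins
   them, see winding_common_row), or are transverse (then the ratio of the two
   determinants avoids a half line, see cdet_transverse). *)
Lemma winding_lagrangian_loops (X X' : 'M[R]_(2, 2 + 2)) d e :
  lagrangian_loop X -> lagrangian_loop X' ->
  winding (fun t => cdet J Y (X *m A t) : C) d ->
  winding (fun t => cdet J Y (X' *m A t) : C) e -> d = e.
Proof.
move=> lX lX' wX wX'.
have free Z : R -> lagrangian_loop Z -> row_free Z.
  by move=> t [lZ _]; have [_] := lZ t; rewrite /row_free mxrankMfree // row_free_unit.
have sub d' e' (Z Z' : 'M[R]_(2, 2 + 2)) : lagrangian_loop Z -> lagrangian_loop Z' ->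
    (Z' <= Z)%MS -> winding (fun t => cdet J Y (Z *m A t) : C) d' ->
    winding (fun t => cdet J Y (Z' *m A t) : C) e' -> d' = e'.
  move=> lZ lZ' /submxP[D ZE] wZ wZ'.
  have Du : D \in unitmx.
    rewrite -row_free_unit; have := free _ 0 lZ'; rewrite /row_free ZE => /eqP r.
    by rewrite eqn_leq rank_leq_row -{1}r mxrankM_maxl.
  apply: winding_unique (winding_loop_mul Du wZ) _; last by rewrite -ZE.
  by move=> t; apply: lagrangian_cdet; rewrite -ZE; have [] := lZ'.
have [XX'|] := boolP (row_free (col_mx X X')).
  pose k t := \det (X' *m A t *m w *m (X *m A t)^T).
  have XXA t : row_free (col_mx (X *m A t) (X' *m A t)).
    by rewrite -mul_col_mx /row_free mxrankMfree // row_free_unit.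
  have kc : continuous k.
    move=> t; apply: det_cvg.
    have h (Z : 'M[R]_(2, 2 + 2)) : (fun t => Z *m A t) @ t --> Z *m A t.
      by apply: mulmx_cvg; [exact: cvg_cst|exact: Ac].
    apply: mulmx_cvg; last exact: trmx_cvg.
    by apply: mulmx_cvg => //; exact: cvg_cst.
  have k0 t : k t != 0 by case: (cdet_transverse (lX.1 t) (lX'.1 t) (XXA t) (lexx 0)).
  (* k has no zero, so it keeps its sign. The constant k 0 can replace k t as factor of the first
     loop, the positive quotient being absorbed by the parameter of the segment. *)
  have ks t : 0 < k 0 / k t.
    rewrite lt_neqAle eq_sym mulf_neq0 ?invr_neq0 //=.
    rewrite leNgt; apply/negP => neg.
    have kneg : k 0 * k t < 0.
      have -> : k 0 * k t = k 0 / k t * k t ^+ 2 by field; rewrite k0.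
      by rewrite nmulr_rlt0 // exprn_even_gt0 //= k0.
    have : exists2 c, c \in `[Num.min 0 t, Num.max 0 t] & k c = 0.
      apply: IVT; rewrite ?ge_min ?le_max ?lexx //.
        exact: continuous_subspaceT.
      by case: (leP 0 t) => _; case: (leP (k 0) (k t)) => l; apply/andP; split; nra.
    by move=> [c _ kc0]; have := k0 c; rewrite kc0 eqxx.
  have c0 : - (k 0)%:C != 0 :> R[i].
    by rewrite oppr_eq0 -(rmorph0 (real_complex R)) (inj_eq (@complexI R)).
  apply: (winding_segment _ _ _ _ _ (windingZ c0 wX) wX') => /=.
  - by rewrite lX.2.
  - by rewrite lX'.2.
  - by rewrite mulf_neq0 //; apply: lagrangian_cdet; exact: lX.1.
  - by move=> t _; rewrite mulf_neq0 //; apply: lagrangian_cdet; exact: lX.1.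
  - move=> t s _ s0.
    have s1 : 0 <= s * (k 0 / k t) by rewrite mulr_ge0 // ltW.
    have [h _] := cdet_transverse (lX.1 t) (lX'.1 t) (XXA t) s1.
    rewrite mulrA mulrN mulNr -rmorphM /= subr_eq0; move: h; rewrite -/(k t).
    by rewrite -mulrA divfK.
move=> nfree.
have [v vX v0] : exists2 v : 'rV[R]_(2 + 2), v *m col_mx X X' = 0 & v != 0.
  apply: contrapT => nv; move/negP: nfree; apply.
  apply: inj_row_free => v vX; apply: contrapT => /eqP v0; apply: nv; by exists v.
(* A linear dependency between the two bases yields a nonzero common vector p X = q X'. It is made
   the first row of a new basis of each plane. *)
pose p : 'rV[R]_2 := lsubmx v; pose q : 'rV[R]_2 := - rsubmx v.
have pq : p *m X = q *m X'.
  move: vX; rewrite -[v]hsubmxK mul_row_col => /eqP; rewrite addr_eq0 => /eqP.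
  by rewrite -mulNmx.
have inj (r : 'rV[R]_2) Z : lagrangian_loop Z -> r *m Z = 0 -> r = 0.
  by move=> lZ rZ; apply: (row_free_inj (free _ 0 lZ)); rewrite rZ mul0mx.
have p0 : p != 0.
  apply: contra v0 => /eqP p0.
  have q0 : q = 0 by apply: inj lX' _; rewrite -pq p0 mul0mx.
  by rewrite -[v]hsubmxK -/p p0 (_ : rsubmx v = 0) ?row_mx0 // -[LHS]opprK -/q q0 oppr0.
have q0 : q != 0.
  by apply: contra p0 => /eqP q0; apply/eqP; apply: inj lX _; rewrite pq q0 mul0mx.
have [p' Mp] := row_complete p0; have [q' Mq] := row_complete q0.
have XE : (col_mx p p' : 'M[R]_(1 + 1, 2)) *m X = col_mx (p *m X) (p' *m X) := mul_col_mx _ _ _.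
have X'E : (col_mx q q' : 'M[R]_(1 + 1, 2)) *m X' = col_mx (p *m X) (q' *m X').
  by rewrite pq; exact: mul_col_mx.
have lX1 := loop_mul Mp lX; have lX1' := loop_mul Mq lX'.
have wX1 := winding_loop_mul Mp wX; have wX1' := winding_loop_mul Mq wX'.
move: lX1 lX1' wX1 wX1'; rewrite XE X'E => lX1 lX1' wX1 wX1'.
have [sub1|] := boolP (q' *m X' <= (col_mx (p *m X) (p' *m X) : 'M[R]_(1 + 1, 2 + 2)))%MS.
  apply: sub lX1 lX1' _ wX1 wX1'.
  rewrite /is_true; apply: (etrans (@col_mx_sub R 1 1 (2 + 2) (p *m X) (q' *m X') 2 (col_mx (p *m X) (p' *m X)))).
  rewrite sub1 andbT.
  by apply: submx_trans (addsmxSl (p *m X) (p' *m X)) _; rewrite addsmxE.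
by move=> nsub; exact: winding_common_row nsub lX1 lX1' wX1 wX1'.
Qed.

End lagrangian_loops.

Lemma near_comp {T U : topologicalType} (f : T -> U) x (P : U -> Prop) :
  {for x, continuous f} -> (\forall z \near f x, P z) -> \forall y \near x, P (f y).
Proof. by move=> fc; exact: fc. Qed.

Lemma pairl_continuous {T U : topologicalType} (y : U) : continuous (fun s : T => (s, y)).
Proof. by move=> z; apply: (@cvg_pairl _ _ _ (nbhs z) _ id (cst y)); [exact: cvg_id|exact: cvg_cst]. Qed.

Lemma pairr_continuous {T U : topologicalType} (y : U) : continuous (fun s : T => (y, s)).
Proof. by move=> z; apply: (@cvg_pairl _ _ _ (nbhs z) _ (cst y) id); [exact: cvg_cst|exact: cvg_id]. Qed.

(** * Directional derivatives of composites and of smooth maps *)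

Section directional_derivatives.
Context {R : realType}.

Lemma derive_comp (U V W : normedModType R) (g : U -> V) (f : V -> W) x v :
  differentiable g x -> differentiable f (g x) ->
  'D_v (f \o g) x = 'D_('D_v g x) f (g x).
Proof.
move=> dg df; rewrite !deriveE //; last exact: differentiable_comp.
by rewrite diff_comp.
Qed.

Lemma derive_pair (U V W : normedModType R) (g : U -> V) (f : U -> W) x v :
  differentiable g x -> differentiable f x ->
  'D_v (fun y => (g y, f y)) x = ('D_v g x, 'D_v f x).
Proof.
move=> dg df; rewrite !deriveE //; last exact: differentiable_pair.
by rewrite diff_pair.
Qed.

Lemma Ck_differentiable (V W : normedModType R) (U : set V) (f : V -> W) x :
  smooth_on U f -> U x -> differentiable f x.
Proof. by move=> /(_ 1%N)[h _]; exact: h. Qed.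

Lemma smooth_derive_continuous (V W : normedModType R) (U : set V) (f : V -> W) x v :
  smooth_on U f -> U x -> {for x, continuous ('D_v f)}.
Proof. by move=> /(_ 1%N)[_ /(_ v) h] Ux; apply: h; exact: mem_set. Qed.

End directional_derivatives.

(** * Charts and the action in charts *)

Section charts.
Context {R : realType} {M : topologicalType} {m : nat} (X : @manifold R M m).
Implicit Types (c : @chart R M m).

Lemma cmapP c q : cdom c q -> cimg c (cmap c q).
Proof. by exists q. Qed.

Lemma cinv_dom c x : cimg c x -> cdom c (cinv c x).
Proof. by move=> [q cq <-]; rewrite cmapK. Qed.

Lemma cinvK c x : cimg c x -> cmap c (cinv c x) = x.
Proof. by move=> [q cq <-]; rewrite cmapK. Qed.

Lemma cmap_cvg c q : cdom c q -> {for q, continuous (cmap c)}.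
Proof. by move=> cq; apply: cmap_continuous; exact: mem_set. Qed.

Lemma cinv_cvg c x : cimg c x -> {for x, continuous (cinv c)}.
Proof. by move=> cx; apply: cinv_continuous; exact: mem_set. Qed.

Lemma near_cimg c x : cimg c x -> \forall y \near x, cimg c y.
Proof. by move=> cx; apply: open_nbhs_nbhs; split=> //; exact: cimg_open. Qed.

Lemma near_cdom c q : cdom c q -> \forall p \near q, cdom c p.
Proof. by move=> cq; apply: open_nbhs_nbhs; split=> //; exact: cdom_open. Qed.

Lemma near_cinv_dom c c' x : cimg c x -> cdom c' (cinv c x) ->
  \forall y \near x, cimg c y /\ cdom c' (cinv c y).
Proof.
move=> cx c'x; have h := cinv_cvg cx (near_cdom c'x).
by apply: filterS2 (near_cimg cx) h.
Qed.

Definition transition c c' : 'rV[R]_m -> 'rV[R]_m := cmap c' \o cinv c.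

Lemma overlapP c c' x : cimg c x -> cdom c' (cinv c x) ->
  (cmap c @` (cdom c `&` cdom c')) x.
Proof. by move=> cx c'x; exists (cinv c x); [split=> //; exact: cinv_dom|exact: cinvK]. Qed.

Lemma transition_smooth c c' : atlas X c -> atlas X c' ->
  smooth_on (cmap c @` (cdom c `&` cdom c')) (transition c c').
Proof. exact: atlas_smooth. Qed.

Lemma transition_differentiable c c' x : atlas X c -> atlas X c' ->
  cimg c x -> cdom c' (cinv c x) -> differentiable (transition c c') x.
Proof.
move=> Xc Xc' cx c'x.
exact: Ck_differentiable (transition_smooth Xc Xc') (overlapP cx c'x).
Qed.

Let ch q := chart_at X q.
Let Xch q : atlas X (ch q) := chart_at_atlas X q.
Let chd q : cdom (ch q) q := chart_at_dom X q.

Lemma derive_transition c c' c'' x v : atlas X c -> atlas X c' -> atlas X c'' ->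
  cimg c x -> cdom c' (cinv c x) -> cdom c'' (cinv c x) ->
  'D_v (transition c c'') x = 'D_('D_v (transition c c') x) (transition c' c'') (transition c c' x).
Proof.
move=> Xc Xc' Xc'' cx c'x c''x.
rewrite -derive_comp; first last.
- by apply: transition_differentiable; rewrite ?cmapK //; exact: cmapP.
- exact: transition_differentiable.
apply: near_eq_derive; apply: filterS (near_cinv_dom cx c'x) => y [cy c'y] /=.
by rewrite /transition /= cmapK.
Qed.

Lemma tchange_mul c c' x v : atlas X c -> atlas X c' -> cimg c x -> cdom c' (cinv c x) ->
  v *m tchange X c x = 'D_v (transition c c') x *m tchange X c' (transition c c' x).
Proof.
move=> Xc Xc' cx c'x; rewrite /tchange /dinto.
have e : cinv c' (transition c c' x) = cinv c x by rewrite /transition /= cmapK.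
rewrite e -!deriveEjacobian; first exact: derive_transition.
  by apply: transition_differentiable; rewrite ?e //; exact: cmapP.
by apply: (@transition_differentiable c' (ch (cinv c x))); rewrite ?e //; exact: cmapP.
Qed.

Lemma tchange_unit c x : atlas X c -> cimg c x -> tchange X c x \in unitmx.
Proof.
move=> Xc cx; set q := cinv c x.
have cq : cdom c q by exact: cinv_dom.
pose A := jacobian (transition (ch q) c) (cmap (ch q) q).
have chx : cimg (ch q) (cmap (ch q) q) by exact: cmapP.
have e : cinv (ch q) (cmap (ch q) q) = q by rewrite cmapK.
have ec : transition (ch q) c (cmap (ch q) q) = x by rewrite /transition /= e cinvK.
have h : A *m tchange X c x = 1%:M.
  apply/row_matrixP => i; rewrite !rowE mulmxA mulmx1.
  rewrite /A -deriveEjacobian; last by apply: transition_differentiable; rewrite ?e.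
  have := @tchange_mul (ch q) c (cmap (ch q) q) (delta_mx 0 i) (Xch q) Xc chx.
  rewrite e => /(_ cq); rewrite ec => <-.
  rewrite /tchange /dinto e -deriveEjacobian; last first.
    by apply: (@transition_differentiable (ch q) (ch q)); rewrite ?e.
  rewrite -[RHS](@derive_id _ _ (cmap (ch q) q) (delta_mx 0 i)).
  apply: near_eq_derive; apply: filterS (near_cimg chx) => y cy /=.
  exact: cinvK.
by have [] := mulmx1_unit h.
Qed.

(** [dinto] is written in the preferred chart of f x, which may jump with x. The right-hand side
    isolates the derivative in a fixed chart, where continuity can be used. *)
Lemma dinto_mul k (f : 'rV[R]_k -> M) x c v : {for x, continuous f} ->
  (forall c', atlas X c' -> cdom c' (f x) -> differentiable (cmap c' \o f) x) ->
  atlas X c -> cdom c (f x) ->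
  v *m dinto X f x = 'D_v (cmap c \o f) x *m tchange X c (cmap c (f x)).
Proof.
move=> fc df Xc cfx; rewrite /tchange /dinto cmapK //.
have d1 := df _ (Xch _) (chd (f x)).
have d2 := df _ Xc cfx.
have d3 : differentiable (transition c (ch (f x))) (cmap c (f x)).
  by apply: (transition_differentiable Xc (Xch _)); rewrite ?cmapK //; exact: cmapP.
rewrite -(deriveEjacobian _ d1) -(deriveEjacobian _ d3).
rewrite -(@derive_comp _ _ _ _ (cmap c \o f) (transition c (ch (f x))) _ _ d2 d3).
apply: near_eq_derive; apply: filterS (near_comp fc (near_cdom cfx)) => y cy.
by rewrite /transition /= cmapK.
Qed.

Lemma dfrom_mul k (F : M -> 'rV[R]_k) c x v : smooth_from X F -> atlas X c -> cimg c x ->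
  v *m tchange X c x *m dfrom X F (cinv c x) = 'D_v (F \o cinv c) x.
Proof.
move=> sF Xc cx; set q := cinv c x.
have dF c' y : atlas X c' -> cimg c' y -> differentiable (F \o cinv c') y.
  by move=> Xc' c'y; exact: Ck_differentiable (sF _ Xc') c'y.
have cq : cdom (ch q) (cinv c x) by exact: chd.
have d1 : differentiable (transition c (ch q)) x.
  exact: (transition_differentiable Xc (Xch q) cx cq).
have d2 : differentiable (F \o cinv (ch q)) (transition c (ch q) x).
  by apply: dF => //; exact: cmapP.
rewrite /dfrom /tchange /dinto -/q -(deriveEjacobian _ d1) -(deriveEjacobian _ d2).
rewrite -(@derive_comp _ _ _ _ _ _ _ _ d1 d2).
apply: near_eq_derive; apply: filterS (near_cinv_dom cx cq) => y [cy c'y] /=.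
by rewrite cmapK.
Qed.

End charts.

(** * Vanishing derivatives and locally constant functions on an interval *)

Section locally_constant.
Context {R : realType}.

Lemma zero_derive_constant (g : R -> R) (a b : R) :
  (forall t, a < t < b -> is_derive t 1 g 0) ->
  forall s t, a < s < b -> a < t < b -> g s = g t.
Proof.
move=> gd.
suff h s t : a < s < b -> a < t < b -> s <= t -> g s = g t.
  by move=> s t sb tb; case: (leP s t) => [|/ltW] st; [apply: h|apply/esym/h].
move=> /andP[as_ sb] /andP[at_ tb] st.
have [] := @MVT_segment R g (cst 0) s t st.
- move=> x; rewrite in_itv /= => /andP[sx xt]; apply: gd.
  by rewrite (lt_trans as_ sx) (lt_trans xt tb).
- apply: derivable_within_continuous => x; rewrite in_itv /= => /andP[sx xt].
  by have [] := gd x _ => //; rewrite (lt_le_trans as_ sx) (le_lt_trans xt tb).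
by move=> x _ /eqP; rewrite mul0r subr_eq0 => /eqP.
Qed.

(** The indicator of the set where h takes the value h t is locally constant, so its derivative is 0
    and the mean value theorem makes it constant; T carries no structure. *)
Lemma locally_constant_constant {T : Type} (h : R -> T) (a b : R) :
  (forall t, a < t < b -> \forall s \near t, h s = h t) ->
  forall s t, a < s < b -> a < t < b -> h s = h t.
Proof.
move=> hl s t sb tb.
pose g (x : R) : R := (`[< h x = h t >])%:R.
have : g s = g t.
  apply: (@zero_derive_constant g a b) => // x xb.
  apply: (near_eq_is_derive (f := cst (g x))).
  by apply: filterS (hl x xb) => y; rewrite /g => ->.
rewrite /g (asboolT (erefl (h t))); case: asboolP => // _ /eqP.
by rewrite eq_sym oner_eq0.
Qed.

Lemma zero_derive_constant_mx n (g : R -> 'rV[R]_n) (a b : R) :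
  (forall t, a < t < b -> is_derive t 1 g 0) ->
  forall s t, a < s < b -> a < t < b -> g s = g t.
Proof.
move=> gd s t sb tb; apply/rowP => j.
apply: (@zero_derive_constant (fun x => g x 0 j) a b) => // x xb.
have [dg Dg] := gd x xb.
have dgj := (derivable_mxP g x 1).1 dg.
apply: DeriveDef; first exact: dgj.
by move: Dg; rewrite derive_mx // => /matrixP/(_ 0 j); rewrite !mxE.
Qed.

End locally_constant.

(** * Derivatives of the action of R^k in charts *)

Section action.
Context {R : realType} {M : topologicalType} {m k : nat} (X : @manifold R M m).
Variables (Phi : 'rV[R]_k -> M -> M).
Hypothesis Phi0 : forall q, Phi 0 q = q.
Hypothesis PhiD : forall u v q, Phi (u + v) q = Phi u (Phi v q).
Hypothesis Phi_smooth : forall c, atlas X c ->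
    smooth_into X (setT `*` cimg c)
      (fun ux : 'rV[R]_k * 'rV[R]_m => Phi ux.1 (cinv c ux.2)).
Implicit Types (c : @chart R M m).

Definition act_in c c' (z : 'rV[R]_k * 'rV[R]_m) : 'rV[R]_m :=
  cmap c' (Phi z.1 (cinv c z.2)).

Definition act_dom c c' : set ('rV[R]_k * 'rV[R]_m) :=
  [set z | cimg c z.2 /\ cdom c' (Phi z.1 (cinv c z.2))].

Lemma act_cvg_in c u x : atlas X c -> cimg c x ->
  {for (u, x), continuous (fun z : 'rV[R]_k * 'rV[R]_m => Phi z.1 (cinv c z.2))}.
Proof. by move=> Xc cx; have [h _] := Phi_smooth Xc; apply: h; exact: mem_set. Qed.

Lemma act_cvg u q : {for (u, q), continuous (fun z : 'rV[R]_k * M => Phi z.1 z.2)}.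
Proof.
pose c := chart_at X q; have Xc : atlas X c := chart_at_atlas X q.
have cq : cdom c q := chart_at_dom X q.
apply: (@cvg_near_eq _ _ (nbhs (u, q)) _ (fun z => Phi z.1 (cinv c (cmap c z.2)))).
  have : \forall z \near (u, q), cdom c z.2.
    by apply: (near_comp (f := snd)); [exact: cvg_snd|exact: near_cdom].
  by apply: filterS => z cz; rewrite cmapK.
have := act_cvg_in (u := u) Xc (cmapP cq).
rewrite /prop_for /continuous_at /= (cmapK cq) => h.
apply: (@cvg_comp _ _ _ (fun z : 'rV[R]_k * M => (z.1, cmap c z.2))
   (fun z : 'rV[R]_k * 'rV[R]_m => Phi z.1 (cinv c z.2)) _ _ _ _ h).
apply: cvg_pairl; first exact: cvg_fst.
apply: (@cvg_comp _ _ _ snd (cmap c)); first exact: cvg_snd.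
exact: cmap_cvg.
Qed.

Lemma act_cvg_comp {T} {F : set_system T} {FF : Filter F} (u : T -> 'rV[R]_k) (q : T -> M)
    (u0 : 'rV[R]_k) (q0 : M) :
  u @ F --> u0 -> q @ F --> q0 -> (fun t => Phi (u t) (q t)) @ F --> Phi u0 q0.
Proof.
move=> uu qq; have h : (fun z : 'rV[R]_k * M => Phi z.1 z.2) @ (u0, q0) --> Phi u0 q0.
  exact: act_cvg.
exact: (@cvg_comp _ _ _ (fun t => (u t, q t)) (fun z : 'rV[R]_k * M => Phi z.1 z.2)
  F _ _ (cvg_pairl uu qq) h).
Qed.

Lemma act_in_smooth c c' : atlas X c -> atlas X c' -> smooth_on (act_dom c c') (act_in c c').
Proof.
move=> Xc Xc'; have [_ /(_ c' Xc')] := Phi_smooth Xc.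
rewrite (_ : _ `&` _ = act_dom c c') //.
by apply/seteqP; split=> z /= => [[[_ h1] h2]|[h1 h2]].
Qed.

Lemma act_in_differentiable c c' z : atlas X c -> atlas X c' -> act_dom c c' z ->
  differentiable (act_in c c') z.
Proof. by move=> Xc Xc' cz; exact: Ck_differentiable (act_in_smooth Xc Xc') cz. Qed.

Lemma near_act_dom c c' z : atlas X c -> act_dom c c' z -> \forall y \near z, act_dom c c' y.
Proof.
case: z => u x Xc [/= cx c'x].
have h1 : \forall y \near (u, x), cimg c y.2.
  by apply: (near_comp (f := snd)); [exact: cvg_snd|exact: near_cimg].
have h2 := near_comp (act_cvg_in (u := u) Xc cx) (near_cdom c'x).
by apply: filterS2 h1 h2.
Qed.

Lemma differentiable_pairl (V W : normedModType R) (y : W) (x : V) :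
  differentiable (fun s : V => (s, y)) x.
Proof. by apply: differentiable_pair; [exact: ex_diff|exact: differentiable_cst]. Qed.

Lemma differentiable_pairr (V W : normedModType R) (y : V) (x : W) :
  differentiable (fun s : W => (y, s)) x.
Proof. by apply: differentiable_pair; [exact: differentiable_cst|exact: ex_diff]. Qed.

Definition generators_in c x : 'M[R]_(k, m) := jacobian (fun s => act_in c c (s, x)) 0.
Definition dact_in c c' u x : 'M[R]_m := jacobian (fun y => act_in c c' (u, y)) x.

Lemma act_in_partial1 c c' u x : atlas X c -> atlas X c' -> act_dom c c' (u, x) ->
  differentiable (fun s => act_in c c' (s, x)) u /\
  forall v, 'D_v (fun s => act_in c c' (s, x)) u = 'D_(v, 0) (act_in c c') (u, x).
Proof.
move=> Xc Xc' cz.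
have d1 := differentiable_pairl x u; have d2 := act_in_differentiable Xc Xc' cz.
split=> [|v]; first exact: (differentiable_comp d1 d2).
rewrite (@derive_comp _ _ _ _ (fun s => (s, x)) (act_in c c') _ v d1 d2).
by rewrite derive_pair ?derive_cst ?derive_id.
Qed.

Lemma act_in_partial2 c c' u x : atlas X c -> atlas X c' -> act_dom c c' (u, x) ->
  differentiable (fun y => act_in c c' (u, y)) x /\
  forall v, 'D_v (fun y => act_in c c' (u, y)) x = 'D_(0, v) (act_in c c') (u, x).
Proof.
move=> Xc Xc' cz.
have d1 := differentiable_pairr u x; have d2 := act_in_differentiable Xc Xc' cz.
split=> [|v]; first exact: (differentiable_comp d1 d2).
rewrite (@derive_comp _ _ _ _ (fun y => (u, y)) (act_in c c') _ v d1 d2).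
by rewrite derive_pair ?derive_cst ?derive_id.
Qed.

Lemma act_dom0 c x : cimg c x -> act_dom c c (0, x).
Proof. by move=> cx; split=> //=; rewrite Phi0; exact: cinv_dom. Qed.

Lemma act_in0 c x : cimg c x -> act_in c c (0, x) = x.
Proof. by move=> cx; rewrite /act_in /= Phi0 cinvK. Qed.

Lemma mul_generators_in c x v : atlas X c -> cimg c x ->
  v *m generators_in c x = 'D_v (fun s => act_in c c (s, x)) 0.
Proof.
move=> Xc cx; have [d _] := act_in_partial1 Xc Xc (act_dom0 cx).
by rewrite (deriveEjacobian _ d).
Qed.

Lemma mul_dact_in c c' u x v : atlas X c -> atlas X c' -> act_dom c c' (u, x) ->
  v *m dact_in c c' u x = 'D_(0, v) (act_in c c') (u, x).
Proof.
by move=> Xc Xc' cx; have [d <-] := act_in_partial2 Xc Xc' cx; rewrite (deriveEjacobian _ d).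
Qed.

Lemma derive_act_shift c c' u x v : atlas X c -> atlas X c' -> act_dom c c' (u, x) ->
  'D_v (fun s => act_in c c' (s, x)) u = 'D_v (fun s => act_in c c' (u + s, x)) 0.
Proof.
move=> Xc Xc' cx; have [d _] := act_in_partial1 Xc Xc' cx.
have d1 : differentiable (fun s : 'rV[R]_k => u + s) 0.
  by apply: differentiableD; [exact: differentiable_cst|exact: ex_diff].
have d2 : differentiable (fun s => act_in c c' (s, x)) (u + 0) by rewrite addr0.
rewrite [RHS](@derive_comp _ _ _ _ (fun s : 'rV[R]_k => u + s) (fun s => act_in c c' (s, x)) _ _ d1 d2).
rewrite addr0; congr ('D_ _ _ _).
rewrite deriveD; [|exact: derivable_cst|exact: derivable_id].
by rewrite derive_cst derive_id add0r.
Qed.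

(** Differentiate Phi^{u+s} = Phi^u o Phi^s in s at 0. *)
Lemma derive_act_right c c' u x v : atlas X c -> atlas X c' -> act_dom c c' (u, x) ->
  'D_(v, 0) (act_in c c') (u, x) = v *m generators_in c x *m dact_in c c' u x.
Proof.
move=> Xc Xc' cx; have cix : cimg c x by case: cx.
have [_ e1] := act_in_partial1 Xc Xc' cx; have [_ e2] := act_in_partial2 Xc Xc' cx.
rewrite -e1 (derive_act_shift v Xc Xc' cx) (mul_generators_in v Xc cix).
rewrite (mul_dact_in _ Xc Xc' cx) -e2.
have d1 := (act_in_partial1 Xc Xc (act_dom0 cix)).1.
have d2 : differentiable (fun y => act_in c c' (u, y)) (act_in c c (0, x)).
  by rewrite act_in0 //; exact: (act_in_partial2 Xc Xc' cx).1.
have := @derive_comp _ _ _ _ (fun s => act_in c c (s, x)) (fun y => act_in c c' (u, y)) _ v d1 d2.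
rewrite (act_in0 cix) => <-.
apply: near_eq_derive.
have : \forall s \near (0 : 'rV[R]_k), act_dom c c (s, x).
  apply: (near_comp (f := fun s => (s, x))); last exact: near_act_dom (act_dom0 cix).
  exact: pairl_continuous.
by apply: filterS => s [_ /= cs]; rewrite /act_in /= PhiD cmapK.
Qed.

(** The same derivative with the factors exchanged, Phi^{s+u} = Phi^s o Phi^u; commutativity of R^k
    enters here. *)
Lemma derive_act_left c c' u x v : atlas X c -> atlas X c' -> act_dom c c' (u, x) ->
  'D_(v, 0) (act_in c c') (u, x) = v *m generators_in c' (act_in c c' (u, x)).
Proof.
move=> Xc Xc' cx.
have [_ e] := act_in_partial1 Xc Xc' cx.
have cy : cimg c' (act_in c c' (u, x)) by apply: cmapP; case: cx.
rewrite -e (derive_act_shift v Xc Xc' cx) (mul_generators_in v Xc' cy).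
have -> : (fun s => act_in c c' (u + s, x)) = (fun s => act_in c' c' (s, act_in c c' (u, x))).
  by apply/funext => s; rewrite /act_in /= addrC PhiD cmapK //; case: cx.
by [].
Qed.

(** The flow carries generators to generators, by comparing the two expressions of one derivative.
    All winding numbers along orbits rest on this identity. *)
Lemma generators_in_act c c' u x : atlas X c -> atlas X c' -> act_dom c c' (u, x) ->
  generators_in c' (act_in c c' (u, x)) = generators_in c x *m dact_in c c' u x.
Proof.
move=> Xc Xc' cx; apply/row_matrixP => i.
rewrite !rowE mulmxA -(derive_act_right (delta_mx 0 i) Xc Xc' cx).
by rewrite (derive_act_left (delta_mx 0 i) Xc Xc' cx).
Qed.

Lemma generators_chart c q : atlas X c -> cdom c q ->
  generators X Phi q = generators_in c (cmap c q) *m tchange X c (cmap c q).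
Proof.
move=> Xc cq; have ccq := cmapP cq.
have fc : {for 0, continuous (fun u => Phi u q)}.
  exact: (@act_cvg_comp _ (nbhs (0 : 'rV[R]_k)) _ id (cst q) 0 q (@cvg_id _ _) (@cvg_cst _ _ _ _ _)).
have fd c' : atlas X c' -> cdom c' (Phi 0 q) -> differentiable (cmap c' \o (fun u => Phi u q)) 0.
  move=> Xc'; rewrite Phi0 => c'q.
  have cz : act_dom c c' (0, cmap c q) by split=> //=; rewrite cmapK // Phi0.
  have [d _] := act_in_partial1 Xc Xc' cz.
  rewrite (_ : _ \o _ = (fun s => act_in c c' (s, cmap c q))) //.
  by apply/funext => s; rewrite /act_in /= cmapK.
have c0 : cdom c (Phi 0 q) by rewrite Phi0.
have e : cmap c \o (fun u => Phi u q) = (fun s => act_in c c (s, cmap c q)).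
  by apply/funext => s; rewrite /act_in /= cmapK.
have key (v : 'rV[R]_k) : v *m generators X Phi q =
    v *m (generators_in c (cmap c q) *m tchange X c (cmap c q)).
  have := dinto_mul v fc fd Xc c0; rewrite Phi0 e -(mul_generators_in v Xc ccq) => ->.
  by rewrite mulmxA.
by apply/row_matrixP => i; rewrite (rowE i (generators X Phi q)) key -rowE.
Qed.

Lemma generators_in_cvg c x : atlas X c -> cimg c x -> {for x, continuous (generators_in c)}.
Proof.
move=> Xc cx; apply: (@cvg_mxP R _ (nbhs x) _ k m (generators_in c) (generators_in c x)).2 => i j.
pose D y := ('D_(delta_mx 0 i, 0) (act_in c c) (0, y)) 0 j.
have DE y : cimg c y -> generators_in c y i j = D y.
  move=> cy; rewrite /D -(act_in_partial1 Xc Xc (act_dom0 cy)).2 -(mul_generators_in (delta_mx 0 i) Xc cy).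
  by rewrite -rowE [RHS]mxE.
apply: (@cvg_near_eq _ _ (nbhs x) _ D).
  by apply: filterS (near_cimg cx) => y; exact: DE.
rewrite DE //.
have h := smooth_derive_continuous (v := (delta_mx 0 i, 0)) (act_in_smooth Xc Xc) (act_dom0 cx).
have h2 : (fun y => 'D_(delta_mx 0 i, 0) (act_in c c) (0, y)) @ x -->
    'D_(delta_mx 0 i, 0) (act_in c c) (0, x).
  apply: (@cvg_comp _ _ _ (fun y => (0 : 'rV[R]_k, y)) ('D_(delta_mx 0 i, 0) (act_in c c)) _ _ _ _ h).
  exact: pairr_continuous.
by move/cvg_mxP: h2; apply.
Qed.

Lemma dact_in_cvg c c' u x : atlas X c -> atlas X c' -> act_dom c c' (u, x) ->
  {for (u, x), continuous (fun z : 'rV[R]_k * 'rV[R]_m => dact_in c c' z.1 z.2)}.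
Proof.
move=> Xc Xc' cx.
apply: (@cvg_mxP R _ (nbhs (u, x)) _ m m (fun z : 'rV[R]_k * 'rV[R]_m => dact_in c c' z.1 z.2) (dact_in c c' u x)).2 => i j.
pose D z := ('D_(0, delta_mx 0 i) (act_in c c') z) 0 j.
have DE z : act_dom c c' z -> dact_in c c' z.1 z.2 i j = D z.
  by case: z => s y cy; rewrite /D -(mul_dact_in (delta_mx 0 i) Xc Xc' cy) -rowE [RHS]mxE.
apply: (@cvg_near_eq _ _ (nbhs (u, x)) _ D).
  by apply: filterS (near_act_dom Xc cx) => y; exact: DE.
rewrite (DE (u, x)) //.
have h := smooth_derive_continuous (v := (0, delta_mx 0 i)) (act_in_smooth Xc Xc') cx.
by move/cvg_mxP: h; apply.
Qed.

Lemma dact_in_unit c c' u x : atlas X c -> atlas X c' -> act_dom c c' (u, x) ->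
  dact_in c c' u x \in unitmx.
Proof.
move=> Xc Xc' cx; have [cix c'x] := cx; set y := act_in c c' (u, x).
have cy : act_dom c' c (- u, y).
  split=> /=; first exact: cmapP.
  by rewrite /y /act_in /= cmapK // -PhiD addNr Phi0; exact: cinv_dom.
have d1 := (act_in_partial2 Xc Xc' cx).1; have d2 := (act_in_partial2 Xc' Xc cy).1.
have h : dact_in c c' u x *m dact_in c' c (- u) y = 1%:M.
  have m1 (v : 'rV[R]_m) : v *m dact_in c c' u x = 'D_v (fun y => act_in c c' (u, y)) x.
    exact: esym (deriveEjacobian v d1).
  have m2 (v : 'rV[R]_m) : v *m dact_in c' c (- u) y = 'D_v (fun z => act_in c' c (- u, z)) y.
    exact: esym (deriveEjacobian v d2).
  have key (v : 'rV[R]_m) : v *m dact_in c c' u x *m dact_in c' c (- u) y = v; last first.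
    by apply/row_matrixP => i; rewrite row_mul (rowE i (dact_in c c' u x)) key row1.
  rewrite m2 m1.
  have := @derive_comp _ _ _ _ (fun y => act_in c c' (u, y)) (fun z => act_in c' c (- u, z)) _ v d1 d2.
  move=> <-; rewrite -[RHS](@derive_id _ _ x v); apply: near_eq_derive.
  have : \forall z \near x, act_dom c c' (u, z).
    apply: (near_comp (f := fun z => (u, z))); last exact: near_act_dom cx.
    exact: pairr_continuous.
  apply: filterS => z [cz c'z]; rewrite /act_in /= cmapK // -PhiD addNr Phi0 cinvK //.
exact: (mulmx1_unit h).1.
Qed.

(** The velocity of f is u' in terms of the generators, and flowing by - u cancels it: in charts the
    derivative is - u' G + u' G, both pushed forward by dPhi. Charts only give local constancy,
    which the interval turns into constancy. *)
Lemma act_along_curve (f : R -> M) (u : R -> 'rV[R]_k) (a b : R) :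
  (forall t, a < t < b -> {for t, continuous f}) ->
  (forall t c, a < t < b -> atlas X c -> cdom c (f t) -> differentiable (cmap c \o f) t) ->
  (forall t, a < t < b -> differentiable u t) ->
  (forall t c, a < t < b -> atlas X c -> cdom c (f t) ->
     'D_1 (cmap c \o f) t = 'D_1 u t *m generators_in c (cmap c (f t))) ->
  forall s t, a < s < b -> a < t < b -> Phi (- u s) (f s) = Phi (- u t) (f t).
Proof.
move=> fc fd ud fu; apply: locally_constant_constant => t0 t0b.
pose c := chart_at X (f t0); pose c' := chart_at X (Phi (- u t0) (f t0)).
have Xc : atlas X c := chart_at_atlas X _; have Xc' : atlas X c' := chart_at_atlas X _.
have near_itv : \forall t \near t0, a < t < b.
  have := @near_in_itvoo R a b t0; rewrite in_itv /= t0b => /(_ isT).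
  by apply: filterS => x; rewrite in_itv.
have near_c : \forall t \near t0, cdom c (f t).
  by apply: near_comp (fc _ t0b) _; apply: near_cdom; exact: chart_at_dom.
have near_c' : \forall t \near t0, cdom c' (Phi (- u t) (f t)).
  apply: (near_comp (f := fun t => Phi (- u t) (f t))); last first.
    by apply: near_cdom; exact: chart_at_dom.
  apply: (@act_cvg_comp _ (nbhs t0) _ (fun t => - u t) f); last exact: fc.
  by apply: cvgN; exact: differentiable_continuous (ud _ t0b).
have : \forall t \near t0, [/\ a < t < b, cdom c (f t) & cdom c' (Phi (- u t) (f t))].
  by apply: filterS3 near_itv near_c near_c'.
move=> /nbhs_ballP[e /= e0 he].
have dom t : t0 - e < t < t0 + e -> [/\ a < t < b, cdom c (f t) & cdom c' (Phi (- u t) (f t))].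
  move=> te; apply: he; rewrite /ball /= distrC ltr_distl //.
apply/nbhs_ballP; exists e => //= t; rewrite /ball /= distrC ltr_distl => te.
have te0 : t0 - e < t0 < t0 + e by rewrite ltrBlDr ltrDl e0.
pose g s := act_in c c' (- u s, cmap c (f s)).
have gE s : t0 - e < s < t0 + e -> cinv c' (g s) = Phi (- u s) (f s).
  by move=> /dom[_ cs c's]; rewrite /g /act_in /= !cmapK.
rewrite -gE // -[in RHS]gE //; congr (cinv c' _).
apply: (@zero_derive_constant_mx R m g (t0 - e) (t0 + e)) => // s /dom[sb cs c's].
have d1 : differentiable (fun s => - u s) s by apply: differentiableN; exact: ud.
have d2 := fd _ _ sb Xc cs.
have dp : differentiable (fun s => (- u s, cmap c (f s))) s by exact: differentiable_pair.
have cz : act_dom c c' (- u s, cmap c (f s)).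
  by split=> /=; [exact: cmapP|rewrite cmapK].
have dz := act_in_differentiable Xc Xc' cz.
apply: DeriveDef.
  apply: diff_derivable; exact: (differentiable_comp dp dz).
rewrite /g (@derive_comp _ _ _ _ (fun s => (- u s, cmap c (f s))) (act_in c c') _ _ dp dz).
rewrite (@derive_pair _ _ _ _ (fun s => - u s) (cmap c \o f) _ _ d1 d2).
rewrite deriveN; last exact: diff_derivable (ud _ sb).
rewrite fu // deriveE //.
set v := 'D_1 u s; set G := generators_in _ _.
have -> : (- v, v *m G) = (0, v *m G) - (v, 0) :> 'rV[R]_k * 'rV[R]_m.
  by apply/eqP; rewrite xpair_eqE /= sub0r subr0 !eqxx.
rewrite linearB -!deriveE // (derive_act_right v Xc Xc' cz) -(mul_dact_in (v *m G) Xc Xc' cz).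
by rewrite -/G subrr.
Qed.

End action.

(** * Antiderivatives of continuous curves *)

Section antiderivative.
Context {R : realType}.

Lemma antiderivative (g : R -> R) (a : R) : continuous g ->
  exists G : R -> R, forall t, a < t -> is_derive t 1 G (g t).
Proof.
move=> gc; exists (fun x => \int[lebesgue_measure]_(t in [set` `[a, x]]) g t) => t at_.
have t1 : t < t + 1 by rewrite ltrDl.
have gi : lebesgue_measure.-integrable [set` `[a, t + 1]] (EFin \o g).
  apply: continuous_compact_integrable; first exact: segment_compact.
  exact: continuous_subspaceT.
have at' : (a%:E < t%:E)%E by rewrite lte_fin.
have [h1 h2] := continuous_FTC1 t1 gi at' (gc t).
by apply: DeriveDef; [exact: h1|rewrite -derive1E; exact: h2].
Qed.

Lemma antiderivative_mx n (g : R -> 'rV[R]_n) (a : R) : continuous g ->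
  exists G : R -> 'rV[R]_n, forall t, a < t -> differentiable G t /\ 'D_1 G t = g t.
Proof.
move=> gc.
have /choice[G GP] (j : 'I_n) : exists Gj : R -> R, forall t, a < t -> is_derive t 1 Gj (g t 0 j).
  apply: (@antiderivative (fun t => g t 0 j)) => t.
  by have /cvg_mxP := gc t; apply.
exists (fun t => \row_j G j t) => t at_.
have d : derivable (fun t => \row_j G j t) t 1.
  apply/derivable_mxP => i j; under eq_fun do rewrite mxE.
  by have [] := GP j t at_.
split; first exact/derivable1_diffP.
rewrite derive_mx //; apply/rowP => j; rewrite mxE; under eq_fun do rewrite mxE.
by have [_ ->] := GP j t at_.
Qed.

End antiderivative.

(** * The regular orbit and its core circle *)

Section orbit.
Context {R : realType} {M : topologicalType} (X : @manifold R M (2 + 2)).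
Variables (w : M -> 'M[R]_(2 + 2)) (Phi : 'rV[R]_2 -> M -> M).
Variables (p : S1 R * R -> M) (p0 : M).
Hypothesis hw : symplectic X w.
Hypothesis hPhi : hamiltonian_action X w Phi.
Hypothesis htorus : lagrangian_pinched_torus X w p p0.
Hypothesis horbit : exists2 q, (p @` open_cylinder (R := R)) q &
  p @` open_cylinder (R := R) = range (fun u => Phi u q).
Hypothesis hregular : forall q, (p @` open_cylinder (R := R)) q ->
  \rank (generators X Phi q) = 2%N.

Local Notation o := (p @` open_cylinder (R := R)).
Let Phi0 := action0 hPhi.
Let PhiD := actionD hPhi.
Let PhiS := action_smooth hPhi.

Lemma orbit_closed u q : o q -> o (Phi u q).
Proof.
have [q0 _ ->] := horbit; move=> [v _ <-]; exists (u + v) => //; exact: PhiD.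
Qed.

Lemma orbit_trans q q' : o q -> o q' -> exists u, Phi u q = q'.
Proof.
have [q0 _ ->] := horbit; move=> [v _ <-] [v' _ <-]; exists (v' - v).
by rewrite -PhiD subrK.
Qed.

Lemma unroll_orbit (x : 'rV[R]_2) : -1 < x 0 1 < 1 -> o (unroll p x).
Proof. by move=> x1; exists (expi (x 0 0), x 0 1). Qed.

Lemma strip_open : open [set x : 'rV[R]_2 | -1 < x 0 1 < 1].
Proof.
have -> : [set x : 'rV[R]_2 | -1 < x 0 1 < 1] = (fun x : 'rV[R]_2 => x 0 1) @^-1` `]-1, 1[%classic.
  by apply/seteqP; split=> x /=; rewrite in_itv.
by apply: open_comp; [move=> x _; exact: coord_continuous|exact: interval_open].
Qed.

Lemma near_strip (x : 'rV[R]_2) : -1 < x 0 1 < 1 -> \forall y \near x, -1 < (y : 'rV[R]_2) 0 1 < 1.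
Proof. by move=> x1; apply: open_nbhs_nbhs; split=> //; exact: strip_open. Qed.

Lemma unroll_cvg (x : 'rV[R]_2) : -1 < x 0 1 < 1 -> {for x, continuous (unroll p)}.
Proof. by move=> x1; have [h _] := pinched_smooth htorus; apply: h; exact: mem_set. Qed.

Lemma unroll_smooth c : atlas X c ->
  smooth_on ([set x : 'rV[R]_2 | -1 < x 0 1 < 1] `&` unroll p @^-1` cdom c) (cmap c \o unroll p).
Proof. by have [_ h] := pinched_smooth htorus; exact: h. Qed.

Lemma unroll_differentiable (x : 'rV[R]_2) c : -1 < x 0 1 < 1 -> atlas X c ->
  cdom c (unroll p x) -> differentiable (cmap c \o unroll p) x.
Proof. by move=> x1 Xc cx; apply: Ck_differentiable (unroll_smooth Xc) _. Qed.

Lemma mul_dinto_unroll (x v : 'rV[R]_2) c : -1 < x 0 1 < 1 -> atlas X c -> cdom c (unroll p x) ->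
  v *m dinto X (unroll p) x =
  'D_v (cmap c \o unroll p) x *m tchange X c (cmap c (unroll p x)).
Proof.
move=> x1 Xc cx; apply: dinto_mul => //; first exact: unroll_cvg.
by move=> c' Xc' c'x; exact: unroll_differentiable.
Qed.

Lemma momentum_tangent (H : M -> 'rV[R]_2) (x : 'rV[R]_2) : smooth_from X H ->
  (forall u q, H (Phi u q) = H q) -> -1 < x 0 1 < 1 ->
  dinto X (unroll p) x *m dfrom X H (unroll p x) = 0.
Proof.
move=> sH HPhi x1; set q := unroll p x.
pose c := chart_at X q; have Xc : atlas X c := chart_at_atlas X q.
have cq : cdom c q := chart_at_dom X q.
have key (v : 'rV[R]_2) : v *m (dinto X (unroll p) x *m dfrom X H q) = 0.
  rewrite mulmxA (mul_dinto_unroll v x1 Xc cq).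
  have := @dfrom_mul _ _ _ X _ H c (cmap c q) ('D_v (cmap c \o unroll p) x) sH Xc (cmapP cq).
  rewrite (cmapK cq) => ->.
  have d1 := unroll_differentiable x1 Xc cq.
  have d2 : differentiable (H \o cinv c) (cmap c q) by exact: Ck_differentiable (sH _ Xc) (cmapP cq).
  rewrite -(@derive_comp _ _ _ _ (cmap c \o unroll p) (H \o cinv c) x v d1 d2).
  rewrite -[RHS](@derive_cst _ _ _ (H q) x v); apply: near_eq_derive.
  apply: filterS2 (near_strip x1) (near_comp (unroll_cvg x1) (near_cdom cq)) => y y1 cy /=.
  rewrite (cmapK cy); have [u <-] := orbit_trans (unroll_orbit x1) (unroll_orbit y1).
  exact: HPhi.
by apply/row_matrixP => i; rewrite rowE key row0.
Qed.

(** The generators are the Hamiltonian fields of functions that are constant on the single orbit o,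
    hence they lie in the symplectic complement of T. That complement is T itself, as T is
    Lagrangian; equal ranks give equality. *)
Lemma generators_tangent (x : 'rV[R]_2) : -1 < x 0 1 < 1 ->
  let T := dinto X (unroll p) x in let G := generators X Phi (unroll p x) in
  (G :=: T)%MS /\ G *m w (unroll p x) *m G^T = 0.
Proof.
move=> x1 T G; set q := unroll p x in G *.
have [H [sH GH HPhi]] := action_momentum hPhi.
have TH : T *m dfrom X H q = 0 := momentum_tangent sH HPhi x1.
have wu := symplectic_nondegenerate hw q; have wT := symplectic_alt hw q.
have rG : \rank G = 2%N := hregular (unroll_orbit x1).
have rT : \rank T = 2%N := pinched_immersion htorus x1.
have TwT : T *m w q *m T^T = 0 := pinched_lagrangian htorus x1.
have TwG : T *m w q *m G^T = 0.
  have wG : w q *m G^T = - dfrom X H q.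
    by rewrite -[w q]opprK -wT mulNmx -trmx_mul /G GH /hamvf mulmxKV // trmxK.
  by rewrite -mulmxA wG mulmxN TH oppr0.
pose K := kermx (w q *m T^T).
have rK : \rank K = 2%N.
  have r2 : \rank (w q *m T^T) = 2%N.
    by rewrite -mxrank_tr trmx_mul trmxK mxrankMfree // row_free_unit unitmx_tr.
  by rewrite /K mxrank_ker r2.
have TK : (T <= K)%MS.
  by apply/sub_kermxP; rewrite (mulmxA T (w q) T^T); exact: TwT.
have GK : (G <= K)%MS.
  apply/sub_kermxP; apply: trmx_inj; rewrite trmx0 (mulmxA G (w q) T^T) (trmx_mul (G *m w q)).
  by rewrite trmxK (trmx_mul G) wT mulNmx mulmxN (mulmxA T (w q)) TwG oppr0.
have eqK (A : 'M[R]_(2, 2 + 2)) : (A <= K)%MS -> \rank A = 2%N -> (A :=: K)%MS.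
  move=> AK rA; apply/eqmxP; rewrite AK /=.
  by have [_ <-] := mxrank_leqif_sup AK; rewrite rA rK.
have GT : (G :=: T)%MS.
  by apply: eqmx_trans (eqK _ GK rG) _; apply: eqmx_sym; exact: eqK.
split; first exact: GT.
have /submxP[D GE] : (G <= T)%MS by rewrite GT.
rewrite GE trmx_mul (mulmxA _ T^T) -(mulmxA D T) -(mulmxA D (T *m w q)) TwT.
by rewrite mulmx0 mul0mx.
Qed.

Lemma generators_lagrangian q : o q -> lagrangian (w q) (generators X Phi q).
Proof.
move=> oq; have [[z r] /= r1 qE] := oq; have [t tE] := expi_surj z.
have uE : unroll p (cyl_coord t r) = q by rewrite /unroll !mxE /= -tE.
have x1 : -1 < (cyl_coord t r) 0 1 < 1 by rewrite mxE.
have [_] := generators_tangent x1; rewrite uE => GG; split=> //.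
by rewrite /row_free hregular.
Qed.

Lemma cyl_coordE t r : cyl_coord t r = t *: delta_mx 0 0 + r *: delta_mx 0 1 :> 'rV[R]_2.
Proof.
apply/rowP; apply: ord2P; rewrite !mxE /= ?mulr1 ?mulr0 ?addr0 ?add0r //.
Qed.

(* The tangent vector of the core circle is a combination c(t) of the generators, and
   u is an antiderivative of c: Phi (- u t) (p (expi t, 0)) has zero derivative. *)
Lemma core_circle_path : exists u : R -> 'rV[R]_2, [/\ continuous u, u 0 = 0,
  forall t, u t = u (clamp 0 1 t) &
  forall t, Phi (u t) (p (expi 0, 0)) = p (expi (clamp 0 1 t), 0)].
Proof.
pose gam (t : R) : 'rV[R]_2 := cyl_coord t 0.
have gamE : gam = (fun t => t *: delta_mx 0 0).
  by apply/funext => t; rewrite /gam cyl_coordE scale0r addr0.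
have g1 t : -1 < gam t 0 1 < 1 by rewrite mxE /= ltrN10 ltr01.
have gd t : differentiable gam t /\ 'D_1 gam t = delta_mx 0 0.
  have di : differentiable (id : R -> R) t by exact: ex_diff.
  have d : differentiable gam t by rewrite gamE; exact: (differentiableZl _ di).
  split=> //; rewrite deriveE // gamE (diffZl _ di).
  by rewrite (_ : 'd id t 1 = 1) ?scale1r // -deriveE // derive_id.
pose f t := unroll p (gam t).
have fE t : f t = p (expi t, 0) by rewrite /f /unroll !mxE.
have gamc t : {for t, continuous gam} by exact: differentiable_continuous (gd t).1.
have fc t : {for t, continuous f}.
  exact: (@continuous_comp _ _ _ gam (unroll p) t (gamc t) (unroll_cvg (g1 t))).
have fd t c : atlas X c -> cdom c (f t) -> differentiable (cmap c \o f) t.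
  move=> Xc cf; exact: (differentiable_comp (gd t).1 (unroll_differentiable (g1 t) Xc cf)).
have fD t c : atlas X c -> cdom c (f t) ->
    'D_1 (cmap c \o f) t = 'D_(delta_mx 0 0) (cmap c \o unroll p) (gam t).
  move=> Xc cf.
  have := @derive_comp _ _ _ _ gam (cmap c \o unroll p) t 1 (gd t).1 (unroll_differentiable (g1 t) Xc cf).
  by rewrite (gd t).2.
pose G t := generators X Phi (f t).
pose cc t : 'rV[R]_2 := delta_mx 0 0 *m dinto X (unroll p) (gam t) *m pinvmx (G t).
have ccG t c : atlas X c -> cdom c (f t) ->
    'D_1 (cmap c \o f) t = cc t *m generators_in Phi c (cmap c (f t)).
  move=> Xc cf.
  have sub : ((delta_mx 0 0 : 'rV[R]_2) *m dinto X (unroll p) (gam t) <= G t)%MS.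
    by have [-> _] := generators_tangent (g1 t); exact: submxMl.
  have := mulmxKpV sub; rewrite -/(cc t) (mul_dinto_unroll _ (g1 t) Xc cf) /G.
  rewrite (generators_chart Phi0 PhiS Xc cf) mulmxA -fD //.
  have tu := tchange_unit Xc (cmapP cf).
  by move/(congr1 (mulmx^~ (invmx (tchange X c (cmap c (f t)))))); rewrite !mulmxK.
(* Continuity cannot be read off from [pinvmx]. Near t, inside one chart, the coefficients are the
   velocity times g^T (g g^T)^-1, which is visibly continuous. *)
have ccc : continuous cc.
  move=> t; pose c := chart_at X (f t); have Xc : atlas X c := chart_at_atlas X _.
  have cf : cdom c (f t) := chart_at_dom X _.
  pose g s := generators_in Phi c (cmap c (f s)).
  pose e s := 'D_(delta_mx 0 0) (cmap c \o unroll p) (gam s) *m (g s)^T *m invmx (g s *m (g s)^T).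
  have gu s : cdom c (f s) -> g s *m (g s)^T \in unitmx.
    move=> cs; rewrite -row_free_unit; apply: inj_row_free => v vg.
    have vg0 : v *m g s = 0.
      have : (v *m g s) *m (v *m g s)^T = 0.
        by rewrite trmx_mul !mulmxA -(mulmxA v) vg mul0mx.
      move=> /matrixP/(_ 0 0); rewrite mxE [RHS]mxE => h.
      apply/rowP => j; rewrite [RHS]mxE; apply/eqP; rewrite -sqrf_eq0; apply/eqP.
      have : \sum_j (v *m g s) 0 j ^+ 2 = 0.
        by rewrite -[RHS]h; apply: eq_bigr => i _; rewrite [(_ ^T) _ _]mxE expr2.
      by move=> /psumr_eq0P; apply => // i _; exact: sqr_ge0.
    have gf : row_free (g s).
      have : \rank (G s) = 2%N by apply: hregular; exact: unroll_orbit (g1 s).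
      rewrite /G (generators_chart Phi0 PhiS Xc cs) mxrankMfree; last first.
        by rewrite row_free_unit; exact: tchange_unit Xc (cmapP cs).
      by rewrite /row_free => ->.
    by apply: (row_free_inj gf); rewrite vg0 mul0mx.
  have eE s : cdom c (f s) -> cc s = e s.
    by move=> cs; rewrite /e -fD // ccG // -(mulmxA (cc s)) mulmxK //; exact: gu.
  apply: (@cvg_near_eq _ _ (nbhs t) _ e).
    by apply: filterS (near_comp (fc t) (near_cdom cf)) => s; exact: eE.
  rewrite eE //.
  have gcv : g @ nbhs t --> g t.
    apply: (@cvg_comp _ _ _ (cmap c \o f) (generators_in Phi c) (nbhs t) _ _ _
      (generators_in_cvg Phi0 PhiS Xc (cmapP cf))).
    exact: differentiable_continuous (fd t c Xc cf).
  have gT : (fun s => (g s)^T) @ nbhs t --> (g t)^T by exact: trmx_cvg gcv.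
  have gg : (fun s => g s *m (g s)^T) @ nbhs t --> g t *m (g t)^T by exact: mulmx_cvg gcv gT.
  have gi : (fun s => invmx (g s *m (g s)^T)) @ nbhs t --> invmx (g t *m (g t)^T).
    exact: invmx_cvg (gu t cf) gg.
  have st1 : ([set x : 'rV[R]_2 | -1 < x 0 1 < 1] `&` unroll p @^-1` cdom c) (gam t).
    by split; [exact: g1|exact: cf].
  have dcv : (fun s => 'D_(delta_mx 0 0) (cmap c \o unroll p) (gam s)) @ nbhs t -->
      'D_(delta_mx 0 0) (cmap c \o unroll p) (gam t).
    exact: (@cvg_comp _ _ _ gam ('D_(delta_mx 0 0) (cmap c \o unroll p)) (nbhs t) _ _ (gamc t)
      (smooth_derive_continuous (unroll_smooth Xc) st1)).
  exact: (mulmx_cvg (mulmx_cvg dcv gT) gi).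
(* The base point -1 lies to the left of [0, 1], so that U is differentiable on an open interval
   containing it. *)
have [U UP] := antiderivative_mx (-1) ccc.
have h (s : R) : -1 < s < 2 -> Phi (- U s) (f s) = Phi (- U 0) (f 0).
  move=> s1.
  have A0 (r : R) : -1 < r < 2 -> {for r, continuous f} by move=> _; exact: fc.
  have A1 (r : R) c : -1 < r < 2 -> atlas X c -> cdom c (f r) -> differentiable (cmap c \o f) r.
    by move=> _; exact: fd.
  have A2 (r : R) : -1 < r < 2 -> differentiable U r by move=> /andP[r1 _]; exact: (UP r r1).1.
  have A3 (r : R) c : -1 < r < 2 -> atlas X c -> cdom c (f r) ->
      'D_1 (cmap c \o f) r = 'D_1 U r *m generators_in Phi c (cmap c (f r)).
    by move=> /andP[r1 _] Xc cr; rewrite (UP r r1).2 ccG.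
  have z1 : -1 < (0 : R) < 2 by rewrite ltrN10 ltr0n.
  exact: (act_along_curve Phi0 PhiD PhiS A0 A1 A2 A3 s1 z1).
have cl (t : R) : -1 < clamp 0 1 t < 2.
  have /andP[h1 h2] := clamp_itv t (@ler01 R); apply/andP; split; lra.
exists (fun t => U (clamp 0 1 t) - U 0); split.
- move=> t; apply: cvgB; last exact: cvg_cst.
  apply: (@continuous_comp _ _ _ (clamp 0 1) U); first exact: clamp_continuous.
  by apply: differentiable_continuous; apply: (UP _ _).1; case/andP: (cl t).
- by rewrite clamp_id ?subrr // lexx ler01.
- by move=> t; rewrite (@clamp_id R 0 1 (clamp 0 1 t)) // clamp_itv // ler01.
- by move=> t; rewrite -!fE PhiD -(h _ (cl t)) -PhiD subrr Phi0.
Qed.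

End orbit.

(** * Closed conditions, orthonormal bases, compatibility in charts *)

Section orthonormalization.
Context {R : realType}.

Lemma closure_zero {T : topologicalType} {m n} (S : set T) (f : T -> 'M[R]_(m, n)) a :
  closure S a -> {for a, continuous f} -> (forall s, S s -> f s = 0) -> f a = 0.
Proof.
move=> Sa fa fS; apply: contrapT => /eqP fa0.
have n0 : 0 < `|f a| by rewrite normr_gt0.
have : \forall s \near a, 0 < `|f s|.
  have h : (fun s => `|f s|) @ nbhs a --> `|f a| by apply: cvg_norm; exact: fa.
  exact: (cvgr_gt _ h _ n0).
by move=> /Sa[s [/fS -> ]]; rewrite normr0 ltxx.
Qed.

(** g is the inverse of the Cholesky factor of the Gram matrix with entries a, b, d, whose Schur
    complement d - b^2 / a is positive. The standard scalar product is used because it puts bases at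
    all points into one compact set. *)
Lemma orthonormalize {m} (G : 'M[R]_(2, m)) : row_free G ->
  exists2 g : 'M[R]_2, g \in unitmx & (g *m G) *m (g *m G)^T = 1%:M.
Proof.
move=> Gf; have [S SE] : exists S, S = G *m G^T by exists (G *m G^T).
have S10 : S 1 0 = S 0 1 by rewrite -[in LHS](trmxK S) mxE SE trmx_mul trmxK.
have pos (v : 'rV[R]_2) : v != 0 -> 0 < (v *m S *m v^T) 0 0.
  move=> v0; have e : v *m S *m v^T = (v *m G) *m (v *m G)^T.
    by rewrite SE trmx_mul !mulmxA.
  rewrite e mxE; under eq_bigr do rewrite [(_^T) _ _]mxE -expr2.
  rewrite lt_neqAle sumr_ge0 ?andbT; last by move=> i _; exact: sqr_ge0.
  apply: contra v0 => /eqP/esym/psumr_eq0P vG; apply/eqP.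
  apply: (row_free_inj Gf); rewrite mul0mx; apply/rowP => i; rewrite [RHS]mxE; apply/eqP.
  by rewrite -sqrf_eq0 vG // => j _; exact: sqr_ge0.
have l1 : lift ord0 ord0 = 1 :> 'I_2 by apply: val_inj.
have o0 : ord0 = 0 :> 'I_2 by apply: val_inj.
have quad (v : 'rV[R]_2) : (v *m S *m v^T) 0 0 =
    S 0 0 * v 0 0 ^+ 2 + 2 * S 0 1 * v 0 0 * v 0 1 + S 1 1 * v 0 1 ^+ 2.
  rewrite mxE !big_ord_recl big_ord0 !mxE !big_ord_recl !big_ord0 l1 o0 S10; ring.
pose a := S 0 0; pose b := S 0 1; pose d := S 1 1.
pose vec (x y : R) : 'rV[R]_2 := \row_j if j == 0 then x else y.
have a0 : 0 < a.
  have v0 : vec 1 0 != 0 by apply/eqP => /rowP/(_ 0); rewrite !mxE /= => /eqP; rewrite oner_eq0.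
  by have := pos _ v0; rewrite quad !mxE /= /a; lra.
have D0 : 0 < d - b ^+ 2 / a.
  have v0 : vec (- b / a) 1 != 0 by apply/eqP => /rowP/(_ 1); rewrite !mxE /= => /eqP; rewrite oner_eq0.
  have := pos _ v0; rewrite quad !mxE /= -/a -/b -/d.
  have -> : a * (- b / a) ^+ 2 + 2 * b * (- b / a) * 1 + d * 1 ^+ 2 = d - b ^+ 2 / a.
    by field; rewrite gt_eqF.
  by [].
pose s := Num.sqrt a; pose r := Num.sqrt (d - b ^+ 2 / a).
have s0 : s != 0 by rewrite gt_eqF // sqrtr_gt0.
have r0 : r != 0 by rewrite gt_eqF // sqrtr_gt0.
have sE : s ^+ 2 = a by rewrite sqr_sqrtr // ltW.
have rE : r ^+ 2 = d - b ^+ 2 / a by rewrite sqr_sqrtr // ltW.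
pose g : 'M[R]_2 := \matrix_(i, j)
  (if i == 0 then if j == 0 then s^-1 else 0 else if j == 0 then - (b / a / r) else r^-1).
have gS : g *m S *m g^T = 1%:M.
  clearbody s r.
  have gSE i j : (g *m S *m g^T) i j =
     (g i 0 * a + g i 1 * b) * g j 0 + (g i 0 * b + g i 1 * d) * g j 1.
    have mul2 (A B : 'M[R]_2) k l : (A *m B) k l = A k 0 * B 0 l + A k 1 * B 1 l.
      by rewrite mxE !big_ord_recl big_ord0 l1 o0 addr0.
    by rewrite (mul2 (g *m S) g^T) !(mul2 g S) ![(g^T) _ _]mxE S10.
  have g00 : g 0 0 = s^-1 by rewrite mxE.
  have g01 : g 0 1 = 0 by rewrite mxE.
  have g10 : g 1 0 = - (b / a / r) by rewrite mxE.
  have g11 : g 1 1 = r^-1 by rewrite mxE.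
  have an0 : a != 0 by rewrite gt_eqF.
  apply/matrixP; apply: ord2P; apply: ord2P; rewrite gSE ?g00 ?g01 ?g10 ?g11 [RHS]mxE /=.
  - by rewrite !mul0r mulr0 !addr0 -sE; field.
  - by field; rewrite r0 s0 an0.
  - by field; rewrite r0 s0 an0.
  - have -> : (- (b / a / r) * a + r^-1 * b) * - (b / a / r) + (- (b / a / r) * b + r^-1 * d) * r^-1
      = (d - b ^+ 2 / a) / r ^+ 2 by field; rewrite r0 an0.
    by rewrite -rE divff // expf_neq0.
exists g; first by move: gS; rewrite -mulmxA => /mulmx1_unit[].
by rewrite -gS SE trmx_mul !mulmxA.
Qed.

Lemma chart_compatible {M : topologicalType} {m} (X : @manifold R M m) (w J : M -> 'M[R]_m) c x :
  symplectic X w -> almost_complex X J -> compatible w J -> atlas X c -> cimg c x ->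
  compatible_mx (form_in X w c x) (endo_in X J c x).
Proof.
move=> hw hJ hc Xc cx; have tu := tchange_unit Xc cx.
have [gT gpos] := hc (cinv c x); rewrite /gJ in gT gpos.
have wT := symplectic_alt hw (cinv c x); have JJ := almost_complex_sqr hJ (cinv c x).
rewrite /form_in /endo_in.
move: (tchange X c x) (w (cinv c x)) (J (cinv c x)) tu gT gpos wT JJ => t W K tu gT gpos wT JJ.
have JW : t *m K *m invmx t *m (t *m W *m t^T) = t *m (K *m W) *m t^T.
  by rewrite !mulmxA mulmxKV.
split.
- by rewrite !trmx_mul trmxK wT mulNmx mulmxN mulmxA.
- by rewrite !mulmxA mulmxKV // -(mulmxA t) JJ mulmxN mulNmx mulmx1 mulmxV.
- by rewrite JW !trmx_mul trmxK -trmx_mul gT !mulmxA.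
- move=> u u0; rewrite JW.
  have -> : u *m (t *m (K *m W) *m t^T) *m u^T = (u *m t) *m (K *m W) *m (u *m t)^T.
    by rewrite trmx_mul !mulmxA.
  apply: gpos; apply: contra u0 => /eqP ut; apply/eqP.
  by rewrite -[u](mulmxK tu) ut mul0mx.
Qed.

End orthonormalization.

Definition to_set_type {T : Type} {A : set T} (x : T) (h : A x) : set_type A :=
  exist (fun y => y \in A) x (mem_set h).

(** * Topology of the pinched torus *)

Section pinched_torus_topology.
Context {R : realType} {M : topologicalType} (X : @manifold R M (2 + 2)).
Variables (w : M -> 'M[R]_(2 + 2)) (p : S1 R * R -> M) (p0 : M).
Hypothesis htorus : lagrangian_pinched_torus X w p p0.

Lemma within_comp_cvg {T U V : topologicalType} {A : set U} (h : T -> U) (g : U -> V) t :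
  {within A, continuous g} -> {for t, continuous h} -> (forall s, A (h s)) ->
  {for t, continuous (g \o h)}.
Proof.
move=> /subspace_continuousP gc hc Ah W nW.
have := gc _ (Ah t) W nW; rewrite /within /= => H.
by apply: filterS (near_comp hc H) => s; apply.
Qed.

(** A continuous version of the parametrization on all of R * R; [p] itself is meaningful on
    [cylinder] only. *)
Definition unroll_clamp (z : R * R) : M := p (expi z.1, clamp (- 1) 1 z.2).

Lemma unroll_clamp_continuous : continuous unroll_clamp.
Proof.
move=> z; apply: (@within_comp_cvg _ _ _ cylinder (fun z : R * R => (expi z.1, clamp (-1) 1 z.2)) p).
- exact: pinched_continuous htorus.
- apply: (@cvg_pairl _ _ _ (nbhs z) _ (fun z : R * R => expi z.1) (fun z : R * R => clamp (-1) 1 z.2)).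
    by apply: (@cvg_comp _ _ _ fst (@expi R)); [exact: cvg_fst|exact: expi_continuous].
  by apply: (@cvg_comp _ _ _ snd (clamp (-1) 1)); [exact: cvg_snd|exact: clamp_continuous].
- move=> s; rewrite /cylinder /=; apply: clamp_itv; lra.
Qed.

Lemma expi_surj01 (z : S1 R) : exists2 t, 0 <= t <= 1 & z = expi t.
Proof.
have [t ->] := expi_surj z; exists (t - (Num.floor t)%:~R).
  have /andP[] := floor_itv t; rewrite intrD rmorph1 => h1 h2; apply/andP; split; lra.
by rewrite -mulrNz expi_shift.
Qed.

(** Both end circles go to p0, and compactness of one period makes the collar uniform in z. *)
Lemma ends_near (U : set M) : nbhs p0 U ->
  exists2 rho : R, 0 < rho < 1 & forall z r, rho <= `|r| <= 1 -> U (p (z, r)).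
Proof.
move=> Up0.
have near_end (s : R) : s = 1 \/ s = -1 ->
    \forall r \near s, forall t, `[0, 1]%classic t -> U (unroll_clamp (t, r)).
  move=> s1; apply: (tube (P := fun t r => U (unroll_clamp (t, r))) (@segment_compact R 0 1)) => t _.
  have h : \forall z \near (t, s), U (unroll_clamp z).
    apply: near_comp; first exact: unroll_clamp_continuous.
    rewrite /unroll_clamp /= clamp_id; last by case: s1 => ->; apply/andP; split; lra.
    by have [h1 h2] := pinched_point htorus (expi t); case: s1 => ->; rewrite ?h1 ?h2.
  by apply: filterS h => -[].
have /nbhs_ballP[e /= e0 he] := near_end 1 (or_introl erefl).
have /nbhs_ballP[d /= d0 hd] := near_end (-1) (or_intror erefl).
pose m := Num.min (1 / 2) (Num.min (e / 2) (d / 2)).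
have [m0 m1 me md] : [/\ 0 < m, m <= 1 / 2, m < e & m < d].
  split; rewrite /m ?lt_min ?divr_gt0 ?ltr01 // ?ge_min ?lexx //.
    by rewrite !gt_min; apply/orP; right; apply/orP; left; lra.
  by rewrite !gt_min; apply/orP; right; apply/orP; right; lra.
exists (1 - m); first by apply/andP; split; lra.
move=> z r /andP[r1 r2]; have [t t01 ->] := expi_surj01 z.
have tt : `[0, 1]%classic t by rewrite /= in_itv.
have rr : -1 <= r <= 1 by rewrite -ler_norml.
have -> : p (expi t, r) = unroll_clamp (t, r) by rewrite /unroll_clamp /= clamp_id.
have [r0|r0] := lerP 0 r.
  rewrite ger0_norm // in r1 r2.
  apply: he tt; rewrite /ball /= ger0_norm; lra.
rewrite ltr0_norm // in r1 r2.
apply: hd tt; rewrite /ball /= ler0_norm; lra.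
Qed.

Lemma open_cylinder_injective z r z' r' : -1 < r < 1 -> -1 < r' < 1 ->
  p (z, r) = p (z', r') -> (z, r) = (z', r').
Proof.
move=> r1 r1' e; have [inj _] := pinched_embedding htorus.
have m1 : open_cylinder (R := R) (z, r) by [].
have m2 : open_cylinder (R := R) (z', r') by [].
by have := inj (to_set_type m1) (to_set_type m2) e; move=> /(congr1 val).
Qed.

Lemma pinch_notin_orbit z r : -1 < r < 1 -> p (z, r) <> p0.
Proof.
move=> r1 pr; have [e [inj _] pe] := pinched_factor htorus.
have m1 : cylinder (R := R) (z, r).
  by rewrite /cylinder /=; case/andP: r1 => *; apply/andP; split; lra.
have m2 : cylinder (R := R) (z, 1).
  by rewrite /cylinder /=; apply/andP; split; lra.
have : e (pinch (to_set_type m1)) = e (pinch (to_set_type m2)).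
  by rewrite -!pe /= pr (pinched_point htorus z).1.
move=> /inj /eqmodP /asboolP[/(congr1 val) /= [rE]|[/= rE _]]; case/andP: r1 => h1 h2.
  by move: h2; rewrite rE ltxx.
have : `|r| < 1 by rewrite ltr_norml h1.
by rewrite rE ltxx.
Qed.

(** The part of the torus with modulus of r at most rho is compact, hence closed, and misses p0.
    Together with [ends_near] it identifies neighbourhoods of p0 in the torus with collars of the
    two ends. *)
Lemma near_pinch_point (rho : R) : 0 <= rho < 1 ->
  \forall q \near p0, forall z r, `|r| <= 1 -> p (z, r) = q -> rho < `|r|.
Proof.
move=> /andP[rho0 rho1].
pose K := unroll_clamp @` (`[0, 1]%classic `*` `[- rho, rho]%classic).
have cK : compact K.
  apply: continuous_compact; first by apply: continuous_subspaceT; exact: unroll_clamp_continuous.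
  by apply: compact_setX; exact: segment_compact.
have Kp0 : ~ K p0.
  move=> [[t r] [/= _]]; rewrite in_itv /= => /andP[r1 r2].
  rewrite /unroll_clamp /= clamp_id; last by apply/andP; split; lra.
  by apply: pinch_notin_orbit; apply/andP; split; lra.
have : nbhs p0 (~` K).
  apply: open_nbhs_nbhs; split=> //; apply: closed_openC.
  exact: compact_closed (manifold_hausdorff X) cK.
apply: filterS => q Kq z r r1 pq; rewrite ltNge; apply/negP => rr; apply: Kq.
have [t t01 zE] := expi_surj01 z; exists (t, r).
  by split=> /=; rewrite in_itv //= -ler_norml.
by rewrite /unroll_clamp /= clamp_id -?ler_norml // -zE.
Qed.

(** Continuity of the coordinates comes from the embedding of the open cylinder: each of its open
    sets is the trace of an open set of M. *)
Lemma cylinder_lift {T : topologicalType} (f : T -> M) :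
  continuous f -> (forall t, (p @` open_cylinder (R := R)) (f t)) ->
  exists z : T -> S1 R, exists r : T -> R,
    [/\ continuous z, continuous r & forall t, -1 < r t < 1 /\ p (z t, r t) = f t].
Proof.
move=> fc fo; have [_ emb] := pinched_embedding htorus.
have /choice[y yP] t : exists y : set_type (open_cylinder (R := R)), p (val y) = f t.
  by have [x ox <-] := fo t; exists (to_set_type ox).
have yc : continuous y.
  move=> t W; rewrite nbhsE => -[U [oU Uy] UW].
  have [V oV UE] := (emb U).1 oU.
  have Vf : V (f t) by rewrite -yP; have : ((fun y0 => p (val y0)) @^-1` V) (y t) by rewrite -UE.
  have : \forall s \near t, V (f s) by apply: near_comp (fc t) _; exact: open_nbhs_nbhs.
  apply: filterS => s Vs; apply: UW; rewrite UE /=; by rewrite yP.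
exists (fun t => (val (y t)).1), (fun t => (val (y t)).2); split.
- move=> t; apply: (@cvg_comp _ _ _ (fun t => val (y t)) fst (nbhs t) (nbhs (val (y t)))).
    by apply: (@cvg_comp _ _ _ y val (nbhs t) (nbhs (y t))); [exact: yc|exact: val_continuous].
  exact: cvg_fst.
- move=> t; apply: (@cvg_comp _ _ _ (fun t => val (y t)) snd (nbhs t) (nbhs (val (y t)))).
    by apply: (@cvg_comp _ _ _ y val (nbhs t) (nbhs (y t))); [exact: yc|exact: val_continuous].
  exact: cvg_snd.
- move=> t; split; first by have := set_mem (valP (y t)).
  by rewrite -yP; case: (val (y t)).
Qed.

End pinched_torus_topology.

(** The case split at 1/2 decides which of the two weights is bounded away from 0 and yields the
    strict inequality. *)
Lemma convex_lt {R : realType} (k a b x y : R) : 0 <= k -> k <= 1 ->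
  x < a -> a < y -> x < b -> b < y -> x < (1 - k) * a + k * b < y.
Proof.
move=> k0 k1 xa ay xb by_; apply/andP; split; case: (lerP k (1 / 2)) => kh.
- have : 1 / 2 * (a - x) <= (1 - k) * (a - x) by rewrite ler_wpM2r //; lra.
  have : 0 <= k * (b - x) by rewrite mulr_ge0 //; lra.
  lra.
- have : 1 / 2 * (b - x) <= k * (b - x) by rewrite ler_wpM2r //; lra.
  have : 0 <= (1 - k) * (a - x) by rewrite mulr_ge0 //; lra.
  lra.
- have : 1 / 2 * (y - a) <= (1 - k) * (y - a) by rewrite ler_wpM2r //; lra.
  have : 0 <= k * (y - b) by rewrite mulr_ge0 //; lra.
  lra.
- have : 1 / 2 * (y - b) <= k * (y - b) by rewrite ler_wpM2r //; lra.
  have : 0 <= (1 - k) * (y - a) by rewrite mulr_ge0 //; lra.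
  lra.
Qed.

(** * Winding numbers near the pinch point *)

Section generator_determinant.
Context {R : realType} {M : topologicalType} (X : @manifold R M (2 + 2)).
Variables (w J : M -> 'M[R]_(2 + 2)) (Phi : 'rV[R]_2 -> M -> M).
Variables (p : S1 R * R -> M) (p0 : M).
Hypotheses (hw : symplectic X w) (hJ : almost_complex X J) (hcompat : compatible w J).
Hypothesis hPhi : hamiltonian_action X w Phi.
Hypothesis htorus : lagrangian_pinched_torus X w p p0.
Hypothesis hfixed : forall u, Phi u p0 = p0.
Hypothesis horbit : exists2 q, (p @` open_cylinder (R := R)) q &
  p @` open_cylinder (R := R) = range (fun u => Phi u q).
Hypothesis hregular : forall q, (p @` open_cylinder (R := R)) q ->
  \rank (generators X Phi q) = 2%N.
Local Notation o := (p @` open_cylinder (R := R)).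
Local Notation C := (R[i]^o).
Let Phi0 := action0 hPhi.
Let PhiD := actionD hPhi.
Let PhiS := action_smooth hPhi.

(** Invertibility of this matrix encodes the condition on Y required by [cdet_neq0], in a form that
    is visibly open ([near_reference]). *)
Definition reference_mx (Jx : 'M[R]_(2 + 2)) (Y : 'M[R]_(2 + 2, 2)) : 'M[R]_(2 + 2) :=
  col_mx Y^T (Jx *m Y)^T.

Lemma reference_mxP Jx Y : reference_mx Jx Y \in unitmx <->
  forall a : 'rV[R]_(2 + 2), a *m Y = 0 -> a *m Jx *m Y = 0 -> a = 0.
Proof.
have E (a : 'rV[R]_(2 + 2)) : a *m (reference_mx Jx Y)^T = row_mx (a *m Y) (a *m Jx *m Y).
  by rewrite /reference_mx tr_col_mx !trmxK mul_mx_row mulmxA.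
split=> [u a aY aJ|h].
  by apply: (can_inj (mulmxK (_ : (reference_mx Jx Y)^T \in unitmx))); rewrite ?unitmx_tr // E aY aJ row_mx0 mul0mx.
rewrite -unitmx_tr -row_free_unit; apply: inj_row_free => a.
rewrite E => e; have [aY aJ] := eq_row_mx (etrans e (esym (row_mx0 _ _ _ _))).
exact: h aY aJ.
Qed.

Lemma endo_in_cvg c x : atlas X c -> cimg c x -> {for x, continuous (endo_in X J c)}.
Proof.
move=> Xc cx.
have h := almost_complex_smooth hJ Xc.
have h0 := h 0%N.
have h1 := h0 x.
have h2 := h1 (mem_set cx).
exact: h2.
Qed.

Lemma form_in_cvg c x : atlas X c -> cimg c x -> {for x, continuous (form_in X w c)}.
Proof.
move=> Xc cx.
have h := symplectic_smooth hw Xc.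
have h0 := h 0%N.
have h1 := h0 x.
have h2 := h1 (mem_set cx).
exact: h2.
Qed.

Lemma near_reference c x Y : atlas X c -> cimg c x -> reference_mx (endo_in X J c x) Y \in unitmx ->
  \forall y \near x, reference_mx (endo_in X J c y) Y \in unitmx.
Proof.
have detE (A : 'M[R]_(2 + 2)) : (A \in unitmx) = (\det A != 0) by rewrite unitmxE unitfE.
move=> Xc cx u; have d0 := u; rewrite detE in d0.
have h : (fun y => \det (reference_mx (endo_in X J c y) Y)) @ nbhs x -->
    \det (reference_mx (endo_in X J c x) Y).
  apply: det_cvg; apply: col_mx_cvg; first exact: cvg_cst.
  by apply: trmx_cvg; apply: mulmx_cvg; [exact: endo_in_cvg|exact: cvg_cst].
have : \forall y \near x, \det (reference_mx (endo_in X J c y) Y) != 0 by exact: (cvgr_neq0 _ h).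
by apply: filterS => y; rewrite detE.
Qed.

Variables (c : @chart R M (2 + 2)) (Xc : atlas X c) (Y : 'M[R]_(2 + 2, 2)).
Local Notation gen := (generators_in Phi c).
Local Notation Jc := (endo_in X J c).
Local Notation wc := (form_in X w c).

(** Y is a fixed matrix in the coordinates of c; at a good point it is a valid reference for [cdet],
    so that determinants at different good points can be compared. *)
Definition good (q : M) : Prop := cdom c q /\ reference_mx (Jc (cmap c q)) Y \in unitmx.

Definition gdet (q : M) : C := cdet (Jc (cmap c q)) Y (gen (cmap c q)).

Lemma near_good q : good q -> \forall q' \near q, good q'.
Proof.
move=> [cq uq]; apply: filterS2 (near_cdom cq) (near_comp (cmap_cvg cq) (near_reference Xc (cmapP cq) uq)).
by [].
Qed.

Lemma gdet_continuous q : good q -> {for q, continuous gdet}.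
Proof.
move=> [cq _]; have cc := cmap_cvg cq; have ccq := cmapP cq.
apply: (@cdet_cvg R M (nbhs q) _ _ (fun q => Jc (cmap c q)) (cst Y) (fun q => gen (cmap c q))).
- exact: (@cvg_comp _ _ _ (cmap c) Jc (nbhs q) _ _ cc (endo_in_cvg Xc ccq)).
- exact: cvg_cst.
- exact: (@cvg_comp _ _ _ (cmap c) gen (nbhs q) _ _ cc (generators_in_cvg Phi0 PhiS Xc ccq)).
Qed.

Lemma generators_in_lagrangian q : o q -> cdom c q -> lagrangian (wc (cmap c q)) (gen (cmap c q)).
Proof.
move=> oq cq; have := generators_lagrangian hw hPhi htorus horbit hregular oq.
rewrite (generators_chart Phi0 PhiS Xc cq) /lagrangian /form_in (cmapK cq).
move: (tchange_unit Xc (cmapP cq)); move: (tchange X c (cmap c q)) => T Tu [h1 h2]; split.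
  by rewrite -[RHS]h1 trmx_mul !mulmxA.
by move: h2; rewrite /row_free mxrankMfree // row_free_unit.
Qed.

Lemma gdet_neq0 q : o q -> good q -> gdet q != 0.
Proof.
move=> oq [cq uq]; have cp := chart_compatible hw hJ hcompat Xc (cmapP cq).
apply: (lagrangian_cdet cp); first exact/reference_mxP.
exact: generators_in_lagrangian.
Qed.

Lemma gdet_act u q : act_dom Phi c c (u, cmap c q) -> cdom c q ->
  gdet (Phi u q) = cdet (Jc (act_in Phi c c (u, cmap c q))) Y (gen (cmap c q) *m dact_in Phi c c u (cmap c q)).
Proof.
move=> dq cq; rewrite /gdet -(generators_in_act Phi0 PhiD PhiS Xc Xc dq).
by rewrite /act_in /= (cmapK cq).
Qed.

Variable rho : R.
Hypothesis rho01 : 0 < rho < 1.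
Hypothesis rho_good : forall z r, rho <= `|r| <= 1 -> good (p (z, r)).

(** The sign s selects an end of the cylinder: s * r then runs up to 1 as r approaches that end. *)
Lemma end_range (s r : R) : s = 1 \/ s = -1 -> rho < s * r < 1 ->
  [/\ -1 < r < 1, `|r| = s * r & rho <= `|r| <= 1].
Proof.
have r0 : 0 < rho by case/andP: rho01.
case=> -> /andP[h1 h2].
  have e : `|r| = 1 * r by rewrite ger0_norm ?mul1r //; lra.
  by split=> //; [apply/andP; split; lra|rewrite e; apply/andP; split; lra].
have e : `|r| = -1 * r by rewrite ler0_norm ?mulN1r //; lra.
by split=> //; [apply/andP; split; lra|rewrite e; apply/andP; split; lra].
Qed.

(** Angles and radii are interpolated linearly. Both angles grow by the same integer n, so every
    intermediate path closes up, and by convexity of the condition on s * r it stays in the same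
    end, where [gdet] has no zero. *)
Lemma gdet_winding_homotopy (s : R) (n : int) (th th' r r' : R -> R) d d' :
  s = 1 \/ s = -1 -> continuous th -> continuous th' -> continuous r -> continuous r' ->
  (forall t, rho < s * r t < 1) -> (forall t, rho < s * r' t < 1) ->
  th 1 = th 0 + n%:~R -> th' 1 = th' 0 + n%:~R -> r 1 = r 0 -> r' 1 = r' 0 ->
  winding (fun t => gdet (p (expi (th t), r t))) d ->
  winding (fun t => gdet (p (expi (th' t), r' t))) d' -> d = d'.
Proof.
move=> s1 thc thc' rc rc' rr rr' th1 th1' r1 r1' wd wd'.
pose k (x : R) := clamp 0 1 x.
pose A (z : R * R) := (1 - k z.2) * th z.1 + k z.2 * th' z.1.
pose B (z : R * R) := (1 - k z.2) * r z.1 + k z.2 * r' z.1.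
have mix (f f' : R -> R) : continuous f -> continuous f' ->
    continuous (fun z : R * R => (1 - k z.2) * f z.1 + k z.2 * f' z.1).
  move=> fc fc' z.
  have kc : (fun z : R * R => k z.2) @ nbhs z --> k z.2.
    by apply: (@cvg_comp _ _ _ snd k (nbhs z) (nbhs z.2)); [exact: cvg_snd|exact: clamp_continuous].
  have h g : continuous g -> (fun z : R * R => g z.1 : R) @ nbhs z --> g z.1.
    by move=> gc; apply: (@cvg_comp _ _ _ fst g (nbhs z) (nbhs z.1)); [exact: cvg_fst|exact: gc].
  apply: cvgD; apply: cvgM; [|exact: h|exact: kc|exact: h].
  by apply: cvgB; [exact: cvg_cst|exact: kc].
have Br z : rho < s * B z < 1.
  have /andP[k0 k1] := clamp_itv z.2 (@ler01 R).
  have /andP[h1 h2] := rr z.1; have /andP[h3 h4] := rr' z.1.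
  have -> : s * B z = (1 - k z.2) * (s * r z.1) + k z.2 * (s * r' z.1) by rewrite /B; ring.
  exact: convex_lt.
pose H (t u : R) : C := gdet (p (expi (A (t, u)), B (t, u))).
have pE z : p (expi (A z), B z) = unroll_clamp p (A z, B z).
  by have [h _ _] := end_range s1 (Br z); rewrite /unroll_clamp /= clamp_id //; lra.
have Hg z : good (p (expi (A z), B z)).
  by have [_ _ h] := end_range s1 (Br z); exact: rho_good.
apply: (@winding_homotopy R H).
- have -> : (fun z : R * R => H z.1 z.2) = gdet \o (fun z => p (expi (A z), B z)).
    by apply/funext => -[].
  move=> z; apply: (@continuous_comp _ _ _ (fun z => p (expi (A z), B z)) gdet).
    rewrite (_ : (fun z => p _) = unroll_clamp p \o (fun z => (A z, B z))); last exact/funext.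
    apply: continuous_comp; last exact: (unroll_clamp_continuous htorus).
    by apply: (@cvg_pairl _ _ _ (nbhs z) _ A B); exact: mix.
  exact: gdet_continuous.
- move=> t u; apply: gdet_neq0; last exact: Hg.
  by have [h _ _] := end_range s1 (Br (t, u)); exists (expi (A (t, u)), B (t, u)).
- move=> u.
  have eB : B (1, u) = B (0, u) by rewrite /B /= r1 r1'.
  have eA : A (1, u) = A (0, u) + n%:~R by rewrite /A /= th1 th1'; ring.
  by rewrite /H eB eA expi_shift.
- have e t : H t 0 = gdet (p (expi (th t), r t)).
    have k0 : k 0 = 0 by rewrite /k clamp_id // lexx ler01.
    have eA : A (t, 0) = th t by rewrite /A /= k0; ring.
    have eB : B (t, 0) = r t by rewrite /B /= k0; ring.
    by rewrite /H eA eB.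
  have -> : H ^~ 0 = (fun t => gdet (p (expi (th t), r t))) by apply/funext => t; exact: e.
  exact: wd.
- have e t : H t 1 = gdet (p (expi (th' t), r' t)).
    have k1 : k 1 = 1 by rewrite /k clamp_id // lexx ler01.
    have eA : A (t, 1) = th' t by rewrite /A /= k1; ring.
    have eB : B (t, 1) = r' t by rewrite /B /= k1; ring.
    by rewrite /H eA eB.
  have -> : H ^~ 1 = (fun t => gdet (p (expi (th' t), r' t))) by apply/funext => t; exact: e.
  exact: wd'.
Qed.

End generator_determinant.

(** * Compactness for orthonormal bases *)

Lemma compact_unit_matrices {R : realType} m n :
  compact [set A : 'M[R]_(m, n) | forall i j, `|A i j| <= 1].
Proof.
pose V : set 'rV[R]_(m * n) := [set v | forall i, `[-1, 1]%classic (v ord0 i)].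
have cV : compact V by exact: (@rV_compact R _ (fun=> `[-1,1]%classic) (fun=> @segment_compact R (-1) 1)).
have -> : [set A : 'M[R]_(m, n) | forall i j, `|A i j| <= 1] = vec_mx @` V.
  apply/seteqP; split=> [A A1|_ [v v1 <-] i j].
    exists (mxvec A); last exact: mxvecK.
    move=> k; case/mxvec_indexP: k => i j; rewrite mxvecE /= in_itv /= -ler_norml.
    exact: A1.
  by have := v1 (mxvec_index i j); rewrite /= in_itv /= -ler_norml mxE.
apply: continuous_compact cV; apply: continuous_subspaceT => v.
apply: (@cvg_mxP R _ (nbhs v) _ m n vec_mx (vec_mx v)).2 => i j.
rewrite mxE; under eq_fun do rewrite mxE.
exact: coord_continuous.
Qed.

Lemma orthonormal_bounded {R : realType} m n (A : 'M[R]_(m, n)) : A *m A^T = 1%:M ->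
  forall i j, `|A i j| <= 1.
Proof.
move=> AA i j; have /matrixP/(_ i i) := AA; rewrite mxE [RHS]mxE eqxx => h.
have : A i j ^+ 2 <= 1.
  rewrite -[leRHS]h (bigD1 j) //= [(_^T) _ _]mxE -expr2 lerDl sumr_ge0 // => k _.
  by rewrite mxE -expr2 sqr_ge0.
move=> h1; have n0 : 0 <= `|A i j| by [].
have : `|A i j| ^+ 2 <= 1 by rewrite real_normK ?num_real.
by nra.
Qed.

(** * Loops swept by the action near the ends *)

Section orbit_loops.
Context {R : realType} {M : topologicalType} (X : @manifold R M (2 + 2)).
Variables (w J : M -> 'M[R]_(2 + 2)) (Phi : 'rV[R]_2 -> M -> M).
Variables (p : S1 R * R -> M) (p0 : M).
Hypotheses (hw : symplectic X w) (hJ : almost_complex X J) (hcompat : compatible w J).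
Hypothesis hPhi : hamiltonian_action X w Phi.
Hypothesis htorus : lagrangian_pinched_torus X w p p0.
Hypothesis hfixed : forall u, Phi u p0 = p0.
Hypothesis horbit : exists2 q, (p @` open_cylinder (R := R)) q &
  p @` open_cylinder (R := R) = range (fun u => Phi u q).
Hypothesis hregular : forall q, (p @` open_cylinder (R := R)) q ->
  \rank (generators X Phi q) = 2%N.
Local Notation o := (p @` open_cylinder (R := R)).
Local Notation C := (R[i]^o).
Let Phi0 := action0 hPhi.
Let PhiD := actionD hPhi.
Let PhiS := action_smooth hPhi.
Variables (c : @chart R M (2 + 2)) (Xc : atlas X c) (Y : 'M[R]_(2 + 2, 2)).
Local Notation gen := (generators_in Phi c).
Local Notation Jc := (endo_in X J c).
Local Notation wc := (form_in X w c).
Local Notation gdet := (gdet X J Phi c Y).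
Variable rho : R.
Hypothesis rho01 : 0 < rho < 1.
Hypothesis rho_good : forall z r, rho <= `|r| <= 1 -> good X J c Y (p (z, r)).

Lemma good_pinch_point : good X J c Y p0.
Proof.
have [<- _] := pinched_point htorus (expi 0); apply: rho_good; rewrite normr1 lexx andbT.
by case/andP: rho01 => _ /ltW.
Qed.

(** The loops through p (1, b s), with b shrinking tau to 0, form a homotopy inside o from the core
    circle to the loop through p (1, tau). The core circle turns once, so the lifted angle of each
    loop increases by exactly 1. *)
Lemma orbit_loop (u : R -> 'rV[R]_2) (tau : R) : -1 < tau < 1 ->
  continuous u -> u 0 = 0 -> (forall t, Phi (u t) (p (expi 0, 0)) = p (expi (clamp 0 1 t), 0)) ->
  exists th : R -> R, exists r : R -> R,
    [/\ continuous th /\ continuous r,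
        th 1 = th 0 + 1 /\ (exists n : int, th 0 = n%:~R),
        r 0 = tau /\ r 1 = tau &
        forall t, -1 < r t < 1 /\ p (expi (th t), r t) = Phi (u t) (p (expi 0, tau))].
Proof.
move=> tau1 uc u0 uP.
have [tau_gt tau_lt] : -1 < tau /\ tau < 1 by case/andP: tau1.
pose b (s : R) := clamp 0 1 s * tau.
have bt s : -1 < b s < 1.
  have /andP[k0 k1] := clamp_itv s (@ler01 R); rewrite /b.
  by apply/andP; split; [have := mulr_ge0 k0 (_ : 0 <= tau + 1)|have := mulr_ge0 k0 (_ : 0 <= 1 - tau)];
    rewrite ?subr_ge0; nra.
have qo s : o (p (expi 0, b s)) by exists (expi 0, b s) => //; exact: bt.
have bcl s : unroll_clamp p (0, b s) = p (expi 0, b s).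
  by rewrite /unroll_clamp /= clamp_id //; have /andP[h1 h2] := bt s; lra.
pose f (z : R * R) := Phi (u z.1) (p (expi 0, b z.2)).
have fc : continuous f.
  move=> z; have u1 : (fun z : R * R => u z.1) @ nbhs z --> u z.1.
    by apply: (@cvg_comp _ _ _ fst u (nbhs z) (nbhs z.1)); [exact: cvg_fst|exact: uc].
  have q1 : (fun z : R * R => p (expi 0, b z.2)) @ nbhs z --> p (expi 0, b z.2).
    rewrite -bcl; under eq_fun do rewrite -bcl.
    apply: (@cvg_comp _ _ _ (fun z : R * R => (0 : R, b z.2)) (unroll_clamp p) (nbhs z) (nbhs (0, b z.2))).
      apply: (@cvg_pairl _ _ _ (nbhs z) _ (cst 0) (fun z : R * R => b z.2)); first exact: cvg_cst.
      apply: (@cvg_comp _ _ _ snd b (nbhs z) (nbhs z.2)); first exact: cvg_snd.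
      by apply: cvgM; [exact: clamp_continuous|exact: cvg_cst].
    exact: (unroll_clamp_continuous htorus).
  exact: (act_cvg_comp PhiS u1 q1).
have fo z : o (f z) by exact: orbit_closed hPhi horbit _ _ (qo z.2).
have [z [r [zc rc zr]]] := cylinder_lift htorus fc fo.
(* Every point of o is Phi^v of the base point, and Phi^v commutes with Phi^{u(1)}. *)
have fix1 q : o q -> Phi (u 1) q = q.
  have o0 : o (p (expi 0, 0)) by exists (expi 0, 0) => //=; rewrite /open_cylinder /=; apply/andP; split; lra.
  move=> oq; have [v <-] := orbit_trans hPhi horbit o0 oq.
  rewrite -PhiD addrC PhiD uP clamp_id ?lexx ?ler01 //.
  by have := expi_shift (0 : R) 1; rewrite add0r => ->.
have at0 s : (z (0, s), r (0, s)) = (expi 0, b s).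
  have [h1 h2] := zr (0, s); apply: (open_cylinder_injective htorus h1 (bt s)).
  by rewrite h2 /f /= u0 Phi0.
have at1 s : (z (1, s), r (1, s)) = (expi 0, b s).
  have [h1 h2] := zr (1, s); apply: (open_cylinder_injective htorus h1 (bt s)).
  by rewrite h2 /f /= fix1.
have ats0 t : z (t, 0) = expi (clamp 0 1 t).
  have [h1 h2] := zr (t, 0).
  have b0 : b 0 = 0 by rewrite /b clamp_id ?mul0r // lexx ler01.
  have m0 : -1 < (0 : R) < 1 by apply/andP; split; lra.
  have : (z (t, 0), r (t, 0)) = (expi (clamp 0 1 t), 0).
    by apply: (open_cylinder_injective htorus h1 m0); rewrite h2 /f /= b0 uP.
  by case.
pose H (t s : R) : C := val (z (t, s)).
have Hc : continuous (fun z : R * R => H z.1 z.2).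
  move=> y; rewrite /H; have : (fun y0 => val (z y0) : C) @ nbhs y --> (val (z y) : C).
    by apply: (@cvg_comp _ _ _ z (fun x : S1 R => val x : C) (nbhs y) (nbhs (z y))); [exact: zc|exact: val_S1_continuous].
  by have -> : (fun z0 : R * R => val (z (z0.1, z0.2)) : C) = (fun y0 => val (z y0)) by [apply/funext => -[]]; case: y.
have H0 t s : H t s != 0 by exact: S1_neq0.
have H1c : continuous (H ^~ 1).
  move=> t; apply: (@continuous_comp _ _ _ (fun t => (t, 1 : R)) (fun y : R * R => H y.1 y.2)).
    exact: pairl_continuous.
  exact: Hc.
have [th thP] := arg_lift H1c (fun t => H0 t 1).
have w1 : winding (H ^~ 1) (th 1 - th 0) by exists th.
have w0 : winding (H ^~ 0) 1.
  exists (clamp 0 1); last by rewrite !clamp_id ?lexx ?ler01 // subr0.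
  split; first exact: clamp_continuous.
  by move=> t; rewrite /H ats0 val_expi norm_cis mul1r.
have Hl s : H 0 s = H 1 s.
  by rewrite /H; have [-> _] := at0 s; have [-> _] := at1 s.
have th1 := winding_homotopy Hc H0 Hl w0 w1.
have zth t : z (t, 1) = expi (th t).
  by apply: val_inj; have := thP.2 t; rewrite /H S1_norm mul1r => ->.
have b1 : b 1 = tau by rewrite /b clamp_id ?mul1r // lexx ler01.
exists th, (fun t => r (t, 1)); split.
- split; first exact: thP.1.
  move=> t; apply: (@continuous_comp _ _ _ (fun t => (t, 1 : R)) r); last exact: rc.
  exact: pairl_continuous.
- split; first lra.
  have [e _] := at0 1; move: e; rewrite zth => /expi_eq[n]; rewrite add0r => e.
  by exists n.
- by have [_ e0] := at0 1; have [_ e1] := at1 1; rewrite e0 e1 b1.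
- by move=> t; have [h1 h2] := zr (t, 1); split=> //; rewrite -zth h2 /f /= b1.
Qed.

(** As p0 is fixed and [0, 1] is compact, points close enough to p0 remain close to it during the
    whole motion. The orbit loop therefore stays in one end and turns once there, so it is homotopic
    in this end to the circle of radius tau. *)
Lemma orbit_loop_winding (u : R -> 'rV[R]_2) :
  continuous u -> u 0 = 0 -> (forall t, u t = u (clamp 0 1 t)) ->
  (forall t, Phi (u t) (p (expi 0, 0)) = p (expi (clamp 0 1 t), 0)) ->
  exists2 rho1 : R, rho <= rho1 < 1 & forall s tau d, s = 1 \/ s = -1 -> rho1 < s * tau < 1 ->
    winding (fun t => gdet (p (expi t, tau))) d ->
    winding (fun t => gdet (Phi (u t) (p (expi 0, tau)))) d.
Proof.
move=> uc u0 ucl uP; have [rho_gt rho_lt] : 0 < rho /\ rho < 1 by case/andP: rho01.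
have rr : 0 <= rho < 1 by rewrite ltW.
pose N q := forall z r, `|r| <= 1 -> p (z, r) = q -> rho < `|r|.
have Nnear : \forall q \near p0, N q by exact: near_pinch_point htorus _ rr.
have : \forall q \near p0, forall t, `[0, 1]%classic t -> N (Phi (u t) q).
  apply: (tube (P := fun t q => N (Phi (u t) q)) (@segment_compact R 0 1)) => t _.
  have h : (fun z : R * M => Phi (u z.1) z.2) @ nbhs (t, p0) --> p0.
    rewrite -[X in _ --> X](hfixed (u t)); apply: (act_cvg_comp PhiS).
      by apply: (@cvg_comp _ _ _ fst u (nbhs (t, p0)) (nbhs t)); [exact: cvg_fst|exact: uc].
    exact: cvg_snd.
  exact: (h _ Nnear).
move=> /(ends_near htorus)[rho1 /andP[rho10 rho11] near_ends].
exists (Num.max rho rho1); first by rewrite le_max lexx gt_max rho_lt rho11.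
move=> s tau d s1 /andP[taur tau1] wd.
have [taur1 taur2] : rho < s * tau /\ rho1 < s * tau.
  by move: taur; rewrite gt_max => /andP.
have rng : rho < s * tau < 1 by rewrite taur1.
have [tau_1 tau_abs _] := end_range rho01 s1 rng.
have Nt t : N (Phi (u t) (p (expi 0, tau))).
  rewrite ucl; apply: near_ends; first by rewrite tau_abs; apply/andP; split; lra.
  by rewrite /= in_itv /= clamp_itv.
have [th [r [[thc rc] [th1 [n th0]] [r0 r1] pr]]] := orbit_loop tau_1 uc u0 uP.
have rabs t : rho < `|r t|.
  by have [/andP[h1 h2] e] := pr t; apply: (Nt t _ _ _ e); rewrite ler_norml; apply/andP; split; lra.
(* s * r starts at s * tau > 0 and its modulus stays above rho; passing to the other end would
   require a zero in between. *)
have srt t : rho < s * r t < 1.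
  have [/andP[h1 h2] _] := pr t.
  have srabs : `|s * r t| = `|r t| by case: s1 => ->; rewrite ?mul1r ?mulN1r ?normrN.
  have sr1 : s * r t < 1 by case: s1 => ->; lra.
  rewrite sr1 andbT ltNge; apply/negP => neg.
  have sr0 : s * r t < 0.
    have := rabs t; rewrite -srabs; case: (lerP 0 (s * r t)) => // h; rewrite ger0_norm //; lra.
  have src : continuous (fun t => s * r t).
    by move=> x; apply: cvgM; [exact: cvg_cst|exact: rc].
  have [x _ x0] : exists2 x, x \in `[Num.min 0 t, Num.max 0 t] & s * r x = 0.
    apply: (@IVT R (fun t => s * r t)); rewrite ?ge_min ?le_max ?lexx //.
      exact: continuous_subspaceT.
    have g1 : s * r t <= 0 by lra.
    have g2 : 0 <= s * tau by lra.
    by case: (leP 0 t) => _ /=; rewrite r0 g1 g2 ?orbT.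
  have xabs : `|r x| = `|s * r x| by case: s1 => ->; rewrite ?mul1r ?mulN1r ?normrN.
  by have := rabs x; rewrite xabs x0 normr0; lra.
have e t : gdet (Phi (u t) (p (expi 0, tau))) = gdet (p (expi (th t), r t)).
  by have [_ ->] := pr t.
have -> : (fun t => gdet (Phi (u t) (p (expi 0, tau)))) = (fun t => gdet (p (expi (th t), r t))).
  by apply/funext => t; exact: e.
have gc : continuous (fun t => gdet (p (expi (th t), r t))).
  move=> t; have [h1 _ h2] := end_range rho01 s1 (srt t).
  have pE : (fun t => p (expi (th t), r t)) = unroll_clamp p \o (fun t => (th t, r t)).
    apply/funext => x; have [/andP[k1 k2] _] := pr x.
    by rewrite /unroll_clamp /= clamp_id //; apply/andP; split; lra.
  have pc : {for t, continuous (fun t => p (expi (th t), r t))}.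
    rewrite pE; apply: continuous_comp; last exact: (unroll_clamp_continuous htorus).
    by apply: (@cvg_pairl _ _ _ (nbhs t) _ th r); [exact: thc|exact: rc].
  exact: (@continuous_comp _ _ _ (fun t => p (expi (th t), r t)) gdet t pc
    (gdet_continuous hJ hPhi Xc (rho_good _ h2))).
have gn0 t : gdet (p (expi (th t), r t)) != 0.
  have [h1 _ h2] := end_range rho01 s1 (srt t).
  by apply: (gdet_neq0 hw hJ hcompat hPhi htorus horbit hregular Xc _ (rho_good _ h2)); exists (expi (th t), r t).
have [d' wd'] := winding_exists gc gn0.
suff -> : d = d' by exact: wd'.
(* The lifted angle starts at some integer th 0; shifting the circle by it changes nothing and
   matches the starting angles. *)
have e' t : p (expi (th 0 + t), tau) = p (expi t, tau) by rewrite th0 addrC expi_shift.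
have wd2 : winding (fun t => gdet (p (expi (th 0 + t), cst tau t))) d.
  have -> : (fun t => gdet (p (expi (th 0 + t), cst tau t))) = (fun t => gdet (p (expi t, tau))).
    by apply/funext => t; rewrite /= e'.
  exact: wd.
have shc : continuous (fun t => th 0 + t).
  by move=> t; apply: cvgD; [exact: cvg_cst|exact: cvg_id].
have cc : continuous (cst tau : R -> R) by move=> t; exact: cvg_cst.
have th1' : th 1 = th 0 + 1%:~R by rewrite th1.
have sh1 : th 0 + 1 = th 0 + 0 + 1%:~R by rewrite addr0.
have r10 : r 1 = r 0 by rewrite r1 r0.
exact: (gdet_winding_homotopy hw hJ hcompat hPhi htorus horbit hregular Xc rho01 rho_good s1
  shc thc cc rc (fun=> rng) srt sh1 th1' erefl r10 wd2 wd').
Qed.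

End orbit_loops.

Lemma cvg_comp_at {T : Type} {U V : topologicalType} {F : set_system T}
    (f : T -> U) (g : U -> V) (h : T -> V) (x : U) (y : V) :
  h = g \o f -> g x = y -> f @ F --> x -> {for x, continuous g} -> h @ F --> y.
Proof. by move=> -> <- fx gx; exact: (@cvg_comp _ _ _ f g F (nbhs x) (nbhs (g x)) fx gx). Qed.

(** * Limit planes at the pinch point *)

Section limit_loops.
Context {R : realType} {M : topologicalType} (X : @manifold R M (2 + 2)).
Variables (w J : M -> 'M[R]_(2 + 2)) (Phi : 'rV[R]_2 -> M -> M).
Variables (p : S1 R * R -> M) (p0 : M).
Hypotheses (hw : symplectic X w) (hJ : almost_complex X J) (hcompat : compatible w J).
Hypothesis hPhi : hamiltonian_action X w Phi.
Hypothesis htorus : lagrangian_pinched_torus X w p p0.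
Hypothesis hfixed : forall u, Phi u p0 = p0.
Hypothesis horbit : exists2 q, (p @` open_cylinder (R := R)) q &
  p @` open_cylinder (R := R) = range (fun u => Phi u q).
Hypothesis hregular : forall q, (p @` open_cylinder (R := R)) q ->
  \rank (generators X Phi q) = 2%N.
Local Notation o := (p @` open_cylinder (R := R)).
Local Notation C := (R[i]^o).
Let Phi0 := action0 hPhi.
Let PhiD := actionD hPhi.
Let PhiS := action_smooth hPhi.
Variables (c : @chart R M (2 + 2)) (Xc : atlas X c) (Y : 'M[R]_(2 + 2, 2)).
Local Notation gen := (generators_in Phi c).
Local Notation Jc := (endo_in X J c).
Local Notation wc := (form_in X w c).
Local Notation gdet := (gdet X J Phi c Y).
Variable rho : R.
Hypothesis rho01 : 0 < rho < 1.
Hypothesis rho_good : forall z r, rho <= `|r| <= 1 -> good X J c Y (p (z, r)).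
Local Notation x0 := (cmap c p0).

Let gp0 : good X J c Y p0 := good_pinch_point htorus rho01 rho_good.
Let cp0 : cdom c p0 := gp0.1.
Let cx0 : cimg c x0 := cmapP cp0.

Lemma act_dom_fixed u : act_dom Phi c c (u, x0).
Proof. by split=> //=; rewrite (cmapK cp0) hfixed. Qed.

Lemma act_in_fixed u : act_in Phi c c (u, x0) = x0.
Proof. by rewrite /act_in /= (cmapK cp0) hfixed. Qed.

Variable u : R -> 'rV[R]_2.
Hypotheses (uc : continuous u) (u0 : u 0 = 0) (ucl : forall t, u t = u (clamp 0 1 t)).
Hypothesis uP : forall t, Phi (u t) (p (expi 0, 0)) = p (expi (clamp 0 1 t), 0).

(** Pairs of an orthonormal basis of the plane of generators and its base point on the ray z = 1
    near the end s. The limit points of this set over [x0] play the part of limit planes. The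
    condition on [act_dom] keeps the whole orbit loop in the chart. *)
Definition end_limits (s rho1 : R) : set ('M[R]_(2, 2 + 2) * 'rV[R]_(2 + 2)) :=
  [set y | exists tau g, [/\ rho1 < s * tau < 1, y.2 = cmap c (p (expi 0, tau)),
    forall t, act_dom Phi c c (u t, y.2), y.1 *m y.1^T = 1%:M &
    g \in unitmx /\ y.1 = g *m gen y.2]].

(* The generators themselves may degenerate at the fixed point p0; orthonormal bases of
   their span stay in a compact set and have a limit point there. *)
Lemma closure_end_limits s rho1 : s = 1 \/ s = -1 -> rho <= rho1 < 1 ->
  exists Xl, closure (end_limits s rho1) (Xl, x0).
Proof.
move=> s1 /andP[rho1_ge rho1_lt]; apply: contrapT => nex.
have nS (Xl : 'M[R]_(2, 2 + 2)) : \forall y \near (Xl, x0), ~ end_limits s rho1 y.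
  apply: contrapT => h; apply: nex; exists Xl => B nB.
  apply: contrapT => h'; apply: h; apply: filterS nB => y By Sy; apply: h'.
  by exists y.
(* Without a limit point, [tube] over the cube of matrices excludes every orthonormal basis over all
   points close to [x0]; the basis built below at a point near the end contradicts this. *)
have /(near_comp (cmap_cvg cp0)) n1 : \forall x \near x0, forall Xm,
    [set Xm : 'M[R]_(2, 2 + 2) | forall i j, `|Xm i j| <= 1] Xm -> ~ end_limits s rho1 (Xm, x).
  apply: (tube (P := fun Xm x => ~ end_limits s rho1 (Xm, x)) (@compact_unit_matrices R 2 (2 + 2))).
  by move=> Xm _; apply: filterS (nS Xm) => -[].
have /(near_comp (cmap_cvg cp0)) n2 : \forall x \near x0, forall t, `[0, 1]%classic t -> act_dom Phi c c (u t, x).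
  apply: (tube (P := fun t x => act_dom Phi c c (u t, x)) (@segment_compact R 0 1)) => t _.
  have h : {for (t, x0), continuous (fun z : R * 'rV[R]_(2 + 2) => (u z.1, z.2))}.
    apply: (@cvg_pairl _ _ _ (nbhs (t, x0)) _ (fun z : R * 'rV[R]_(2 + 2) => u z.1) snd); last exact: cvg_snd.
    by apply: (@cvg_comp _ _ _ fst u (nbhs (t, x0)) (nbhs t)); [exact: cvg_fst|exact: uc].
  exact: (near_comp h (near_act_dom PhiS Xc (act_dom_fixed (u t)))).
have [rho2 /andP[rho20 rho21] hr] := ends_near htorus (filterI n1 n2).
pose m := Num.max rho1 rho2.
have [m1 m2 m3] : [/\ rho1 <= m, rho2 <= m & m < 1].
  by rewrite /m; split; rewrite ?le_max ?lexx ?orbT // gt_max rho1_lt rho21.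
pose tau := s * ((m + 1) / 2).
have stau : s * tau = (m + 1) / 2 by rewrite /tau; case: s1 => ->; ring.
have r0 : 0 < rho by case/andP: rho01.
have str : rho < s * tau < 1 by rewrite stau; apply/andP; split; lra.
have [tau1 tauabs taur] := end_range rho01 s1 str.
have := hr (expi 0) tau; rewrite tauabs stau => -[]; first by apply/andP; split; lra.
have oq : o (p (expi 0, tau)) by exists (expi 0, tau).
have gq := rho_good (expi 0) taur.
have [_ rf] := generators_in_lagrangian hw hPhi htorus horbit hregular Xc oq gq.1.
have [g gu gg] := orthonormalize rf.
move=> h1 h2; apply: (h1 (g *m gen (cmap c (p (expi 0, tau))))).
  exact: orthonormal_bounded gg.
exists tau, g; split=> //=; first by rewrite stau; apply/andP; split; lra.
by move=> t; rewrite ucl; apply: h2; rewrite /= in_itv /= clamp_itv.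
Qed.

Let F (t : R) (y : 'M[R]_(2, 2 + 2) * 'rV[R]_(2 + 2)) : 'M[R]_(2, 2 + 2) :=
  y.1 *m dact_in Phi c c (u t) y.2.

Lemma F_cvg (t : R) (Xl : 'M[R]_(2, 2 + 2)) : {for (t, (Xl, x0)), continuous (fun z : R * ('M[R]_(2, 2 + 2) * 'rV[R]_(2 + 2)) => F z.1 z.2)}.
Proof.
set b := (t, (Xl, x0)).
have h1 : (fun z : R * ('M[R]_(2, 2 + 2) * 'rV[R]_(2 + 2)) => z.2.1) @ nbhs b --> Xl.
  by apply: (@cvg_comp _ _ _ snd fst (nbhs b) (nbhs (Xl, x0))); [exact: cvg_snd|exact: cvg_fst].
have h2 : (fun z : R * ('M[R]_(2, 2 + 2) * 'rV[R]_(2 + 2)) => z.2.2) @ nbhs b --> x0.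
  by apply: (@cvg_comp _ _ _ snd snd (nbhs b) (nbhs (Xl, x0))); [exact: cvg_snd|exact: cvg_snd].
have h3 : (fun z : R * ('M[R]_(2, 2 + 2) * 'rV[R]_(2 + 2)) => u z.1) @ nbhs b --> u t.
  by apply: (@cvg_comp _ _ _ fst u (nbhs b) (nbhs t)); [exact: cvg_fst|exact: uc].
have h4 : (fun z : R * ('M[R]_(2, 2 + 2) * 'rV[R]_(2 + 2)) => (u z.1, z.2.2)) @ nbhs b --> (u t, x0).
  exact: cvg_pairl h3 h2.
have h5 : (fun z : 'rV[R]_2 * 'rV[R]_(2 + 2) => dact_in Phi c c z.1 z.2) @ nbhs (u t, x0) -->
    dact_in Phi c c (u t) x0.
  exact: (dact_in_cvg PhiS Xc Xc (act_dom_fixed (u t))).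
have h6 : (fun z : R * ('M[R]_(2, 2 + 2) * 'rV[R]_(2 + 2)) => dact_in Phi c c (u z.1) z.2.2) @ nbhs b -->
   dact_in Phi c c (u t) x0.
  apply: (cvg_comp_at (f := fun z : R * ('M[R]_(2, 2 + 2) * 'rV[R]_(2 + 2)) => (u z.1, z.2.2))
    (g := fun z : 'rV[R]_2 * 'rV[R]_(2 + 2) => dact_in Phi c c z.1 z.2) _ _ h4); first by [].
    by [].
  exact: h5.
exact: (@mulmx_cvg R _ (nbhs b) _ _ _ _ _ _ _ _ h1 h6).
Qed.

Lemma act_in_fixed_cvg (t : R) (Xl : 'M[R]_(2, 2 + 2)) : (fun z : R * ('M[R]_(2, 2 + 2) * 'rV[R]_(2 + 2)) =>
  act_in Phi c c (u z.1, z.2.2)) @ nbhs (t, (Xl, x0)) --> x0.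
Proof.
set b := (t, (Xl, x0)).
have h2 : (fun z : R * ('M[R]_(2, 2 + 2) * 'rV[R]_(2 + 2)) => z.2.2) @ nbhs b --> x0.
  by apply: (@cvg_comp _ _ _ snd snd (nbhs b) (nbhs (Xl, x0))); [exact: cvg_snd|exact: cvg_snd].
have h3 : (fun z : R * ('M[R]_(2, 2 + 2) * 'rV[R]_(2 + 2)) => u z.1) @ nbhs b --> u t.
  by apply: (@cvg_comp _ _ _ fst u (nbhs b) (nbhs t)); [exact: cvg_fst|exact: uc].
have h4 : (fun z : R * ('M[R]_(2, 2 + 2) * 'rV[R]_(2 + 2)) => (u z.1, z.2.2)) @ nbhs b --> (u t, x0).
  exact: cvg_pairl h3 h2.
have h5 : {for (u t, x0), continuous (act_in Phi c c)}.
  exact: differentiable_continuous (act_in_differentiable PhiS Xc Xc (act_dom_fixed (u t))).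
apply: (cvg_comp_at (f := fun z : R * ('M[R]_(2, 2 + 2) * 'rV[R]_(2 + 2)) => (u z.1, z.2.2))
    (g := act_in Phi c c) _ _ h4); first by [].
  exact: act_in_fixed.
exact: h5.
Qed.

(** The determinant of the transported basis, taken at the moved point. On [end_limits] it is a
    nonzero constant times [gdet] along the orbit loop; at a limit point it is the determinant of
    the limit loop. *)
Let K (t : R) (y : 'M[R]_(2, 2 + 2) * 'rV[R]_(2 + 2)) : C :=
  cdet (Jc (act_in Phi c c (u t, y.2))) Y (F t y).

Lemma K_cvg (t : R) (Xl : 'M[R]_(2, 2 + 2)) : {for (t, (Xl, x0)), continuous (fun z : R * ('M[R]_(2, 2 + 2) * 'rV[R]_(2 + 2)) => K z.1 z.2)}.
Proof.
rewrite /prop_for /continuous_at {2}/K /= act_in_fixed.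
apply: (@cdet_cvg R _ (nbhs (t, (Xl, x0))) _ _
  (fun z : R * ('M[R]_(2, 2 + 2) * 'rV[R]_(2 + 2)) => Jc (act_in Phi c c (u z.1, z.2.2))) (cst Y)
  (fun z : R * ('M[R]_(2, 2 + 2) * 'rV[R]_(2 + 2)) => F z.1 z.2)).
- exact: (@cvg_comp _ _ _ _ Jc _ _ _ (act_in_fixed_cvg t Xl) (endo_in_cvg hJ Xc cx0)).
- exact: cvg_cst.
- exact: F_cvg.
Qed.

Lemma end_limits_orbit s rho1 y (t : R) : s = 1 \/ s = -1 -> rho <= rho1 ->
  end_limits s rho1 y ->
  exists q g, [/\ o q, cdom c q, cdom c (Phi (u t) q), g \in unitmx /\ y.2 = cmap c q &
    F t y = g *m gen (act_in Phi c c (u t, y.2)) /\ act_in Phi c c (u t, y.2) = cmap c (Phi (u t) q)].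
Proof.
move=> s1 r1 [tau [g [/andP[st1 st2] e2 dom _ [gu e1]]]].
have str : rho < s * tau < 1 by rewrite st2 andbT; exact: le_lt_trans st1.
have [tau1 tauabs taur] := end_range rho01 s1 str.
have oq : o (p (expi 0, tau)) by exists (expi 0, tau).
have cq := (rho_good (expi 0) taur).1.
have e3 t' : act_in Phi c c (u t', y.2) = cmap c (Phi (u t') (p (expi 0, tau))).
  by rewrite /act_in e2 /= (cmapK cq).
have cq' : cdom c (Phi (u t) (p (expi 0, tau))) by have [_ ] := dom t; rewrite /= e2 (cmapK cq).
have e4 : F t y = g *m gen (act_in Phi c c (u t, y.2)).
  rewrite (generators_in_act Phi0 PhiD PhiS Xc Xc (dom t)) /F e1.
  exact: esym (mulmxA _ _ _).
exists (p (expi 0, tau)), g; split; [exact: oq|exact: cq|exact: cq'|split; [exact: gu|exact: e2]|].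
by split; [exact: e4|exact: e3].
Qed.

Let A t := dact_in Phi c c (u t) x0.

(** Orthonormality, isotropy of the transported planes and equality of the bases at times 0 and 1
    are closed conditions that hold on [end_limits]. Orthonormality of the limit in turn gives its
    rank. *)
Lemma end_limit_loop s rho1 Xl : s = 1 \/ s = -1 -> rho <= rho1 ->
  closure (end_limits s rho1) (Xl, x0) -> lagrangian_loop (wc x0) A Xl.
Proof.
move=> s1 r1 cl; set b := (Xl, x0).
have fcv : (fst : 'M[R]_(2, 2 + 2) * 'rV[R]_(2 + 2) -> _) @ nbhs b --> Xl by exact: cvg_fst.
have Ft t : (fun y => F t y) @ nbhs b --> F t b.
  have h : (fun y : 'M[R]_(2, 2 + 2) * 'rV[R]_(2 + 2) => (t, y)) @ nbhs b --> (t, b).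
    by apply: (@cvg_pairl _ _ _ (nbhs b) _ (cst t) id); [exact: cvg_cst|exact: cvg_id].
  exact: (@cvg_comp_at _ _ _ (nbhs b) (fun y => (t, y)) (fun z : R * ('M[R]_(2, 2 + 2) * 'rV[R]_(2 + 2)) => F z.1 z.2)
    (fun y => F t y) (t, b) (F t b) erefl erefl h (@F_cvg t Xl)).
have at_ t : (fun y : 'M[R]_(2, 2 + 2) * 'rV[R]_(2 + 2) => act_in Phi c c (u t, y.2)) @ nbhs b --> x0.
  have h : (fun y : 'M[R]_(2, 2 + 2) * 'rV[R]_(2 + 2) => (t, y)) @ nbhs b --> (t, b).
    by apply: (@cvg_pairl _ _ _ (nbhs b) _ (cst t) id); [exact: cvg_cst|exact: cvg_id].
  exact: (@cvg_comp _ _ _ (fun y => (t, y)) _ (nbhs b) _ _ h (act_in_fixed_cvg t Xl)).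
have XX : Xl *m Xl^T = 1%:M.
  apply/eqP; rewrite -subr_eq0; apply/eqP.
  apply: (closure_zero (f := fun y : 'M[R]_(2, 2 + 2) * 'rV[R]_(2 + 2) => y.1 *m y.1^T - 1%:M) cl).
    apply: cvgB; last exact: cvg_cst.
    by apply: (@mulmx_cvg R _ (nbhs b) _ _ _ _ fst (fun y => y.1^T)); [exact: fcv|exact: trmx_cvg].
  by move=> y [tau [g [_ _ _ -> _]]]; rewrite subrr.
have Xfree : row_free Xl.
  apply/eqP/anti_leq; rewrite rank_leq_row /= -[X in (X <= _)%N](mxrank1 R 2) -XX.
  exact: mxrankM_maxl.
split.
  move=> t; split.
    have -> : Xl *m A t *m wc x0 *m (Xl *m A t)^T =
      F t b *m wc (act_in Phi c c (u t, b.2)) *m (F t b)^T by rewrite act_in_fixed.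
    apply: (closure_zero (f := fun y => F t y *m wc (act_in Phi c c (u t, y.2)) *m (F t y)^T) cl).
      have h1 : (fun y : 'M[R]_(2, 2 + 2) * 'rV[R]_(2 + 2) => wc (act_in Phi c c (u t, y.2))) @ nbhs b -->
          wc (act_in Phi c c (u t, b.2)).
        rewrite act_in_fixed.
        exact: (@cvg_comp _ _ _ _ wc (nbhs b) _ _ (at_ t) (form_in_cvg hw Xc cx0)).
      have h2 : (fun y => (F t y)^T) @ nbhs b --> (F t b)^T by exact: (trmx_cvg (Ft t)).
      apply: (@mulmx_cvg R _ (nbhs b) _ _ _ _ (fun y => F t y *m wc (act_in Phi c c (u t, y.2))) (fun y => (F t y)^T)).
        exact: (@mulmx_cvg R _ (nbhs b) _ _ _ _ (fun y => F t y) (fun y => wc (act_in Phi c c (u t, y.2))) _ _ (Ft t) h1).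
      exact: h2.
    move=> y Sy; have [q [g [oq cq cq' [gu e2] [e3 e4]]]] := end_limits_orbit t s1 r1 Sy.
    have oq' := orbit_closed hPhi horbit (u t) oq.
    have [L _] := generators_in_lagrangian hw hPhi htorus horbit hregular Xc oq' cq'.
    rewrite e3 e4 trmx_mul; move: L; set G := gen _; set W := wc _ => L.
    have -> : g *m G *m W *m (G^T *m g^T) = g *m (G *m W *m G^T) *m g^T by rewrite !mulmxA.
    by rewrite L mulmx0 mul0mx.
  by rewrite /row_free mxrankMfree // row_free_unit; exact: (dact_in_unit Phi0 PhiD PhiS Xc Xc (act_dom_fixed (u t))).
have fix1 q : o q -> Phi (u 1) q = q.
  have o0 : o (p (expi 0, 0)) by exists (expi 0, 0) => //=; rewrite /open_cylinder /=; apply/andP; split; lra.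
  move=> oq; have [v <-] := orbit_trans hPhi horbit o0 oq.
  rewrite -PhiD addrC PhiD uP clamp_id ?lexx ?ler01 //.
  by have := expi_shift (0 : R) 1; rewrite add0r => ->.
apply/eqP; rewrite -subr_eq0; apply/eqP.
have -> : Xl *m A 0 - Xl *m A 1 = F 0 b - F 1 b by [].
apply: (closure_zero (f := fun y => F 0 y - F 1 y) cl).
  exact: (@cvgB _ _ _ (nbhs b) _ _ _ _ _ (Ft 0) (Ft 1)).
move=> y [tau [g [/andP[st1 st2] e2 dom _ [gu e1]]]].
have str : rho < s * tau < 1 by rewrite st2 andbT; exact: le_lt_trans st1.
have [tau1 tauabs taur] := end_range rho01 s1 str.
have oq : o (p (expi 0, tau)) by exists (expi 0, tau).
have cq := (rho_good (expi 0) taur).1.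
have e3 t : act_in Phi c c (u t, y.2) = cmap c (Phi (u t) (p (expi 0, tau))).
  by rewrite /act_in e2 /= (cmapK cq).
have E t : F t y = g *m gen (cmap c (Phi (u t) (p (expi 0, tau)))).
  rewrite -e3 (generators_in_act Phi0 PhiD PhiS Xc Xc (dom t)) /F e1.
  exact: esym (mulmxA _ _ _).
by rewrite !E u0 Phi0 fix1 // subrr.
Qed.

(** By [gdet_act], K t y is det g times [gdet] at Phi^{u(t)}(q), with g independent of t. *)
Lemma end_limits_winding s rho1 y : s = 1 \/ s = -1 -> rho <= rho1 ->
  (forall tau d, rho1 < s * tau < 1 -> winding (fun t => gdet (p (expi t, tau))) d ->
    winding (fun t => gdet (Phi (u t) (p (expi 0, tau)))) d) ->
  end_limits s rho1 y ->
  K 0 y = K 1 y /\ exists tau d, [/\ rho < s * tau < 1,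
    winding (fun t => gdet (p (expi t, tau))) d & winding (fun t => K t y) d].
Proof.
move=> s1 r1 hwind [tau [g [st e2 dom _ [gu e1]]]].
have [st1 st2] : rho1 < s * tau /\ s * tau < 1 by case/andP: st.
have str : rho < s * tau < 1 by rewrite st2 andbT; exact: le_lt_trans st1.
have [tau1 tauabs taur] := end_range rho01 s1 str.
set q := p (expi 0, tau).
have oq : o q by exists (expi 0, tau).
have gq : good X J c Y q := rho_good (expi 0) taur.
have cq := gq.1.
have fix1 : Phi (u 1) q = q.
  have o0 : o (p (expi 0, 0)) by exists (expi 0, 0) => //=; rewrite /open_cylinder /=; apply/andP; split; lra.
  have [v <-] := orbit_trans hPhi horbit o0 oq.
  rewrite -PhiD addrC PhiD uP clamp_id ?lexx ?ler01 //.
  by have := expi_shift (0 : R) 1; rewrite add0r => ->.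
have pE : (fun t => p (expi t, tau)) = unroll_clamp p \o (fun t => (t, tau)).
  apply/funext => t; have /andP[k1 k2] := tau1.
  by rewrite /unroll_clamp /= clamp_id //; apply/andP; split; lra.
have gc : continuous (fun t => gdet (p (expi t, tau)) : C).
  move=> t; have pc : {for t, continuous (fun t => p (expi t, tau))}.
    rewrite pE; apply: continuous_comp; last exact: (unroll_clamp_continuous htorus).
    exact: pairl_continuous.
  exact: (@continuous_comp _ _ _ (fun t => p (expi t, tau)) gdet t pc
    (gdet_continuous hJ hPhi Xc (rho_good _ taur))).
have gn0 t : gdet (p (expi t, tau)) != 0.
  apply: (gdet_neq0 hw hJ hcompat hPhi htorus horbit hregular Xc _ (rho_good _ taur)).
  by exists (expi t, tau).
have [d wd] := winding_exists gc gn0.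
have wd' := hwind _ _ st wd.
have dq t : act_dom Phi c c (u t, cmap c q) by rewrite -e2; exact: dom.
have KE t : K t y = (\det g)%:C * gdet (Phi (u t) q).
  have eF : F t y = g *m (gen (cmap c q) *m dact_in Phi c c (u t) (cmap c q)).
    by rewrite /F e1 e2; exact: esym (mulmxA _ _ _).
  by rewrite (gdet_act J hPhi Xc Y (dq t) cq) /K eF e2; exact: cdet_real.
have g0 : (\det g)%:C != 0 :> C.
  have d0 : \det g != 0 by rewrite -unitfE -unitmxE.
  by apply: contraNneq d0 => /(congr1 (@complex.Re R)) /= ->.
split; first by rewrite !KE fix1 u0 Phi0.
exists tau, d; split; [exact: str|exact: wd|].
have -> : (fun t => K t y) = (fun t => (\det g)%:C * gdet (Phi (u t) q)).
  by apply/funext => t; exact: KE.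
exact: windingZ g0 wd'.
Qed.

(** For a member y of [end_limits] close to the limit b, the quotient of K t y by K t b has positive
    real part uniformly in t. Hence no segment between the two loops meets 0, and the limit loop has
    the winding number of an actual circle near the end. *)
Lemma end_limit_winding s rho1 Xl e : s = 1 \/ s = -1 -> rho <= rho1 ->
  (forall tau d, rho1 < s * tau < 1 -> winding (fun t => gdet (p (expi t, tau))) d ->
    winding (fun t => gdet (Phi (u t) (p (expi 0, tau)))) d) ->
  closure (end_limits s rho1) (Xl, x0) ->
  winding (fun t => cdet (Jc x0) Y (Xl *m A t) : C) e ->
  exists2 tau, rho < s * tau < 1 & winding (fun t => gdet (p (expi t, tau))) e.
Proof.
have re_pos (z : C) (x : R) : 0 < complex.Re z -> 0 <= x -> z + x%:C != 0.
  case: z => a1 a2 /= h h'; apply/eqP => /(congr1 (@complex.Re R)) /=; lra.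
move=> s1 r1 hwind cl we; set b := (Xl, x0).
have [lag loop] := end_limit_loop s1 r1 cl.
have Kb t : K t b = cdet (Jc x0) Y (Xl *m A t) by rewrite /K /= act_in_fixed.
have Y0 : forall a : 'rV[R]_(2 + 2), a *m Y = 0 -> a *m Jc x0 *m Y = 0 -> a = 0.
  exact/reference_mxP/gp0.2.
have K0 t : K t b != 0.
  by rewrite Kb; apply: (lagrangian_cdet (chart_compatible hw hJ hcompat Xc cx0) Y0); exact: lag.
pose Q t (y : 'M[R]_(2, 2 + 2) * 'rV[R]_(2 + 2)) := 0 < complex.Re (K t y / K t b).
have : \forall y \near b, forall t, `[0, 1]%classic t -> Q t y.
  apply: (tube (P := Q) (@segment_compact R 0 1)) => t _.
  have h1 : (fun z : R * ('M[R]_(2, 2 + 2) * 'rV[R]_(2 + 2)) => K z.1 b) @ nbhs (t, b) --> K t b.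
    have h : (fun z : R * ('M[R]_(2, 2 + 2) * 'rV[R]_(2 + 2)) => (z.1, b)) @ nbhs (t, b) --> (t, b).
      by apply: (@cvg_pairl _ _ _ (nbhs (t, b)) _ fst (cst b)); [exact: cvg_fst|exact: cvg_cst].
    exact: (@cvg_comp_at _ _ _ (nbhs (t, b)) (fun z : R * ('M[R]_(2, 2 + 2) * 'rV[R]_(2 + 2)) => (z.1, b))
      (fun z : R * ('M[R]_(2, 2 + 2) * 'rV[R]_(2 + 2)) => K z.1 z.2)
      (fun z : R * ('M[R]_(2, 2 + 2) * 'rV[R]_(2 + 2)) => K z.1 b) (t, b) (K t b) erefl erefl h (@K_cvg t Xl)).
  have h2 : (fun z : R * ('M[R]_(2, 2 + 2) * 'rV[R]_(2 + 2)) => K z.1 z.2 / K z.1 b : C) @ nbhs (t, b) -->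
      (K t b / K t b : C).
    by apply: cvgM; [exact: K_cvg|apply: cvgV; [exact: K0|exact: h1]].
  have h3 : complex.Re (K t b / K t b) = 1 by rewrite (divff (K0 t)).
  have h4 : (fun z : R * ('M[R]_(2, 2 + 2) * 'rV[R]_(2 + 2)) => complex.Re (K z.1 z.2 / K z.1 b)) @ nbhs (t, b) --> (1 : R).
    by rewrite -h3; exact: (re_cvg h2).
  exact: (cvgr_gt _ h4 _ ltr01).
have wKb : winding (fun t => K t b) e.
  by have -> : (fun t => K t b) = (fun t => cdet (Jc x0) Y (Xl *m A t) : C) by apply/funext => t; exact: Kb.
have loopb : K 0 b = K 1 b := etrans (Kb 0) (etrans (congr1 (fun Z => cdet (Jc x0) Y Z) loop) (esym (Kb 1))).
move=> /cl[y [/(end_limits_winding s1 r1 hwind)[loopy [tau [d [str wd wK]]]] Qy]].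
exists tau; first exact: str.
suff ed : e = d by rewrite ed; exact: wd.
apply: (@winding_segment R (fun t => K t b) (fun t => K t y) e d loopb loopy (K0 0) (fun t _ => K0 t) _ wKb wK).
move=> t x t01 xpos.
have -> : K t y + x%:C * K t b = (K t y / K t b + x%:C) * K t b by rewrite mulrDl (divfK (K0 t)).
apply: mulf_neq0; last exact: K0.
exact: (re_pos _ _ (Qy t t01) xpos).
Qed.

End limit_loops.

(** * One winding number for both ends *)

Section winding_at_ends.
Context {R : realType} {M : topologicalType} (X : @manifold R M (2 + 2)).
Variables (w J : M -> 'M[R]_(2 + 2)) (Phi : 'rV[R]_2 -> M -> M).
Variables (p : S1 R * R -> M) (p0 : M).
Hypotheses (hw : symplectic X w) (hJ : almost_complex X J) (hcompat : compatible w J).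
Hypothesis hPhi : hamiltonian_action X w Phi.
Hypothesis htorus : lagrangian_pinched_torus X w p p0.
Hypothesis hfixed : forall u, Phi u p0 = p0.
Hypothesis horbit : exists2 q, (p @` open_cylinder (R := R)) q &
  p @` open_cylinder (R := R) = range (fun u => Phi u q).
Hypothesis hregular : forall q, (p @` open_cylinder (R := R)) q ->
  \rank (generators X Phi q) = 2%N.
Local Notation C := (R[i]^o).

Lemma gdet_winding_end c Y rho s tau tau' d : atlas X c -> 0 < rho < 1 ->
  (forall z r, rho <= `|r| <= 1 -> good X J c Y (p (z, r))) ->
  s = 1 \/ s = -1 -> rho < s * tau < 1 -> rho < s * tau' < 1 ->
  winding (fun t => gdet X J Phi c Y (p (expi t, tau))) d ->
  winding (fun t => gdet X J Phi c Y (p (expi t, tau'))) d.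
Proof.
move=> Xc rho01 rho_good s1 rt rt' wd.
have [tau1 _ taur] := end_range rho01 s1 rt'.
have pE : (fun t => p (expi t, tau')) = unroll_clamp p \o (fun t => (t, tau')).
  apply/funext => t; have /andP[k1 k2] := tau1.
  by rewrite /unroll_clamp /= clamp_id //; apply/andP; split; lra.
have gc : continuous (fun t => gdet X J Phi c Y (p (expi t, tau')) : C).
  move=> t; have pc : {for t, continuous (fun t => p (expi t, tau'))}.
    rewrite pE; apply: continuous_comp; last exact: (unroll_clamp_continuous htorus).
    exact: pairl_continuous.
  exact: (@continuous_comp _ _ _ (fun t => p (expi t, tau')) (gdet X J Phi c Y) t pc
    (gdet_continuous hJ hPhi Xc (rho_good _ _ taur))).
have gn0 t : gdet X J Phi c Y (p (expi t, tau')) != 0.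
  apply: (gdet_neq0 hw hJ hcompat hPhi htorus horbit hregular Xc _ (rho_good _ _ taur)).
  by exists (expi t, tau').
have [d' wd'] := winding_exists gc gn0.
suff -> : d = d' by exact: wd'.
have ic : continuous (id : R -> R) by move=> t; exact: cvg_id.
have cc x : continuous (cst x : R -> R) by move=> t; exact: cvg_cst.
have e1 : (id 1 : R) = id 0 + 1%:~R by rewrite add0r.
exact: (gdet_winding_homotopy hw hJ hcompat hPhi htorus horbit hregular Xc rho01 rho_good s1
  ic ic (cc tau) (cc tau') (fun=> rt) (fun=> rt') e1 e1 erefl erefl wd wd').
Qed.

Lemma gdet_winding_ends c Y rho : atlas X c -> 0 < rho < 1 ->
  (forall z r, rho <= `|r| <= 1 -> good X J c Y (p (z, r))) ->
  exists d, forall r, rho < `|r| < 1 ->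
    winding (fun t => gdet X J Phi c Y (p (expi t, r))) d.
Proof.
move=> Xc rho01 rho_good.
have [u [uc u0 ucl uP]] := core_circle_path hw hPhi htorus horbit hregular.
have [rho1 /andP[r1 r1'] hwind] := orbit_loop_winding hw hJ hcompat hPhi htorus hfixed horbit hregular
  Xc rho01 rho_good uc u0 ucl uP.
have r11 : rho <= rho1 < 1 by rewrite r1.
have s1 : (1 : R) = 1 \/ (1 : R) = -1 by left.
have s2 : (-1 : R) = 1 \/ (-1 : R) = -1 by right.
have [X1 cl1] := closure_end_limits hw hPhi htorus hfixed horbit hregular Xc rho01 rho_good uc ucl s1 r11.
have [X2 cl2] := closure_end_limits hw hPhi htorus hfixed horbit hregular Xc rho01 rho_good uc ucl s2 r11.
have L1 := end_limit_loop hw hPhi htorus hfixed horbit hregular Xc rho01 rho_good uc u0 uP s1 r1 cl1.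
have L2 := end_limit_loop hw hPhi htorus hfixed horbit hregular Xc rho01 rho_good uc u0 uP s2 r1 cl2.
have gp0 := good_pinch_point htorus rho01 rho_good.
have cx0 := cmapP gp0.1.
pose A t := dact_in Phi c c (u t) (cmap c p0).
have dom0 t : act_dom Phi c c (u t, cmap c p0) := act_dom_fixed htorus hfixed rho01 rho_good (u t).
have Ac : continuous A.
  move=> t; have h5 : (fun z : 'rV[R]_2 * 'rV[R]_(2 + 2) => dact_in Phi c c z.1 z.2) @ nbhs (u t, cmap c p0) -->
      dact_in Phi c c (u t) (cmap c p0).
    exact: (dact_in_cvg (action_smooth hPhi) Xc Xc (dom0 t)).
  have h4 : (fun t => (u t, cmap c p0)) @ nbhs t --> (u t, cmap c p0).
    by apply: (@cvg_pairl _ _ _ (nbhs t) _ u (cst (cmap c p0))); [exact: uc|exact: cvg_cst].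
  exact: (@cvg_comp _ _ _ (fun t => (u t, cmap c p0))
    (fun z : 'rV[R]_2 * 'rV[R]_(2 + 2) => dact_in Phi c c z.1 z.2) (nbhs t) _ _ h4 h5).
have Au t : A t \in unitmx.
  exact: (dact_in_unit (action0 hPhi) (actionD hPhi) (action_smooth hPhi) Xc Xc (dom0 t)).
have Y0 : forall a : 'rV[R]_(2 + 2), a *m Y = 0 -> a *m endo_in X J c (cmap c p0) *m Y = 0 -> a = 0.
  exact/reference_mxP/gp0.2.
have cp := chart_compatible hw hJ hcompat Xc cx0.
have wind_exists X' : lagrangian_loop (form_in X w c (cmap c p0)) A X' ->
    exists e, winding (fun t => cdet (endo_in X J c (cmap c p0)) Y (X' *m A t) : C) e.
  move=> [lag _]; apply: winding_exists; last by move=> t; exact: (lagrangian_cdet cp Y0 (lag t)).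
  move=> t; apply: (@cdet_cvg R _ (nbhs t) _ _ (cst (endo_in X J c (cmap c p0))) (cst Y) (fun t => X' *m A t)).
  - exact: cvg_cst.
  - exact: cvg_cst.
  - by apply: (@mulmx_cvg R _ (nbhs t) _ _ _ _ (cst X') A); [exact: cvg_cst|exact: Ac].
have [e1 we1] := wind_exists _ L1; have [e2 we2] := wind_exists _ L2.
have e12 := winding_lagrangian_loops cp Y0 Ac Au L1 L2 we1 we2.
have [tau1 t1 w1] := end_limit_winding hw hJ hcompat hPhi htorus hfixed horbit hregular Xc rho01 rho_good
  uc u0 uP s1 r1 (fun tau d => hwind 1 tau d s1) cl1 we1.
have [tau2 t2 w2] := end_limit_winding hw hJ hcompat hPhi htorus hfixed horbit hregular Xc rho01 rho_good
  uc u0 uP s2 r1 (fun tau d => hwind (-1) tau d s2) cl2 we2.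
exists e1 => r rr; case: (lerP 0 r) => r0.
  apply: (gdet_winding_end Xc rho01 rho_good s1 t1 _ w1).
  by rewrite mul1r; rewrite ger0_norm in rr.
rewrite e12; apply: (gdet_winding_end Xc rho01 rho_good s2 t2 _ w2).
by rewrite mulN1r; rewrite ltr0_norm in rr.
Qed.

End winding_at_ends.

(** * Phases and rotation of the first basis vector *)

Section rotations.
Context {R : realType}.
Local Notation C := (R[i]^o).

Lemma val_normalizeM (x y : C) : x != 0 -> y != 0 ->
  val (normalize (x * y)) = val (normalize x) * val (normalize y) :> R[i].
Proof.
move=> x0 y0; rewrite !val_normalize ?mulf_neq0 //.
by rewrite normrM invfM mulrACA.
Qed.

Lemma normalizeZ (k : R) (x : C) : 0 < k -> x != 0 -> normalize (k%:C * x) = normalize x.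
Proof.
move=> k0 x0; have kC : 0 < k%:C :> R[i] by rewrite ltcR.
have kn0 : k%:C != 0 :> C by rewrite gt_eqF.
apply: val_inj; rewrite (val_normalizeM kn0 x0) (val_normalize kn0) gtr0_norm //.
by rewrite divff // mul1r.
Qed.

Lemma norm_detC (D : 'M[R]_(2 + 2)) : Ugroup D -> `|detC D| = 1.
Proof.
move=> [_ /unitarymxP U]; have := congr1 determinant U.
rewrite det_mulmx det1 det_map_mx det_tr -normCK => /eqP.
by rewrite sqrp_eq1 // => /eqP.
Qed.

Definition rotation_re (z : C) : 'M[R]_2 :=
  \matrix_(i, j) (if i == j then if i == 0 then complex.Re z else 1 else 0).
Definition rotation_im (z : C) : 'M[R]_2 :=
  \matrix_(i, j) (if (i == 0) && (j == 0) then complex.Im z else 0).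
(** The complex matrix diag (z, 1) acting on the rows, with i acting as - J: only the first vector
    is multiplied, and [cdet] gets the factor z. *)
Definition rotate m (J : 'M[R]_m) (z : C) (T : 'M[R]_(2, m)) : 'M[R]_(2, m) :=
  rotation_re z *m T - rotation_im z *m (T *m J).

Lemma cdet_rotate m (J : 'M[R]_m) Y (z : C) T : J *m J = - 1%:M ->
  cdet J Y (rotate J z T) = z * cdet J Y T.
Proof.
move=> JJ; rewrite /rotate (cdet_mul Y _ _ _ JJ); congr (_ * _).
rewrite det_mx2 !cplx_mx_coef !mxE /=; case: z => a b /=.
by apply/eqP; rewrite eq_complex /= !(mul0r, mulr0, mulr1, subr0, addr0, add0r) !eqxx.
Qed.

Lemma rotate1 m (J : 'M[R]_m) T : rotate J 1 T = T.
Proof.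
have e1 : rotation_re 1 = 1%:M.
  by apply/matrixP => i j; rewrite !mxE /=; case: (i == j) => //; case: ifP.
have e2 : rotation_im 1 = 0.
  by apply/matrixP => i j; rewrite !mxE /=; case: ifP.
by rewrite /rotate e1 e2 mul1mx mul0mx subr0.
Qed.

End rotations.

(** * Coordinates on the Maslov bundle *)

Section maslov_bundle_coordinates.
Context {R : realType} {M : topologicalType} (X : @manifold R M (2 + 2)).
Variables (w J : M -> 'M[R]_(2 + 2)).
Hypotheses (hw : symplectic X w) (hJ : almost_complex X J) (hcompat : compatible w J).
Local Notation C := (R[i]^o).
Local Notation Fr := (Fr X w J).
Local Notation Gam := (Gam X w J).

Lemma pointwise_compatible q : compatible_mx (w q) (J q).
Proof.
have [h1 h2] := hcompat q.
by split; [exact: symplectic_alt hw q|exact: almost_complex_sqr hJ q|exact: h1|exact: h2].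
Qed.

Definition frame_upper (f : Fr) : 'M[R]_(2, 2 + 2) := usubmx (frame_mx f).

Lemma frame_upperP (f : Fr) :
  orthonormal_lagrangian (w (frame_base f)) (J (frame_base f)) (frame_upper f) /\
  frame_mx f = frame_of (J (frame_base f)) (frame_upper f).
Proof.
have [_ hv h1 h2] : unitary_frames w J (val f) := set_valP f.
split; last by rewrite /frame_of /frame_upper /frame_base -hv vsubmxK.
apply/(orthonormal_lagrangianP (pointwise_compatible _)); split; first exact: h1.
by rewrite /frame_upper /frame_base /frame_mx -hv.
Qed.

Lemma frame_of_unitary q u : orthonormal_lagrangian (w q) (J q) u ->
  @unitary_frames R M 2 X w J (q, frame_of (J q) u).
Proof.
move=> ou; have [h1 h2] := (orthonormal_lagrangianP (pointwise_compatible q) u).1 ou.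
split; rewrite /= /frame_of ?col_mxKu ?col_mxKd //.
exact: (frame_of_unit (pointwise_compatible q) ou).
Qed.

Definition unitary_frame q u (h : orthonormal_lagrangian (w q) (J q) u) : Fr :=
  to_set_type (frame_of_unitary h).

Lemma frame_upper_unitary q u (h : orthonormal_lagrangian (w q) (J q) u) :
  frame_upper (unitary_frame h) = u.
Proof. exact: col_mxKu. Qed.

Lemma frame_transition (f f' : Fr) : frame_base f' = frame_base f ->
  exists2 D : 'M[R]_(2 + 2), Ugroup D & frame_act f D f'.
Proof.
move=> bE; have [h1 e1] := frame_upperP f; have [h2 e2] := frame_upperP f'.
move: h2 e2; rewrite bE => h2 e2.
have [D [UD eD _]] := orthonormal_transition (pointwise_compatible _) h1 h2.
by exists D => //; split => //; rewrite e1 e2.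
Qed.

Lemma Gam_classP (f f' : Fr) :
  Gam_class f = Gam_class f' <-> exists2 D, EUgroup D & frame_act f D f'.
Proof.
rewrite /Gam_class; split.
  by move=> /eqmodP/asboolP.
by move=> h; apply/eqmodP/asboolP.
Qed.

Lemma Gam_reprK (g : Gam) : Gam_class (Gam_repr g) = g.
Proof. exact: reprK. Qed.

Lemma Gam_base_class (f : Fr) : Gam_base (Gam_class f) = frame_base f.
Proof.
have /Gam_classP[D _ [e _]] := Gam_reprK (Gam_class f).
by rewrite /Gam_base e.
Qed.

Variables (c : @chart R M (2 + 2)) (Xc : atlas X c) (Y : 'M[R]_(2 + 2, 2)).
Local Notation Jc := (endo_in X J c).
Local Notation wc := (form_in X w c).
Local Notation tc q := (tchange X c (cmap c q)).
Local Notation good := (good X J c Y).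

Definition fdet (f : mframes X) : C :=
  cdet (Jc (cmap c f.1)) Y (usubmx f.2 *m invmx (tc f.1)).

(** The chart-fixed Y transported to the preferred coordinates of T_qM, where [w q] and [J q]
    live. *)
Definition chart_reference q : 'M[R]_(2 + 2, 2) := invmx (tc q) *m Y.

Lemma cdet_chart q u : cdom c q ->
  cdet (Jc (cmap c q)) Y (u *m invmx (tc q)) = cdet (J q) (chart_reference q) u.
Proof.
move=> cq; rewrite /chart_reference /endo_in (cmapK cq).
move: (tchange_unit Xc (cmapP cq)); move: (tc q) => T Tu.
rewrite /cdet; have -> : u *m invmx T *m Y = u *m (invmx T *m Y) by rewrite mulmxA.
have -> : u *m invmx T *m (T *m J q *m invmx T) *m Y = u *m J q *m (invmx T *m Y).
  by rewrite !mulmxA mulmxKV.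
by [].
Qed.

Lemma chart_reference_good q : good q -> forall a : 'rV[R]_(2 + 2),
  a *m chart_reference q = 0 -> a *m J q *m chart_reference q = 0 -> a = 0.
Proof.
move=> [cq /reference_mxP ref] a; have Tu := tchange_unit Xc (cmapP cq).
move: ref Tu; rewrite /chart_reference /endo_in (cmapK cq); move: (tc q) => T ref Tu h1 h2.
have h : a *m invmx T = 0.
  apply: ref; first by rewrite -mulmxA h1.
  by rewrite !mulmxA mulmxKV // -mulmxA h2.
by rewrite -(mulmxKV Tu a) h mul0mx.
Qed.

Lemma gdet_generators Phi q : (forall q, Phi 0 q = q) ->
  (forall c, atlas X c -> smooth_into X (setT `*` cimg c)
      (fun ux : 'rV[R]_2 * 'rV[R]_(2 + 2) => Phi ux.1 (cinv c ux.2))) ->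
  cdom c q -> gdet X J Phi c Y q = cdet (J q) (chart_reference q) (generators X Phi q).
Proof.
move=> P0 PS cq; rewrite -cdet_chart // (generators_chart P0 PS Xc cq).
have Tu := tchange_unit Xc (cmapP cq); move: Tu; rewrite /gdet.
by move: (tc q) => T Tu; rewrite mulmxK.
Qed.

Lemma fdetE (f : Fr) : cdom c (frame_base f) ->
  fdet (val f) = cdet (J (frame_base f)) (chart_reference (frame_base f)) (frame_upper f).
Proof. by move=> cq; rewrite -cdet_chart. Qed.

Lemma fdet_neq0 (f : Fr) : good (frame_base f) -> fdet (val f) != 0.
Proof.
move=> gq; rewrite fdetE; last exact: gq.1.
apply: (cdet_frame_neq0 (pointwise_compatible _) (chart_reference_good gq)).
exact: (frame_upperP f).1.
Qed.

Lemma fdet_act (f f' : Fr) D : cdom c (frame_base f) -> Ugroup D -> frame_act f D f' ->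
  fdet (val f') = detC D * fdet (val f).
Proof.
move=> cf UD [bE mE]; rewrite !fdetE ?bE //.
apply: (cdet_transition (pointwise_compatible (frame_base f)) _ UD).
have [_ e1] := frame_upperP f; have [_ e2] := frame_upperP f'.
by rewrite -e1 -mE e2 bE.
Qed.

(** The fibre coordinate of Gamma_J^2 over good points. It is computed on a representative; the
    square removes the sign left open by EU(2) ([nu_class]). *)
Definition nu (g : Gam) : S1 R := normalize (fdet (val (Gam_repr g)) ^+ 2).

Lemma val_nu_act (f f' : Fr) D : good (frame_base f) -> Ugroup D -> frame_act f D f' ->
  val (normalize (fdet (val f') ^+ 2)) = detC D ^+ 2 * val (normalize (fdet (val f) ^+ 2)) :> R[i].
Proof.
move=> gf UD fD; rewrite (fdet_act gf.1 UD fD) exprMn.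
have n1 : `|detC D ^+ 2| = 1 by rewrite normrX norm_detC // expr1n.
have n0 : detC D ^+ 2 != 0 by rewrite -normr_eq0 n1 oner_eq0.
have f0 : fdet (val f) ^+ 2 != 0 by rewrite expf_neq0 // fdet_neq0.
by rewrite (val_normalizeM n0 f0) (normalizeE n1).
Qed.

Lemma nu_class (f : Fr) : good (frame_base f) -> nu (Gam_class f) = normalize (fdet (val f) ^+ 2).
Proof.
move=> gf; have /esym/Gam_classP[D [UD eD] fD] := Gam_reprK (Gam_class f).
have D1 : detC D ^+ 2 = 1 by case: eD => ->; rewrite ?sqrrN expr1n.
by apply: val_inj; apply: etrans (val_nu_act gf UD fD) _; rewrite D1 mul1r.
Qed.

(** A frame change by D multiplies [fdet] by detC D, so in the coordinates (base, [nu]) the circle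
    action is multiplication in the second one. *)
Lemma Gam_actP (g g' : Gam) z : good (Gam_base g) ->
  Gam_act g z g' <-> Gam_base g' = Gam_base g /\ val (nu g') = val (nu g) * val z :> R[i].
Proof.
move=> gg; split=> [[f [f' [D [gE gE' UD dz fD]]]]|[bE nE]].
  move: gg; rewrite gE gE' !Gam_base_class => gf; have bE : frame_base f' = frame_base f := fD.1.
  have gf' : good (frame_base f') by rewrite bE.
  split; first exact: bE.
  by rewrite (nu_class gf) (nu_class gf') -dz mulrC; exact: val_nu_act.
have [D UD fD] := frame_transition (f := Gam_repr g) (f' := Gam_repr g') bE.
exists (Gam_repr g), (Gam_repr g'), D; split; rewrite ?Gam_reprK //.
have h : val (nu g') = detC D ^+ 2 * val (nu g) :> R[i] := val_nu_act gg UD fD.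
have e : detC D ^+ 2 * val (nu g) = val z * val (nu g) :> R[i] := etrans (esym h) (etrans nE (mulrC _ _)).
exact: (mulIf (S1_neq0 (nu g)) e).
Qed.

(** Equal coordinates force the squared complex determinant of the transition matrix to be 1, which
    is membership in EU(2). *)
Lemma nu_injective (g g' : Gam) : good (Gam_base g) -> Gam_base g' = Gam_base g ->
  nu g' = nu g -> g = g'.
Proof.
move=> gg bE nE; rewrite -(Gam_reprK g) -(Gam_reprK g'); apply/Gam_classP.
have [D UD fD] := frame_transition (f := Gam_repr g) (f' := Gam_repr g') bE.
exists D; last by [].
have h : val (nu g') = detC D ^+ 2 * val (nu g) :> R[i] := val_nu_act gg UD fD.
have /eqP : detC D ^+ 2 = 1 by apply: (mulIf (S1_neq0 (nu g))); rewrite -h nE mul1r.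
by rewrite sqrf_eq1 => /orP[]/eqP d1; (split; first exact: UD); [left|right]; exact: d1.
Qed.

Lemma gram_schmidt_class q T : good q -> cdet (J q) (chart_reference q) T != 0 ->
  exists f : Fr, [/\ frame_base f = q, frame_upper f = gram_schmidt (w q) (J q) T &
    nu (Gam_class f) = normalize (cdet (J q) (chart_reference q) T ^+ 2)].
Proof.
move=> gq d0; have wJ := pointwise_compatible q.
have [n0 n1] := gs_nondeg wJ d0.
have [k k0 kE] := gram_schmidt_cdet wJ d0.
exists (unitary_frame (gram_schmidt_unitary wJ n0 n1)); split=> //.
  exact: frame_upper_unitary.
rewrite nu_class // fdetE; last exact: gq.1.
rewrite frame_upper_unitary; have -> : frame_base (unitary_frame (gram_schmidt_unitary wJ n0 n1)) = q by [].
rewrite kE exprMn -rmorphXn /=; apply: normalizeZ; first exact: exprn_gt0.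
by rewrite expf_neq0.
Qed.

Lemma Gam_exists q (z : S1 R) : good q -> exists g : Gam, Gam_base g = q /\ nu g = z.
Proof.
move=> gq; have wJ := pointwise_compatible q; have [u ou] := orthonormal_lagrangian_exists wJ.
have d0 := cdet_frame_neq0 wJ (chart_reference_good gq) ou.
set d := cdet _ _ _ in d0.
have n1 : `|val z / val (normalize (d ^+ 2))| = 1 :> R[i] by rewrite normf_div !S1_norm divr1.
have n0 : val z / val (normalize (d ^+ 2)) != 0 :> R[i] by rewrite -normr_eq0 n1 oner_eq0.
(* t is the argument of the missing phase; rotating by half of it suffices because [nu] squares the
   determinant. *)
have [t] := arg_exists n0; rewrite n1 mul1r => tE.
have JJ := almost_complex_sqr hJ q.
have c0 : cis (t / 2) != 0 by exact: cis_neq0.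
have dE : cdet (J q) (chart_reference q) (rotate (J q) (cis (t / 2)) u) = cis (t / 2) * d by exact: cdet_rotate.
have [|f [bf _ nf]] := @gram_schmidt_class q (rotate (J q) (cis (t / 2)) u) gq; first by rewrite dE mulf_neq0.
exists (Gam_class f); rewrite Gam_base_class nf dE; split; first exact: bf.
apply: val_inj; rewrite exprMn val_normalizeM ?expf_neq0 // normalizeE; last by rewrite normrX norm_cis expr1n.
have -> : cis (t / 2) ^+ 2 = cis t by rewrite expr2 -cisD; congr cis; lra.
by rewrite -tE divfK // S1_neq0.
Qed.

End maslov_bundle_coordinates.

(** * Continuity of Gram-Schmidt *)

Section gram_schmidt_continuity.
Context {R : realType} {T : Type} {F : set_system T} {FF : Filter F} {m : nat}.

Lemma ip_cvg (w J : T -> 'M[R]_m) (a b : T -> 'rV[R]_m) w0 J0 a0 b0 :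
  w @ F --> w0 -> J @ F --> J0 -> a @ F --> a0 -> b @ F --> b0 ->
  (fun t => ip (w t) (J t) (a t) (b t)) @ F --> ip w0 J0 a0 b0.
Proof.
move=> hw hJ ha hb.
have h2 : (fun t => a t *m (J t *m w t) *m (b t)^T) @ F --> a0 *m (J0 *m w0) *m b0^T.
  by apply: mulmx_cvg; [apply: mulmx_cvg; [exact: ha|exact: mulmx_cvg]|exact: trmx_cvg].
exact: ((@cvg_mxP R T F FF 1 1 _ _).1 h2 0 0).
Qed.

Lemma gs_normal_cvg (w J : T -> 'M[R]_m) (a : T -> 'rV[R]_m) w0 J0 a0 :
  0 < ip w0 J0 a0 a0 -> w @ F --> w0 -> J @ F --> J0 -> a @ F --> a0 ->
  (fun t => gs_normal (w t) (J t) (a t)) @ F --> gs_normal w0 J0 a0.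
Proof.
move=> p0 hw hJ ha.
have h1 : (fun t => ip (w t) (J t) (a t) (a t)) @ F --> ip w0 J0 a0 a0 by exact: ip_cvg.
have h2 : (fun t => (Num.sqrt (ip (w t) (J t) (a t) (a t)))^-1) @ F --> (Num.sqrt (ip w0 J0 a0 a0))^-1.
  apply: cvgV; first by rewrite gt_eqF // sqrtr_gt0.
  exact: (@cvg_comp _ _ _ (fun t => ip (w t) (J t) (a t) (a t)) Num.sqrt F _ _ h1 (@sqrt_continuous R _)).
exact: scalemx_cvg h2 ha.
Qed.

Lemma gs_ortho_cvg (w J : T -> 'M[R]_m) (u b : T -> 'rV[R]_m) w0 J0 u0 b0 :
  w @ F --> w0 -> J @ F --> J0 -> u @ F --> u0 -> b @ F --> b0 ->
  (fun t => gs_ortho (w t) (J t) (u t) (b t)) @ F --> gs_ortho w0 J0 u0 b0.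
Proof.
move=> hw hJ hu hb.
have huJ : (fun t => u t *m J t) @ F --> u0 *m J0 by exact: mulmx_cvg.
apply: cvgB; first apply: cvgB; first exact: hb.
  by apply: scalemx_cvg; [exact: ip_cvg|exact: hu].
by apply: scalemx_cvg; [exact: ip_cvg|exact: huJ].
Qed.

Lemma gram_schmidt_cvg (w J : T -> 'M[R]_m) (S : T -> 'M[R]_(2, m)) w0 J0 S0 :
  compatible_mx w0 J0 ->
  row 0 S0 != 0 -> gs_ortho w0 J0 (gs_normal w0 J0 (row 0 S0)) (row 1 S0) != 0 ->
  w @ F --> w0 -> J @ F --> J0 -> S @ F --> S0 ->
  (fun t => gram_schmidt (w t) (J t) (S t)) @ F --> gram_schmidt w0 J0 S0.
Proof.
move=> wJ n0 n1 hw hJ hS.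
have r0 : (fun t => row 0 (S t)) @ F --> row 0 S0 by exact: row_cvg.
have r1 : (fun t => row 1 (S t)) @ F --> row 1 S0 by exact: row_cvg.
have h0 : (fun t => gs_normal (w t) (J t) (row 0 (S t))) @ F --> gs_normal w0 J0 (row 0 S0).
  exact: (gs_normal_cvg (ip_gt0 wJ n0)).
have h1 : (fun t => gs_ortho (w t) (J t) (gs_normal (w t) (J t) (row 0 (S t))) (row 1 (S t))) @ F -->
    gs_ortho w0 J0 (gs_normal w0 J0 (row 0 S0)) (row 1 S0) by exact: gs_ortho_cvg.
have h2 : (fun t => gs_normal (w t) (J t)
    (gs_ortho (w t) (J t) (gs_normal (w t) (J t) (row 0 (S t))) (row 1 (S t)))) @ F -->
    gs_normal w0 J0 (gs_ortho w0 J0 (gs_normal w0 J0 (row 0 S0)) (row 1 S0)).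
  exact: (gs_normal_cvg (ip_gt0 wJ n1)).
exact: (@col_mx_cvg R T F FF 1 1 m _ _ _ _ h0 h2).
Qed.

Lemma rotate_cvg (z : T -> R[i]^o) (J : T -> 'M[R]_m) (S : 'M[R]_(2, m)) z0 J0 :
  z @ F --> (z0 : R[i]^o) -> J @ F --> J0 ->
  (fun t => rotate (J t) (z t) S) @ F --> rotate J0 z0 S.
Proof.
move=> hz hJ.
have h1 : (fun t => rotation_re (z t)) @ F --> rotation_re z0.
  apply/cvg_mxP => i j; rewrite mxE; under eq_fun do rewrite mxE.
  by case: ifP => _; [case: ifP => _; [exact: re_cvg|exact: cvg_cst]|exact: cvg_cst].
have h2 : (fun t => rotation_im (z t)) @ F --> rotation_im z0.
  apply/cvg_mxP => i j; rewrite mxE; under eq_fun do rewrite mxE.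
  by case: ifP => _; [exact: im_cvg|exact: cvg_cst].
have hS : (fun=> S) @ F --> S by exact: cvg_cst.
apply: cvgB; first by apply: mulmx_cvg; [exact: h1|exact: hS].
by apply: mulmx_cvg; [exact: h2|apply: mulmx_cvg; [exact: hS|exact: hJ]].
Qed.

End gram_schmidt_continuity.

Lemma cvg_open {T : Type} {U : topologicalType} {F : set_system T} {FF : Filter F}
    (f : T -> U) (l : U) (V : set U) :
  open V -> V l -> f @ F --> l -> \forall t \near F, V (f t).
Proof. by move=> oV Vl fl; exact: (fl V (open_nbhs_nbhs (conj oV Vl))). Qed.

(** A square root of the phase y that is continuous near y = 1 and involves no angle: x = (1 + y) /
    2 satisfies x = y conj(x), so x^2 / |x|^2 = x / conj(x) = y. *)
Lemma val_normalize_half_square {R : realType} (y : R[i]) : `|y| = 1 -> (1 + y) / 2 != 0 ->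
  val (normalize (((1 + y) / 2) ^+ 2)) = y :> R[i].
Proof.
move=> n1; set x := (1 + y) / 2 => x0.
have e : x = y * x^*.
  rewrite /x rmorphM /= rmorphD /= rmorph1 fmorphV rmorph_nat mulrA mulrDr mulr1 -normCK n1 expr1n.
  by rewrite addrC.
have c0 : x^* != 0 by rewrite conjC_eq0.
rewrite (val_normalize (expf_neq0 2 x0)) normrX normCK expr2 -mulf_div divff // mul1r.
by rewrite {1}e mulfK.
Qed.

(** * The topology of the Maslov bundle in coordinates *)

Section maslov_bundle_topology.
Context {R : realType} {M : topologicalType} (X : @manifold R M (2 + 2)).
Variables (w J : M -> 'M[R]_(2 + 2)).
Hypotheses (hw : symplectic X w) (hJ : almost_complex X J) (hcompat : compatible w J).
Local Notation C := (R[i]^o).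
Local Notation Fr := (Fr X w J).
Local Notation Gam := (Gam X w J).

Lemma tchange_jacobian c c' x : atlas X c -> atlas X c' -> cimg c' x -> cdom c (cinv c' x) ->
  tchange X c' x = jacobian (transition c' c) x *m tchange X c (transition c' c x).
Proof.
move=> Xc Xc' cx dx; apply/row_matrixP => i; rewrite !rowE mulmxA.
have d := transition_differentiable Xc' Xc cx dx.
have e := tchange_mul (delta_mx 0 i) Xc' Xc cx dx.
by rewrite (deriveEjacobian _ d) in e; exact: e.
Qed.

Lemma jacobian_transition_cvg c c' x : atlas X c -> atlas X c' -> cimg c' x -> cdom c (cinv c' x) ->
  {for x, continuous (jacobian (transition c' c))}.
Proof.
move=> Xc Xc' cx dx.
apply: (@cvg_mxP R _ (nbhs x) _ _ _ (jacobian (transition c' c)) (jacobian (transition c' c) x)).2 => i j.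
pose D y := ('D_(delta_mx 0 i) (transition c' c) y) 0 j.
have DE y : cimg c' y -> cdom c (cinv c' y) -> jacobian (transition c' c) y i j = D y.
  move=> cy dy; have d := transition_differentiable Xc' Xc cy dy.
  by rewrite /D (deriveEjacobian _ d) -rowE [RHS]mxE.
apply: (@cvg_near_eq _ _ (nbhs x) _ D).
  by apply: filterS (near_cinv_dom cx dx) => y [h1 h2]; exact: DE.
rewrite DE //.
have h := smooth_derive_continuous (v := delta_mx 0 i) (transition_smooth Xc' Xc) (overlapP cx dx).
have h2 : 'D_(delta_mx 0 i) (transition c' c) @ nbhs x --> 'D_(delta_mx 0 i) (transition c' c) x by exact: h.
by move/cvg_mxP: h2; apply.
Qed.

Variables (c : @chart R M (2 + 2)) (Xc : atlas X c) (Y : 'M[R]_(2 + 2, 2)).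
Local Notation Jc := (endo_in X J c).
Local Notation wc := (form_in X w c).
Local Notation tc q := (tchange X c (cmap c q)).
Local Notation good := (good X J c Y).
Local Notation nu := (@nu R M X w J c Y).

Definition frame_coord (f : mframes X) : 'rV[R]_(2 + 2) * 'M[R]_(2 + 2) :=
  (cmap c f.1, f.2 *m invmx (tc f.1)).

(** Open sets of frames are tested in every chart of the atlas, so continuity of the coordinates in
    c is checked in each c', where they become the transition map together with its jacobian. *)
Lemma frame_coord_cvg (f : mframes X) : cdom c f.1 -> {for f, continuous frame_coord}.
Proof.
move=> cf U; rewrite nbhsE => -[V [oV Vf] VU].
pose W : set (mframes X) := [set f | cdom c f.1 /\ V (frame_coord f)].
have oW : mframes_open W.
  move=> c' Xc'; rewrite openE => -[x A] [cx [dx Vx]].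
  pose g (y : 'rV[R]_(2 + 2) * 'M[R]_(2 + 2)) := (transition c' c y.1, y.2 *m jacobian (transition c' c) y.1).
  have gE y : cimg c' y.1 -> cdom c (cinv c' y.1) ->
      frame_coord (cinv c' y.1, y.2 *m tchange X c' y.1) = g y.
    move=> cy dy; rewrite /frame_coord /g /= (tchange_jacobian Xc Xc' cy dy).
    have Tu := tchange_unit Xc (cmapP dy).
    by rewrite mulmxA /transition /= mulmxK.
  have fx : {for (x, A), continuous (fst : 'rV[R]_(2 + 2) * 'M[R]_(2 + 2) -> _)} by exact: cvg_fst.
  have n1 := near_comp fx (near_cinv_dom cx dx).
  have gc : g @ nbhs (x, A) --> g (x, A).
    have h1 : (fun y : 'rV[R]_(2 + 2) * 'M[R]_(2 + 2) => transition c' c y.1) @ nbhs (x, A) --> transition c' c x.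
      apply: (@cvg_comp _ _ _ fst (transition c' c) (nbhs (x, A)) (nbhs x)); first exact: cvg_fst.
      exact: differentiable_continuous (transition_differentiable Xc' Xc cx dx).
    have h2 : (fun y : 'rV[R]_(2 + 2) * 'M[R]_(2 + 2) => jacobian (transition c' c) y.1) @ nbhs (x, A) --> jacobian (transition c' c) x.
      apply: (@cvg_comp _ _ _ fst (jacobian (transition c' c)) (nbhs (x, A)) (nbhs x)); first exact: cvg_fst.
      exact: jacobian_transition_cvg.
    have h3 : (fun y : 'rV[R]_(2 + 2) * 'M[R]_(2 + 2) => y.2) @ nbhs (x, A) --> A by exact: cvg_snd.
    have h4 : (fun y : 'rV[R]_(2 + 2) * 'M[R]_(2 + 2) => y.2 *m jacobian (transition c' c) y.1) @ nbhs (x, A) --> A *m jacobian (transition c' c) x.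
      exact: mulmx_cvg h3 h2.
    exact: cvg_pairl h1 h4.
  have n2 : \forall y \near (x, A), V (g y).
    apply: gc; rewrite -gE //; exact: open_nbhs_nbhs.
  apply: filterS2 n1 n2 => y [cy dy] Vy.
  by split; [exact: cy|split; [exact: dy|rewrite gE]].
have nW : nbhs f W by rewrite nbhsE; exists W => //; split => //; exact: oW.
by apply: filterS nW => f' [_ Vf']; exact: VU.
Qed.

Lemma fdet_cvg (f : mframes X) : cdom c f.1 -> {for f, continuous (fdet J c Y)}.
Proof.
move=> cf; have h := frame_coord_cvg cf.
have h1 : (fun f : mframes X => cmap c f.1) @ nbhs f --> cmap c f.1.
  exact: (@cvg_comp _ _ _ frame_coord fst (nbhs f) _ _ h cvg_fst).
have h2 : (fun f : mframes X => usubmx (f.2 *m invmx (tc f.1)) : 'M[R]_(2, 2 + 2)) @ nbhs f -->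
    (usubmx (f.2 *m invmx (tc f.1)) : 'M[R]_(2, 2 + 2)).
  apply: usubmx_cvg; exact: (@cvg_comp _ _ _ frame_coord snd (nbhs f) _ _ h cvg_snd).
have E (f' : mframes X) : fdet J c Y f' = cdet (Jc (cmap c f'.1)) Y (usubmx (f'.2 *m invmx (tc f'.1))).
  by rewrite /fdet mul_usub_mx.
have -> : fdet J c Y = (fun f' : mframes X => cdet (Jc (cmap c f'.1)) Y (usubmx (f'.2 *m invmx (tc f'.1)))).
  by apply/funext => f'; exact: E.
apply: (@cdet_cvg R _ (nbhs f) _ _ (fun f : mframes X => Jc (cmap c f.1)) (cst Y)
  (fun f : mframes X => usubmx (f.2 *m invmx (tc f.1)))).
- exact: (@cvg_comp _ _ _ (fun f : mframes X => cmap c f.1) Jc (nbhs f) _ _ h1 (endo_in_cvg hJ Xc (cmapP cf))).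
- exact: cvg_cst.
- exact: h2.
Qed.

Lemma mframes_base_continuous : continuous (fst : mframes X -> M).
Proof.
apply/continuousP => U oU; have : mframes_open (fst @^-1` U : set (mframes X)); last by [].
move=> c' Xc'; rewrite openE => -[x A] [cx Ux].
have fx : {for (x, A), continuous (fst : 'rV[R]_(2 + 2) * 'M[R]_(2 + 2) -> _)} by exact: cvg_fst.
have n1 := near_comp fx (near_cimg cx).
have n2 := near_comp fx (near_comp (cinv_cvg cx) (open_nbhs_nbhs (conj oU Ux))).
by apply: filterS2 n1 n2 => y h1 h2; split.
Qed.

Lemma Fr_val_continuous : continuous (val : Fr -> mframes X).
Proof. exact: val_continuous. Qed.

Lemma Gam_openP (U : set Gam) : open U <-> open ((@Gam_class R M 2 X w J) @^-1` U).
Proof. by []. Qed.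

Lemma frame_base_continuous : continuous (fun f : Fr => frame_base f).
Proof.
move=> f; exact: (@continuous_comp _ _ _ (val : Fr -> mframes X) (fst : mframes X -> M) f
  (@Fr_val_continuous f) (@mframes_base_continuous _)).
Qed.

Lemma Gam_base_continuous : continuous (@Gam_base R M 2 X w J).
Proof.
apply/continuousP => U oU; apply/Gam_openP.
have -> : (@Gam_class R M 2 X w J) @^-1` (@Gam_base R M 2 X w J @^-1` U) = (fun f : Fr => frame_base f) @^-1` U.
  by apply/seteqP; split=> f /=; rewrite Gam_base_class.
by apply: open_comp => // f _; exact: frame_base_continuous.
Qed.

Lemma nu_cvg (g : Gam) : good (Gam_base g) -> {for g, continuous nu}.
Proof.
move=> gg U; rewrite nbhsE => -[V [oV Vg] VU].
pose W : set Gam := [set g | good (Gam_base g) /\ V (nu g)].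
have oW : open W.
  apply/Gam_openP; rewrite openE => f [/= gf Vf]; rewrite Gam_base_class in gf.
  have n1 := near_comp (@frame_base_continuous f) (near_good hJ Xc gf).
  have h1 : (fun f : Fr => fdet J c Y (val f)) @ nbhs f --> fdet J c Y (val f).
    exact: (@cvg_comp _ _ _ (val : Fr -> mframes X) (fdet J c Y) (nbhs f) _ _ (@Fr_val_continuous f) (fdet_cvg gf.1)).
  have h2 : (fun f : Fr => fdet J c Y (val f) ^+ 2 : C) @ nbhs f --> (fdet J c Y (val f) ^+ 2 : C).
    exact: (cvgM h1 h1).
  have f0 : fdet J c Y (val f) ^+ 2 != 0 by rewrite expf_neq0 // (fdet_neq0 hw hJ hcompat Xc gf).
  have h3 : (fun f' : Fr => normalize (fdet J c Y (val f') ^+ 2)) @ nbhs f --> normalize (fdet J c Y (val f) ^+ 2).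
    exact: (normalize_cvg f0 h2).
  have nf : nu (Gam_class f) = normalize (fdet J c Y (val f) ^+ 2) by exact: nu_class.
  rewrite nf in Vf.
  have n2 : \forall f' \near f, V (normalize (fdet J c Y (val f') ^+ 2)).
    exact: (@cvg_open _ _ (nbhs f) _ (fun f' : Fr => normalize (fdet J c Y (val f') ^+ 2)) _ V oV Vf h3).
  apply: filterS2 n1 n2 => f' gf' Vf'; split; first by rewrite Gam_base_class.
  by have -> : nu (Gam_class f') = normalize (fdet J c Y (val f') ^+ 2) by exact: nu_class.
have nW : nbhs g W by rewrite nbhsE; exists W.
by apply: filterS nW => g' [_ Vg']; exact: VU.
Qed.

Lemma form_in_pullback q (S : 'M[R]_(2, 2 + 2)) : cdom c q ->
  orthonormal_lagrangian (wc (cmap c q)) (Jc (cmap c q)) S <->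
  orthonormal_lagrangian (w q) (J q) (S *m tc q).
Proof.
move=> cq; rewrite /orthonormal_lagrangian /form_in /endo_in (cmapK cq).
have := tchange_unit Xc (cmapP cq); move: (tc q) => T Tu.
have -> : S *m (T *m J q *m invmx T *m (T *m w q *m T^T)) *m S^T =
    S *m T *m (J q *m w q) *m (S *m T)^T by rewrite trmx_mul !mulmxA mulmxKV.
by have -> : S *m (T *m w q *m T^T) *m S^T = S *m T *m w q *m (S *m T)^T by rewrite trmx_mul !mulmxA.
Qed.

(* The continuous local inverse of (base, nu) is obtained by rotating the first vector of
   a reference frame by (1 + om) / 2, whose squared phase is om, and orthonormalizing. *)
Lemma near_Gam (W : set Gam) (g0 : Gam) : good (Gam_base g0) -> nbhs g0 W ->
  \forall y \near (Gam_base g0, nu g0), forall g, Gam_base g = y.1 -> nu g = y.2 -> W g.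
Proof.
move=> gg; rewrite nbhsE => -[V [oV Vg] VW].
set f0 := Gam_repr g0; set q0 := Gam_base g0.
have [V' oV' VE] : exists2 V' : set (mframes X), open V' & val @^-1` V' = (@Gam_class R M 2 X w J) @^-1` V.
  exact: oV.
have V'f0 : V' (val f0).
  by have : (val @^-1` V') f0 by rewrite VE /= Gam_reprK.
have cq0 : cdom c q0 := gg.1.
pose S0 : 'M[R]_(2, 2 + 2) := frame_upper f0 *m invmx (tc q0).
have [h0 e0] := frame_upperP hw hJ hcompat f0.
have T0u := tchange_unit Xc (cmapP cq0).
have S0E : S0 *m tc q0 = frame_upper f0 by rewrite /S0 mulmxKV.
have S0o : orthonormal_lagrangian (wc (cmap c q0)) (Jc (cmap c q0)) S0.
  by apply/(form_in_pullback _ cq0); rewrite S0E.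
have wJ0 := chart_compatible hw hJ hcompat Xc (cmapP cq0).
have Y0 : forall a : 'rV[R]_(2 + 2), a *m Y = 0 -> a *m Jc (cmap c q0) *m Y = 0 -> a = 0.
  exact/reference_mxP/gg.2.
pose D q : C := cdet (Jc (cmap c q)) Y S0.
have D0 : D q0 != 0 by exact: (cdet_frame_neq0 wJ0 Y0 S0o).
pose om (y : M * S1 R) : C := (1 + val y.2 / (D y.1 ^+ 2 / `|D y.1 ^+ 2|)) / 2.
pose Rt (y : M * S1 R) := rotate (Jc (cmap c y.1)) (om y) S0.
pose G y := gram_schmidt (wc (cmap c y.1)) (Jc (cmap c y.1)) (Rt y).
pose Q (y : M * S1 R) : 'rV[R]_(2 + 2) * 'M[R]_(2 + 2) := (cmap c y.1, frame_of (Jc (cmap c y.1)) (G y)).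
set b := (q0, nu g0).
have vS (y : S1 R) : val y != 0 :> R[i] by exact: S1_neq0.
have nu0 : val (nu g0) = D q0 ^+ 2 / `|D q0 ^+ 2| :> R[i].
  by rewrite -(val_normalize (expf_neq0 2 D0)).
have om0 : om b = 1.
  have e : om b = (1 + val (nu g0) / (D q0 ^+ 2 / `|D q0 ^+ 2|)) / 2 by [].
  by rewrite e -nu0 (divff (vS _)) -mulr2n divff // pnatr_eq0.
have Rt0 : Rt b = S0 by rewrite /Rt om0 rotate1.
have G0 : G b = S0 by rewrite /G Rt0; exact: (gram_schmidt_id wJ0 S0o).
have fc : (fun y : M * S1 R => cmap c y.1) @ nbhs b --> cmap c q0.
  apply: (@cvg_comp _ _ _ fst (cmap c) (nbhs b) (nbhs q0)); first exact: cvg_fst.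
  exact: cmap_cvg.
have Jcv : (fun y : M * S1 R => Jc (cmap c y.1)) @ nbhs b --> Jc (cmap c q0).
  exact: (@cvg_comp _ _ _ (fun y : M * S1 R => cmap c y.1) Jc (nbhs b) _ _ fc (endo_in_cvg hJ Xc (cmapP cq0))).
have wcv : (fun y : M * S1 R => wc (cmap c y.1)) @ nbhs b --> wc (cmap c q0).
  exact: (@cvg_comp _ _ _ (fun y : M * S1 R => cmap c y.1) wc (nbhs b) _ _ fc (form_in_cvg hw Xc (cmapP cq0))).
have Dcv : (fun y : M * S1 R => D y.1) @ nbhs b --> D q0.
  apply: (@cdet_cvg R _ (nbhs b) _ _ (fun y : M * S1 R => Jc (cmap c y.1)) (cst Y) (cst S0)).
  - exact: Jcv.
  - exact: cvg_cst.
  - exact: cvg_cst.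
have D2cv : (fun y : M * S1 R => D y.1 ^+ 2 : C) @ nbhs b --> (D q0 ^+ 2 : C) by exact: (cvgM Dcv Dcv).
have D20 : D q0 ^+ 2 != 0 by rewrite expf_neq0.
have phcv : (fun y : M * S1 R => D y.1 ^+ 2 / `|D y.1 ^+ 2| : C) @ nbhs b --> (D q0 ^+ 2 / `|D q0 ^+ 2| : C).
  exact: (phase_cvg D20 D2cv).
have zcv : (fun y : M * S1 R => val y.2 : C) @ nbhs b --> (val (nu g0) : C).
  by apply: (@cvg_comp _ _ _ snd (fun z : S1 R => val z : C) (nbhs b) (nbhs (nu g0))); [exact: cvg_snd|exact: val_S1_continuous].
have omcv : om @ nbhs b --> (1 : C).
  rewrite -om0; apply: cvgM; last exact: cvg_cst.
  apply: cvgD; first exact: cvg_cst.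
  apply: cvgM; first exact: zcv.
  by apply: cvgV; [rewrite -nu0; exact: vS|exact: phcv].
have Rtcv : Rt @ nbhs b --> S0.
  by rewrite -[X in _ --> X](rotate1 (Jc (cmap c q0))); exact: rotate_cvg.
have n0 : row 0 S0 != 0 /\ gs_ortho (wc (cmap c q0)) (Jc (cmap c q0))
    (gs_normal (wc (cmap c q0)) (Jc (cmap c q0)) (row 0 S0)) (row 1 S0) != 0.
  exact: (gs_nondeg wJ0 D0).
have Gcv : G @ nbhs b --> S0.
  by rewrite -[X in _ --> X](gram_schmidt_id wJ0 S0o); exact: (gram_schmidt_cvg wJ0 n0.1 n0.2).
have Qcv : Q @ nbhs b --> (cmap c q0, frame_of (Jc (cmap c q0)) S0).
  apply: (@cvg_pairl _ _ _ (nbhs b) _ (fun y => cmap c y.1) (fun y => frame_of (Jc (cmap c y.1)) (G y))); first exact: fc.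
  apply: (@col_mx_cvg R _ (nbhs b) _ _ _ _ G (fun y => - (G y *m Jc (cmap c y.1)))); first exact: Gcv.
  by apply: cvgN; apply: (@mulmx_cvg R _ (nbhs b) _ _ _ _ G); [exact: Gcv|exact: Jcv].
have frame_tc q (S : 'M[R]_(2, 2 + 2)) : cdom c q -> frame_of (Jc (cmap c q)) S *m tc q = frame_of (J q) (S *m tc q).
  move=> cq; rewrite /frame_of /endo_in (cmapK cq).
  have := tchange_unit Xc (cmapP cq); move: (tc q) => T Tu.
  by rewrite mul_col_mx mulNmx !mulmxA mulmxKV.
have oM : open (mframes_in c V') := oV' c Xc.
have M0 : mframes_in c V' (cmap c q0, frame_of (Jc (cmap c q0)) S0).
  split; first exact: cmapP.
  rewrite /= (frame_tc _ _ cq0) S0E (cmapK cq0).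
  have -> : (q0, frame_of (J q0) (frame_upper f0)) = val f0.
    exact: etrans (congr1 (pair q0) (esym e0)) (esym (surjective_pairing (val f0))).
  exact: V'f0.
have m1 : \forall y \near b, mframes_in c V' (Q y).
  exact: (@cvg_open _ _ (nbhs b) _ Q _ (mframes_in c V') oM M0 Qcv).
have m2 : \forall y \near b, good y.1.
  by apply: (near_comp (f := fst)); [exact: cvg_fst|exact: near_good].
have m3 : \forall y \near b, D y.1 != 0 by exact: (cvgr_neq0 _ Dcv).
have m4 : \forall y \near b, 0 < complex.Re (om y).
  have h : (fun y => complex.Re (om y)) @ nbhs b --> (1 : R) by exact: (re_cvg omcv).
  exact: (cvgr_gt _ h _ ltr01).
apply: filterS3 (filterI m1 m2) m3 m4 => y [[_ V'y] gy] Dy omy g bg ng.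
apply: VW; have cy : cdom c y.1 := gy.1.
have wJy := chart_compatible hw hJ hcompat Xc (cmapP cy).
have om_neq0 : om y != 0 by apply: contraTneq omy => ->; rewrite ltxx.
have [_ JJ _ _] := wJy.
have dE : cdet (Jc (cmap c y.1)) Y (Rt y) = om y * D y.1 by exact: (cdet_rotate Y (om y) S0 JJ).
have dE0 : cdet (Jc (cmap c y.1)) Y (Rt y) != 0 by rewrite dE mulf_neq0.
have [k0 k1] := gs_nondeg wJy dE0.
have [k kpos kE] := gram_schmidt_cdet wJy dE0.
have ou := (form_in_pullback (G y) cy).1 (gram_schmidt_unitary wJy k0 k1).
pose f := unitary_frame hw hJ hcompat ou.
have fE : val f = (y.1, frame_of (J y.1) (G y *m tc y.1)) by [].
have fd : fdet J c Y (val f) = k%:C * (om y * D y.1).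
  rewrite -dE -kE /fdet fE /= /frame_of col_mxKu.
  by rewrite (mulmxK (tchange_unit Xc (cmapP cy))).
have gf : good (frame_base f) by exact: gy.
have bf : Gam_base (Gam_class f) = y.1 by rewrite Gam_base_class.
have nf : nu (Gam_class f) = y.2.
  have -> : nu (Gam_class f) = normalize (fdet J c Y (val f) ^+ 2) by exact: nu_class.
  have k2 : 0 < k ^+ 2 by exact: exprn_gt0.
  have oD : (om y * D y.1) ^+ 2 != 0 by exact: (expf_neq0 2 (mulf_neq0 om_neq0 Dy)).
  have kk : k%:C ^+ 2 = (k ^+ 2)%:C :> C by rewrite -rmorphXn.
  rewrite fd exprMn kk (normalizeZ k2 oD).
  have Dy2 : D y.1 ^+ 2 != 0 by rewrite expf_neq0.
  have om2 : om y ^+ 2 != 0 by rewrite expf_neq0.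
  apply: val_inj; rewrite exprMn (val_normalizeM om2 Dy2) (val_normalize Dy2).
  have ph1 : `|D y.1 ^+ 2 / `|D y.1 ^+ 2| | = 1 by rewrite -(val_normalize Dy2) S1_norm.
  have n1 : `|val y.2 / (D y.1 ^+ 2 / `|D y.1 ^+ 2|)| = 1 by rewrite normf_div S1_norm ph1 divr1.
  have ph0 : D y.1 ^+ 2 / `|D y.1 ^+ 2| != 0 by rewrite -normr_eq0 ph1 oner_eq0.
  by rewrite (val_normalize_half_square n1 om_neq0) (divfK ph0).
have gE : g = Gam_class f.
  apply: (@nu_injective _ _ X w J hw hJ hcompat c Xc Y); first by rewrite bg.
    by rewrite bf bg.
  by rewrite ng; exact: nf.
rewrite gE; have : (val @^-1` V') f.
  by move: V'y; rewrite /= (cmapK cy) (frame_tc _ _ cy).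
by rewrite VE.
Qed.

(** The form in which [near_Gam] is used: continuity into the bundle is checked separately on the
    base and on [nu]. *)
Lemma Gam_cvg {T} {F : set_system T} {FF : Filter F} (s : T -> Gam) (g : Gam) :
  good (Gam_base g) -> (fun t => Gam_base (s t)) @ F --> Gam_base g ->
  (fun t => nu (s t)) @ F --> nu g -> s @ F --> g.
Proof.
move=> gg hb hn W /(near_Gam gg) nW.
have h : (fun t => (Gam_base (s t), nu (s t))) @ F --> (Gam_base g, nu g) by exact: cvg_pairl.
have h' : F [set t | forall g', Gam_base g' = Gam_base (s t) -> nu g' = nu (s t) -> W g'].
  exact: (h _ nW).
suff : F [set t | W (s t)] by [].
by apply: (@filterS _ F _ _ _ _ h') => t ht; exact: (ht (s t)).
Qed.

End maslov_bundle_topology.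

Lemma normalize_div {R : realType} (x y : S1 R) :
  val x = val y * val (normalize (val x / val y : R[i]^o)) :> R[i].
Proof.
rewrite normalizeE; last by rewrite normf_div !S1_norm divr1.
by rewrite mulrC divfK // S1_neq0.
Qed.

Lemma normalize_mul {R : realType} (x y : S1 R) :
  val (normalize (val x * val y : R[i]^o)) = val x * val y :> R[i].
Proof. by rewrite normalizeE // normrM !S1_norm mulr1. Qed.

(** * The circle action and quotients of elements of one fibre *)

Section ratios.
Context {R : realType} {M : topologicalType} (X : @manifold R M (2 + 2)).
Variables (w J : M -> 'M[R]_(2 + 2)).
Hypotheses (hw : symplectic X w) (hJ : almost_complex X J) (hcompat : compatible w J).
Local Notation C := (R[i]^o).
Local Notation Fr := (Fr X w J).
Local Notation Gam := (Gam X w J).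
Local Notation Gam_base := (@Gam_base R M 2 X w J).

Lemma good_chart q : exists Y, good X J (chart_at X q) Y q.
Proof.
have wJ := chart_compatible hw hJ hcompat (chart_at_atlas X q) (cmapP (chart_at_dom X q)).
have [Y h] := reference_exists wJ; exists Y; split; first exact: chart_at_dom.
exact/reference_mxP.
Qed.

Lemma Gam_act_base (g g' : Gam) z : Gam_act g z g' -> Gam_base g' = Gam_base g.
Proof.
move=> h; have [Y gY] := good_chart (Gam_base g).
by have [] := (Gam_actP hw hJ hcompat (chart_at_atlas X _) g' z gY).1 h.
Qed.

Lemma Gam_act_exists (g g' : Gam) : Gam_base g' = Gam_base g -> exists z, Gam_act g z g'.
Proof.
move=> bE; have [Y gY] := good_chart (Gam_base g).
pose z := normalize (val (nu (chart_at X (Gam_base g)) Y g') / val (nu (chart_at X (Gam_base g)) Y g) : C).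
exists z; apply: (Gam_actP hw hJ hcompat (chart_at_atlas X _) g' z gY).2; split; first exact: bE.
exact: normalize_div.
Qed.

Lemma Gam_act_total (g : Gam) z : exists g', Gam_act g z g'.
Proof.
have [Y gY] := good_chart (Gam_base g).
have [g' [bE nE]] := Gam_exists hw hJ hcompat (chart_at_atlas X _)
  (normalize (val (nu (chart_at X (Gam_base g)) Y g) * val z : C)) gY.
exists g'; apply: (Gam_actP hw hJ hcompat (chart_at_atlas X _) g' z gY).2; split; first exact: bE.
by rewrite nE normalizeE // normrM !S1_norm mulr1.
Qed.

Lemma Gam_act_source (g : Gam) z : exists g', Gam_act g' z g.
Proof.
have [Y gY] := good_chart (Gam_base g).
have [g' [bE nE]] := Gam_exists hw hJ hcompat (chart_at_atlas X _)
  (normalize (val (nu (chart_at X (Gam_base g)) Y g) / val z : C)) gY.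
exists g'; rewrite -bE in gY nE *; apply: (Gam_actP hw hJ hcompat (chart_at_atlas X _) g z gY).2.
split; first by [].
by rewrite nE normalizeE ?divfK ?S1_neq0 // normf_div !S1_norm divr1.
Qed.

Lemma Gam_act_comp (g g' g'' : Gam) z z' : Gam_act g z g' -> Gam_act g' z' g'' ->
  Gam_act g (normalize (val z * val z' : C)) g''.
Proof.
move=> h h'; have bE := Gam_act_base h; have bE' := Gam_act_base h'.
have [Y gY] := good_chart (Gam_base g).
have gY' : good X J (chart_at X (Gam_base g)) Y (Gam_base g') by rewrite bE.
have [_ e] := (Gam_actP hw hJ hcompat (chart_at_atlas X _) g' z gY).1 h.
have [_ e'] := (Gam_actP hw hJ hcompat (chart_at_atlas X _) g'' z' gY').1 h'.
apply: (Gam_actP hw hJ hcompat (chart_at_atlas X _) g'' _ gY).2; split; first by rewrite bE' bE.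
have key (x1 x2 x3 : R[i]) : x2 = x1 * val z -> x3 = x2 * val z' ->
    x3 = x1 * val (normalize (val z * val z' : C)).
  by move=> -> ->; rewrite normalize_mul mulrA.
exact: key e e'.
Qed.

Lemma Gam_act_inj_target (g g' g'' : Gam) z : Gam_act g z g' -> Gam_act g z g'' -> g' = g''.
Proof.
move=> h h'; have bE := Gam_act_base h; have bE' := Gam_act_base h'.
have [Y gY] := good_chart (Gam_base g).
have [_ e] := (Gam_actP hw hJ hcompat (chart_at_atlas X _) g' z gY).1 h.
have [_ e'] := (Gam_actP hw hJ hcompat (chart_at_atlas X _) g'' z gY).1 h'.
apply: (nu_injective hw hJ hcompat (chart_at_atlas X (Gam_base g)) (Y := Y)); first by rewrite bE.
  by rewrite bE bE'.
by apply: val_inj; apply: etrans e' (esym e).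
Qed.

Lemma Gam_act_inj_source (g g' g'' : Gam) z : Gam_act g' z g -> Gam_act g'' z g -> g' = g''.
Proof.
move=> h h'; have bE := Gam_act_base h; have bE' := Gam_act_base h'.
have [Y gY] := good_chart (Gam_base g).
have gY' : good X J (chart_at X (Gam_base g)) Y (Gam_base g') by rewrite -bE.
have gY'' : good X J (chart_at X (Gam_base g)) Y (Gam_base g'') by rewrite -bE'.
have [_ e] := (Gam_actP hw hJ hcompat (chart_at_atlas X _) g z gY').1 h.
have [_ e'] := (Gam_actP hw hJ hcompat (chart_at_atlas X _) g z gY'').1 h'.
apply: (nu_injective hw hJ hcompat (chart_at_atlas X (Gam_base g)) gY'); first by rewrite -bE bE'.
by apply: val_inj; apply: (mulIf (S1_neq0 z)); apply: etrans (esym e') e.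
Qed.

Lemma Gam_act_inj_phase (g g' : Gam) z z' : Gam_act g z g' -> Gam_act g z' g' -> z = z'.
Proof.
move=> h h'; have [Y gY] := good_chart (Gam_base g).
have [_ e] := (Gam_actP hw hJ hcompat (chart_at_atlas X _) g' z gY).1 h.
have [_ e'] := (Gam_actP hw hJ hcompat (chart_at_atlas X _) g' z' gY).1 h'.
by apply: val_inj; apply: (mulfI (S1_neq0 (nu (chart_at X (Gam_base g)) Y g))); apply: etrans (esym e) e'.
Qed.

(** The z with g . z = g'; for elements over different points no such z exists and the value is the
    default [expi 0]. *)
Definition phase_ratio (g g' : Gam) : S1 R := xget (expi 0) [set z | Gam_act g z g'].

Lemma phase_ratioP (g g' : Gam) : Gam_base g' = Gam_base g -> Gam_act g (phase_ratio g g') g'.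
Proof.
by move=> /Gam_act_exists[z zP]; have := @xgetI _ (expi 0) [set z | Gam_act g z g'] z zP.
Qed.

Lemma phase_ratioE (g g' : Gam) z : Gam_act g z g' -> phase_ratio g g' = z.
Proof. by move=> h; apply: (Gam_act_inj_phase _ h); apply: phase_ratioP; exact: Gam_act_base h. Qed.

Lemma val_ratio c Y (g g' : Gam) : atlas X c -> good X J c Y (Gam_base g) ->
  Gam_base g' = Gam_base g -> val (phase_ratio g g') = val (nu c Y g') / val (nu c Y g) :> R[i].
Proof.
move=> Xc gY bE; have [_ e] := (Gam_actP hw hJ hcompat Xc g' (phase_ratio g g') gY).1 (phase_ratioP bE).
exact: esym (canLR (mulfK (S1_neq0 (nu c Y g))) (etrans e (mulrC _ _))).
Qed.

Lemma phase_ratio_cvg {T} {F : set_system T} {FF : Filter F} (s s' : T -> Gam) (g g' : Gam) :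
  (forall t, Gam_base (s' t) = Gam_base (s t)) -> Gam_base g' = Gam_base g ->
  s @ F --> g -> s' @ F --> g' -> (fun t => phase_ratio (s t) (s' t)) @ F --> phase_ratio g g'.
Proof.
move=> bt bE sg sg'; have [Y gY] := good_chart (Gam_base g).
set c := chart_at X _ in gY; have Xc : atlas X c := chart_at_atlas X _.
have gY' : good X J c Y (Gam_base g') by rewrite bE.
have n1 : (fun t => nu c Y (s t)) @ F --> nu c Y g.
  exact: (@cvg_comp _ _ _ s (nu c Y) F _ _ sg (nu_cvg hw hJ hcompat Xc gY)).
have n2 : (fun t => nu c Y (s' t)) @ F --> nu c Y g'.
  exact: (@cvg_comp _ _ _ s' (nu c Y) F _ _ sg' (nu_cvg hw hJ hcompat Xc gY')).
have v1 : (fun t => val (nu c Y (s t)) : C) @ F --> (val (nu c Y g) : C).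
  exact: (@cvg_comp _ _ _ (fun t => nu c Y (s t)) (fun z : S1 R => val z : C) F _ _ n1 (@val_S1_continuous R _)).
have v2 : (fun t => val (nu c Y (s' t)) : C) @ F --> (val (nu c Y g') : C).
  exact: (@cvg_comp _ _ _ (fun t => nu c Y (s' t)) (fun z : S1 R => val z : C) F _ _ n2 (@val_S1_continuous R _)).
have b1 : (fun t => Gam_base (s t)) @ F --> Gam_base g.
  exact: (@cvg_comp _ _ _ s Gam_base F _ _ sg (@Gam_base_continuous R M X w J _)).
have nr : F [set t | good X J c Y (Gam_base (s t))].
  exact: (b1 _ (near_good hJ Xc gY)).
apply: S1_cvg; rewrite (val_ratio Xc gY bE).
apply: (@cvg_near_eq _ _ F FF (fun t => val (nu c Y (s' t)) / val (nu c Y (s t)) : C)).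
  by apply: filterS nr => t gt; exact: val_ratio.
by apply: cvgM; [exact: v2|apply: cvgV; [exact: S1_neq0|exact: v1]].
Qed.

Lemma frame_injective (f f' : Fr) : frame_base f = frame_base f' -> frame_upper f = frame_upper f' -> f = f'.
Proof.
move=> bE uE; apply: val_inj.
have [_ e] := frame_upperP hw hJ hcompat f; have [_ e'] := frame_upperP hw hJ hcompat f'.
rewrite bE uE in e.
have h : (frame_base f, frame_mx f) = (frame_base f', frame_mx f') by rewrite bE e e'.
exact: etrans (surjective_pairing (val f)) (etrans h (esym (surjective_pairing (val f')))).
Qed.

(** With vanishing imaginary block the complex determinant is real, and modulus 1 leaves 1 and
    -1. *)
Lemma detC_real (D : 'M[R]_(2 + 2)) : Ogroup D -> EUgroup D.
Proof.
move=> [UD oD]; split; first exact: UD.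
have dE : detC D = (\det (ulsubmx D))%:C.
  rewrite /detC /complex_of; have -> : dlsubmx D = 0 := oD.
  by rewrite map_mx0 scaler0 addr0 det_map_mx.
have := norm_detC UD; rewrite dE.
have -> : `|(\det (ulsubmx D))%:C| = `|\det (ulsubmx D)|%:C :> R[i] by rewrite normc_def /= expr0n addr0 sqrtr_sqr.
move=> /(congr1 (@complex.Re R)) /= /eqP; rewrite eqr_norml ler01 andbT.
move=> /orP[]/eqP h; [left|right]; apply: etrans dE _; rewrite h //.
by rewrite rmorphN1.
Qed.

Lemma det2_class (f : Fr) : det2 (Lam_class f) = Gam_class f.
Proof.
rewrite /det2; apply/esym/Gam_classP.
have /eqmodP/asboolP[D OD fD] : Lam_class f = Lam_class (Lam_repr (Lam_class f)).
  by rewrite /Lam_class /Lam_repr reprK.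
by exists D; [exact: detC_real|].
Qed.

(** Gram-Schmidt is carried out in T_qM, so one frame serves all charts at once, and since it keeps
    phases the fibre coordinate is read off from the generators. *)
Lemma plane_class Phi q : (forall q, Phi 0 q = q) ->
  (forall c, atlas X c -> smooth_into X (setT `*` cimg c)
      (fun ux : 'rV[R]_2 * 'rV[R]_(2 + 2) => Phi ux.1 (cinv c ux.2))) ->
  lagrangian (w q) (generators X Phi q) ->
  exists l : Lam X w J, [/\ Gam_base (det2 l) = q,
    forall T : 'M[R]_(2, 2 + 2), (generators X Phi q :=: T)%MS -> is_plane l q T &
    forall c Y, atlas X c -> good X J c Y q ->
      nu c Y (det2 l) = normalize (gdet X J Phi c Y q ^+ 2)].
Proof.
move=> P0 PS lag; have wJ := pointwise_compatible hw hJ hcompat q.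
have d0 c Y : atlas X c -> good X J c Y q ->
    cdet (J q) (chart_reference X c Y q) (generators X Phi q) != 0.
  move=> Xc gY; apply: (cdet_neq0 wJ (chart_reference_good Xc gY)); first exact: lag.1.
  exact: lag.2.
have [Y gY] := good_chart q; have Xq := chart_at_atlas X q.
have [f [bf uf _]] := gram_schmidt_class hw hJ hcompat Xq gY (d0 _ _ Xq gY).
exists (Lam_class f); rewrite det2_class Gam_base_class; split; first exact: bf.
  move=> T GT; exists f; split; [by []|exact: bf|].
  have [A Au AE] := gram_schmidt_span wJ (d0 _ _ Xq gY) lag.1.
  have -> : usubmx (frame_mx f) = A *m generators X Phi q by rewrite -AE -uf.
  apply/eqmxP; apply: eqmx_trans GT; apply: eqmxMfull.
  by rewrite row_full_unit.
move=> c Y' Xc gY'.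
have [f' [bf' uf' nf']] := gram_schmidt_class hw hJ hcompat Xc gY' (d0 _ _ Xc gY').
have -> : f = f' by apply: frame_injective; rewrite ?bf ?bf' ?uf ?uf'.
by rewrite nf' (gdet_generators J Xc _ P0 PS gY'.1).
Qed.

End ratios.

Lemma norm_complex_real {R : realType} (x : R[i]) : x != 0 -> exists2 k : R, 0 < k & `|x| = k%:C.
Proof.
rewrite -normr_gt0 ltcE => /andP[/eqP im re]; exists (complex.Re `|x|); first exact: re.
by case: (`|x|) im => a b /= ->.
Qed.

Lemma cvg_preimage {T : Type} {U : topologicalType} {F : set_system T} (f : T -> U) (l : U) (P : set U) :
  f @ F --> l -> nbhs l P -> F [set t | P (f t)].
Proof. by move=> fl; exact: fl. Qed.

(** * The global section over the pinched torus *)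

Section global_sections.
Context {R : realType} {M : topologicalType} (X : @manifold R M (2 + 2)).
Variables (w J : M -> 'M[R]_(2 + 2)) (Phi : 'rV[R]_2 -> M -> M).
Variables (p : S1 R * R -> M) (p0 : M).
Hypotheses (hw : symplectic X w) (hJ : almost_complex X J) (hcompat : compatible w J).
Hypothesis hPhi : hamiltonian_action X w Phi.
Hypothesis htorus : lagrangian_pinched_torus X w p p0.
Hypothesis hfixed : forall u, Phi u p0 = p0.
Hypothesis horbit : exists2 q, (p @` open_cylinder (R := R)) q &
  p @` open_cylinder (R := R) = range (fun u => Phi u q).
Hypothesis hregular : forall q, (p @` open_cylinder (R := R)) q ->
  \rank (generators X Phi q) = 2%N.
Local Notation o := (p @` open_cylinder (R := R)).
Local Notation C := (R[i]^o).
Local Notation Gam := (Gam X w J).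
Local Notation Gam_base := (@Gam_base R M 2 X w J).

(* K is the determinant of the generators over both ends; the two circles |r| = rho are
   joined by interpolating the arguments, which differ by a periodic function since
   the winding numbers agree. *)
Lemma interpolation c Y rho0 : atlas X c -> 0 < rho0 < 1 ->
  (forall z r, rho0 <= `|r| <= 1 -> good X J c Y (p (z, r))) ->
  exists rho, exists K : R -> R -> C,
    [/\ rho0 <= rho < 1 /\ continuous (fun z : R * R => K z.1 z.2),
        forall t r, -1 < r < 1 -> K t r != 0,
        forall t (n : int) r, K (t + n%:~R) r = K t r &
        forall t r, rho <= `|r| < 1 -> exists2 k : R, 0 < k & K t r = k%:C * gdet X J Phi c Y (p (expi t, r))].
Proof.
move=> Xc rho01 rho_good.
have [d wd] := gdet_winding_ends hw hJ hcompat hPhi htorus hfixed horbit hregular Xc rho01 rho_good.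
have /andP[rho0_gt rho0_lt] := rho01.
(* The common winding number is known for |r| > rho0 only; the midpoint puts the circles of radius
   rho and - rho strictly inside this range. *)
pose rho := (rho0 + 1) / 2.
have rho_gt : rho0 < rho by rewrite /rho; lra.
have rho_lt : rho < 1 by rewrite /rho; lra.
pose G (z : R * R) : C := gdet X J Phi c Y (unroll_clamp p z).
have GE t r : -1 <= r <= 1 -> G (t, r) = gdet X J Phi c Y (p (expi t, r)).
  by move=> r1; rewrite /G /unroll_clamp /= clamp_id.
have Gc (z : R * R) : rho0 <= `|z.2| -> {for z, continuous G}.
  move=> z2; have h : rho0 <= `|clamp (-1) 1 z.2| <= 1.
    have n1 : -1 <= 1 :> R by lra.
    have /andP[c1 c2] := clamp_itv z.2 n1.
    apply/andP; split; last by rewrite ler_norml c1 c2.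
    case: (lerP 1 z.2) => h1.
      have -> : clamp (-1) 1 z.2 = 1 by rewrite /clamp (min_idPl h1) (max_idPr n1).
      by rewrite normr1 ltW.
    case: (lerP (-1) z.2) => h2.
      have h3 : -1 <= z.2 <= 1 by apply/andP; split; lra.
      rewrite (clamp_id h3); exact: z2.
    have -> : clamp (-1) 1 z.2 = -1 by rewrite /clamp (min_idPr (ltW h1)) (max_idPl (ltW h2)).
    by rewrite normrN normr1 ltW.
  exact: (@continuous_comp _ _ _ (unroll_clamp p) (gdet X J Phi c Y) z (unroll_clamp_continuous htorus (x := z))
    (gdet_continuous hJ hPhi Xc (rho_good (expi z.1) _ h))).
have G0 t r : -1 < r < 1 -> rho0 <= `|r| -> G (t, r) != 0.
  move=> /andP[r1 r2] hr; rewrite GE; last by rewrite !ltW.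
  apply: (gdet_neq0 hw hJ hcompat hPhi htorus horbit hregular Xc).
    by exists (expi t, r) => //=; rewrite /open_cylinder /= r1 r2.
  by apply: rho_good; rewrite hr ler_norml !ltW.
have Gp t (n : int) r : G (t + n%:~R, r) = G (t, r).
  by rewrite /G /unroll_clamp /= expi_shift.
have rr1 : -1 < rho < 1 by apply/andP; split; lra.
have rr2 : -1 < - rho < 1 by apply/andP; split; lra.
have ra1 : `|rho| = rho by rewrite ger0_norm; lra.
have ra2 : `|- rho| = rho by rewrite normrN.
have w1 : winding (fun t => G (t, rho)) d.
  have -> : (fun t => G (t, rho)) = (fun t => gdet X J Phi c Y (p (expi t, rho))).
    by apply/funext => t; rewrite GE //; apply/andP; split; lra.
  by apply: wd; rewrite ra1 rho_gt.
have w2 : winding (fun t => G (t, - rho)) d.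
  have -> : (fun t => G (t, - rho)) = (fun t => gdet X J Phi c Y (p (expi t, - rho))).
    by apply/funext => t; rewrite GE //; apply/andP; split; lra.
  by apply: wd; rewrite ra2 rho_gt.
pose L t : C := G (t, rho) * (G (t, - rho))^-1.
have L0 t : L t != 0.
  by rewrite mulf_neq0 ?invr_eq0 // G0 // ?ra1 ?ra2 ltW.
(* The quotient of the two circles has winding number d - d = 0, which makes its argument th
   periodic; otherwise the interpolation below would not descend to the circle. *)
have [th thL th01] : winding L (d + - d) := windingM w1 (windingV w2).
have Lp t : L (t + 1) = L t by have := Gp t 1; rewrite /L => h; rewrite !(Gp t 1).
have th1 t : th (t + 1) = th t.
  have a1 : is_arg L (fun t => th (t + 1)).
    split; last by move=> s; rewrite -(Lp s); exact: thL.2.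
    move=> s; apply: (@continuous_comp _ _ _ (fun s : R => s + 1 : R) th s); last exact: thL.1.
    by apply: cvgD; [exact: cvg_id|exact: cvg_cst].
  have h := is_arg_unique L0 a1 thL t 0; rewrite add0r th01 subrr in h.
  by apply/eqP; rewrite -subr_eq0 h.
have thn t (n : int) : th (t + n%:~R) = th t.
  have nat_case s (k : nat) : th (s + k%:R) = th s.
    by elim: k => [|k IH]; rewrite ?addr0 // -natr1 addrA th1.
  case: n => n; first exact: nat_case.
  have h := nat_case (t - n.+1%:R) n.+1; rewrite subrK in h.
  by rewrite NegzE mulrNz; exact: esym h.
pose lam r := clamp 0 1 ((r + rho) / (2 * rho)).
have rho_pos : 0 < rho by lra.
have lam1 r : rho <= r -> lam r = 1.
  move=> h; rewrite /lam /clamp min_l ?max_r // ler_pdivlMr; lra.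
have lam0 r : r <= - rho -> lam r = 0.
  move=> h; have h1 : (r + rho) / (2 * rho) <= 0 by rewrite ler_pdivrMr; lra.
  by rewrite /lam /clamp min_r ?max_l //; lra.
have hmax r : rho0 <= `|Num.max r rho|.
  have h0 : rho <= Num.max r rho by rewrite le_max lexx orbT.
  by rewrite ger0_norm; lra.
have hmin r : rho0 <= `|Num.min r (- rho)|.
  have h0 : Num.min r (- rho) <= - rho by rewrite ge_min lexx orbT.
  by rewrite ler0_norm; lra.
(* For r >= rho this is G (t, r). For r <= - rho it is G (t, r) * L t * cis (- th t), that is |L t|
   times G (t, r). In between, the radius is frozen and only the argument moves from one circle to
   the other. *)
pose K (t r : R) : C := G (t, Num.max r rho) * (G (t, Num.min r (- rho)) / G (t, - rho)) * cis ((lam r - 1) * th t).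
exists rho, K; split.
- split; first by rewrite ltW.
  move=> z; apply: cvgM; first apply: cvgM.
  + apply: (@cvg_comp _ _ _ (fun z : R * R => (z.1, Num.max z.2 rho)) G (nbhs z) (nbhs (z.1, Num.max z.2 rho))); last first.
      by apply: Gc; exact: hmax.
    apply: (@cvg_pairl _ _ _ (nbhs z) _ fst (fun z : R * R => Num.max z.2 rho)); first exact: cvg_fst.
    by apply: continuous_max; [exact: cvg_snd|exact: cvg_cst].
  + apply: cvgM.
      apply: (@cvg_comp _ _ _ (fun z : R * R => (z.1, Num.min z.2 (- rho))) G (nbhs z) (nbhs (z.1, Num.min z.2 (- rho)))); last first.
        by apply: Gc; exact: hmin.
      apply: (@cvg_pairl _ _ _ (nbhs z) _ fst (fun z : R * R => Num.min z.2 (- rho))); first exact: cvg_fst.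
      by apply: continuous_min; [exact: cvg_snd|exact: cvg_cst].
    apply: cvgV; first by apply: G0; rewrite // ra2 ltW.
    apply: (@cvg_comp _ _ _ (fun z : R * R => (z.1, - rho)) G (nbhs z) (nbhs (z.1, - rho))); last first.
      by apply: Gc; rewrite /= ra2 ltW.
    by apply: (@cvg_pairl _ _ _ (nbhs z) _ fst (cst (- rho))); [exact: cvg_fst|exact: cvg_cst].
  + apply: (@cvg_comp _ _ _ (fun z : R * R => (lam z.2 - 1) * th z.1) (@cis R : R -> C) (nbhs z) (nbhs ((lam z.2 - 1) * th z.1))); last exact: cis_continuous.
    apply: cvgM; last first.
      by apply: (@cvg_comp _ _ _ fst th (nbhs z) (nbhs z.1)); [exact: cvg_fst|exact: thL.1].
    apply: cvgB; last exact: cvg_cst.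
    apply: (@cvg_comp _ _ _ (fun z : R * R => (z.2 + rho) / (2 * rho)) (clamp 0 1) (nbhs z) (nbhs ((z.2 + rho) / (2 * rho)))); last exact: clamp_continuous.
    by apply: cvgM; [apply: cvgD; [exact: cvg_snd|exact: cvg_cst]|exact: cvg_cst].
- move=> t r /andP[r1 r2]; apply: mulf_neq0; last exact: cis_neq0.
  apply: mulf_neq0; last apply: mulf_neq0; last first.
  + by rewrite invr_eq0; apply: G0; rewrite // ra2 ltW.
  + apply: G0; first by rewrite gt_min lt_min r1 r2 /=; lra.
    exact: hmin.
  + apply: G0; first by rewrite lt_max gt_max r1 r2 /=; lra.
    exact: hmax.
- by move=> t n r; rewrite /K !Gp thn.
- move=> t r /andP[hr r1].
  have r11 : -1 <= r <= 1 by rewrite -ler_norml ltW.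
  have Gr0 : G (t, - rho) != 0 by apply: G0; rewrite // ra2 ltW.
  rewrite -(GE t r r11); case: (lerP 0 r) => r0.
    rewrite (ger0_norm r0) in hr; exists 1; first exact: ltr01.
    have e1 : Num.max r rho = r by rewrite max_l.
    have e2 : Num.min r (- rho) = - rho by rewrite min_r //; lra.
    rewrite /K e1 e2 (lam1 _ hr) subrr mul0r cis0.
    move: Gr0; move: (G (t, - rho)) (G (t, r)) => x1 x2 x10.
    rewrite (divff x10) !mulr1; exact: esym (mul1r x2).
  rewrite (ltr0_norm r0) in hr.
  have hr' : r <= - rho by lra.
  have [k k0 kE] := norm_complex_real (L0 t); exists k; first exact: k0.
  have e1 : Num.max r rho = rho by rewrite max_r //; lra.
  have e2 : Num.min r (- rho) = r by rewrite min_l.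
  have LE : L t * cis (- th t) = k%:C.
    by rewrite (thL.2 t) kE cisN mulfK // cis_neq0.
  rewrite /K e1 e2 (lam0 _ hr') sub0r mulN1r -LE /L.
  move: (G (t, rho)) (G (t, r)) ((G (t, - rho))^-1) (cis (- th t)) => x1 x2 x3 x4.
  by rewrite -!mulrA; congr (_ * _); rewrite mulrCA; congr (_ * _); exact: mulrC.
Qed.

(** Sig is the section given by T o divided by the phase of K^2. Near the ends K is a positive
    multiple of [gdet], so in the chart at p0 the coordinate [nu] of Sig is 1 there, and the element
    e0 over p0 with [nu] equal to 1 extends it. All is written on the universal cover in (t, r), and
    [clamp] expresses continuity up to the ends. *)
Lemma global_section : exists (Sl : M -> Lam X w J) (K : R -> R -> C) (Sig : R -> R -> Gam),
  [/\ forall q, o q -> Gam_base (det2 (Sl q)) = q /\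
        forall T : 'M[R]_(2, 2 + 2), (generators X Phi q :=: T)%MS -> is_plane (Sl q) q T,
      continuous (fun z : R * R => K z.1 z.2) /\ (forall t r, -1 < r < 1 -> K t r != 0) /\
        (forall t (n : int) r, K (t + n%:~R) r = K t r),
      forall t r, -1 < r < 1 ->
        Gam_act (Sig t r) (normalize (K t r ^+ 2)) (det2 (Sl (p (expi t, r)))),
      exists e0, Gam_base e0 = p0 /\ forall t r, ~~ (-1 < r < 1) -> Sig t r = e0 &
      continuous (fun z : R * R => Sig z.1 (clamp (-1) 1 z.2))].
Proof.
have P0 := action0 hPhi; have PS := action_smooth hPhi.
have oP z r : -1 < r < 1 -> o (p (z, r)) by exists (z, r).
have [Y0 gY0] := good_chart hw hJ hcompat p0.
set c0 := chart_at X p0 in gY0; have Xc0 : atlas X c0 := chart_at_atlas X p0.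
have [rho0 rho01 rho_good] := ends_near htorus (near_good hJ Xc0 gY0).
have [rho [K [[/andP[rho_ge rho_lt] Kc] K0 Kp Kend]]] := interpolation Xc0 rho01 rho_good.
have lagr q := generators_lagrangian hw hPhi htorus horbit hregular (q := q).
have zero1 : -1 < (0 : R) < 1 by apply/andP; split; lra.
(* A default value for [Sl] outside o. *)
have [l1 _] := plane_class hw hJ hcompat P0 PS (lagr _ (oP (expi 0) 0 zero1)).
have : forall q, exists l : Lam X w J, o q -> [/\ Gam_base (det2 l) = q,
    forall T : 'M[R]_(2, 2 + 2), (generators X Phi q :=: T)%MS -> is_plane l q T &
    forall c Y, atlas X c -> good X J c Y q ->
      nu c Y (det2 l) = normalize (gdet X J Phi c Y q ^+ 2)].
  move=> q; have [oq|noq] := pselect (o q); last by exists l1.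
  by have [l Hl] := plane_class hw hJ hcompat P0 PS (lagr _ oq); exists l.
move=> /choice[Sl HSl].
have [e0 [be0 ne0]] := Gam_exists hw hJ hcompat Xc0 (normalize (1 : C)) gY0.
have : forall z : R * R, exists g : Gam,
    (-1 < z.2 < 1 -> Gam_act g (normalize (K z.1 z.2 ^+ 2)) (det2 (Sl (p (expi z.1, z.2))))) /\
    (~~ (-1 < z.2 < 1) -> g = e0).
  move=> z; case: (boolP (-1 < z.2 < 1)) => h; last by exists e0.
  have [g Hg] := Gam_act_source hw hJ hcompat (det2 (Sl (p (expi z.1, z.2)))) (normalize (K z.1 z.2 ^+ 2)).
  by exists g.
move=> /choice[Sz HSz]; pose Sig t r := Sz (t, r).
have SigK t r : -1 < r < 1 -> Gam_act (Sig t r) (normalize (K t r ^+ 2)) (det2 (Sl (p (expi t, r)))).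
  exact: (HSz (t, r)).1.
have Sig0 t r : ~~ (-1 < r < 1) -> Sig t r = e0 by exact: (HSz (t, r)).2.
have bSig t r : -1 < r < 1 -> Gam_base (Sig t r) = p (expi t, r).
  move=> r1; have <- := Gam_act_base hw hJ hcompat (SigK t r r1).
  by have [] := HSl _ (oP (expi t) r r1).
have nSig c Y t r : atlas X c -> good X J c Y (p (expi t, r)) -> -1 < r < 1 ->
    nu c Y (Sig t r) = normalize ((gdet X J Phi c Y (p (expi t, r)) / K t r) ^+ 2).
  move=> Xc gY r1; have gS : good X J c Y (Gam_base (Sig t r)) by rewrite bSig.
  have [_ e] := (Gam_actP hw hJ hcompat Xc _ (normalize (K t r ^+ 2)) gS).1 (SigK t r r1).
  have [_ _ /(_ c Y Xc gY) ngd] := HSl _ (oP (expi t) r r1).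
  rewrite ngd in e.
  have d0 : gdet X J Phi c Y (p (expi t, r)) != 0.
    exact: (gdet_neq0 hw hJ hcompat hPhi htorus horbit hregular Xc (oP _ _ r1) gY).
  have k0 := K0 t r r1.
  move: d0 k0 e; move: (gdet X J Phi c Y (p (expi t, r))) (K t r) (nu c Y (Sig t r)) => x y z x0 y0 e.
  apply: val_inj; apply: (mulIf (S1_neq0 (normalize (y ^+ 2)))).
  have xy0 : (x / y) ^+ 2 != 0 := expf_neq0 2 (mulf_neq0 x0 (invr_neq0 y0)).
  have y20 : y ^+ 2 != 0 := expf_neq0 2 y0.
  have h := val_normalizeM xy0 y20; rewrite -exprMn (divfK y0) in h.
  exact: etrans (esym e) h.
exists Sl, K, Sig; split.
- by move=> q oq; have [h1 h2 _] := HSl q oq.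
- by split; [exact: Kc|split; [exact: K0|exact: Kp]].
- exact: SigK.
- by exists e0; split; [exact: be0|exact: Sig0].
move=> z; pose r' := clamp (-1) 1 z.2.
have n1 : -1 <= 1 :> R by lra.
have cl1 (x : R) : -1 <= clamp (-1) 1 x <= 1 by exact: clamp_itv.
have clc : (fun y : R * R => clamp (-1) 1 y.2 : R) @ nbhs z --> r'.
  by apply: (@cvg_comp _ _ _ snd (clamp (-1) 1) (nbhs z) (nbhs z.2)); [exact: cvg_snd|exact: clamp_continuous].
have pc : (fun y : R * R => p (expi y.1, clamp (-1) 1 y.2)) @ nbhs z --> p (expi z.1, r').
  exact: (unroll_clamp_continuous htorus (x := z)).
have p_end t r : -1 <= r <= 1 -> ~~ (-1 < r < 1) -> `|r| = 1 /\ p (expi t, r) = p0.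
  move=> /andP[r1 r2]; rewrite negb_and -!leNgt => /orP[] h.
    have -> : r = -1 by lra.
    by split; [rewrite normrN normr1|have [] := pinched_point htorus (expi t)].
  have -> : r = 1 by lra.
  by split; [rewrite normr1|have [] := pinched_point htorus (expi t)].
have bc y : Gam_base (Sig y.1 (clamp (-1) 1 y.2)) = p (expi y.1, clamp (-1) 1 y.2).
  case: (boolP (-1 < clamp (-1) 1 y.2 < 1)) => h; first exact: bSig.
  by rewrite (Sig0 _ _ h) be0 (p_end y.1 _ (cl1 y.2) h).2.
have bcv : (fun y : R * R => Gam_base (Sig y.1 (clamp (-1) 1 y.2))) @ nbhs z -->
    Gam_base (Sig z.1 r').
  by rewrite bc; under eq_fun do rewrite bc; exact: pc.
case: (boolP (-1 < r' < 1)) => hr.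
  have [Y gY] := good_chart hw hJ hcompat (p (expi z.1, r')).
  set c := chart_at X _ in gY; have Xc : atlas X c := chart_at_atlas X _.
  have gS : good X J c Y (Gam_base (Sig z.1 r')) by rewrite bc.
  apply: (@Gam_cvg _ _ X w J hw hJ hcompat c Xc Y _ (nbhs z) _ _ _ gS bcv).
  pose f (y : R * R) : C := gdet X J Phi c Y (p (expi y.1, clamp (-1) 1 y.2)) / K y.1 (clamp (-1) 1 y.2).
  have near1 : nbhs z [set y : R * R | good X J c Y (p (expi y.1, clamp (-1) 1 y.2))].
    have ng : nbhs (p (expi z.1, r')) (good X J c Y).
      exact (near_good hJ Xc gY).
    exact: (@cvg_preimage _ _ (nbhs z) (fun y : R * R => p (expi y.1, clamp (-1) 1 y.2)) _ (good X J c Y) pc ng).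
  have [hr1 hr2] : -1 < r' /\ r' < 1 by case/andP: hr.
  have near2 : \forall y \near z, -1 < clamp (-1) 1 y.2 :> R by exact: (cvgr_gt _ clc _ hr1).
  have near3 : \forall y \near z, clamp (-1) 1 y.2 < 1 :> R by exact: (cvgr_lt _ clc _ hr2).
  apply: (@cvg_near_eq _ _ (nbhs z) _ (fun y => normalize (f y ^+ 2))).
    by apply: filterS3 near1 near2 near3 => y h1 h2 h3; apply: nSig => //; rewrite h2.
  have -> : nu c Y (Sig z.1 r') = normalize (f z ^+ 2) by exact: nSig.
  have gd0 : gdet X J Phi c Y (p (expi z.1, r')) != 0.
    exact: (gdet_neq0 hw hJ hcompat hPhi htorus horbit hregular Xc (oP _ _ hr) gY).
  have f0 : f z != 0 by apply: mulf_neq0; [exact: gd0|rewrite invr_eq0; exact: K0].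
  have gc : (fun y : R * R => gdet X J Phi c Y (p (expi y.1, clamp (-1) 1 y.2)) : C) @ nbhs z -->
      (gdet X J Phi c Y (p (expi z.1, r')) : C).
    exact: (@cvg_comp _ _ _ (fun y : R * R => p (expi y.1, clamp (-1) 1 y.2)) (gdet X J Phi c Y) (nbhs z) _ _
      pc (gdet_continuous hJ hPhi Xc gY)).
  have kc : (fun y : R * R => K y.1 (clamp (-1) 1 y.2) : C) @ nbhs z --> (K z.1 r' : C).
    have h : (fun y : R * R => (y.1, clamp (-1) 1 y.2 : R)) @ nbhs z --> (z.1, r').
      by apply: (@cvg_pairl _ _ _ (nbhs z) _ fst (fun y : R * R => clamp (-1) 1 y.2 : R)); [exact: cvg_fst|exact: clc].
    exact: (@cvg_comp _ _ _ (fun y : R * R => (y.1, clamp (-1) 1 y.2 : R)) (fun y : R * R => K y.1 y.2) (nbhs z) _ _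
      h (Kc (z.1, r'))).
  have fc : f @ nbhs z --> f z.
    by apply: cvgM; [exact: gc|apply: cvgV; [exact: K0|exact: kc]].
  have f2c : (fun y => f y ^+ 2 : C) @ nbhs z --> (f z ^+ 2 : C) by exact: (cvgM fc fc).
  exact: (normalize_cvg (expf_neq0 2 f0) f2c).
(* At an end point the fibre coordinate of Sig equals that of e0 on a whole neighbourhood, so only
   the base varies. *)
have [ar pr] := p_end z.1 _ (cl1 z.2) hr.
have gS : good X J c0 Y0 (Gam_base (Sig z.1 r')) by rewrite bc pr.
apply: (@Gam_cvg _ _ X w J hw hJ hcompat c0 Xc0 Y0 _ (nbhs z) _ _ _ gS bcv).
have absc : (fun y : R * R => `|clamp (-1) 1 y.2 : R|) @ nbhs z --> `|r'|.
  exact: (cvg_norm clc).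
have rr' : rho < `|r'| by rewrite ar.
have near1 : \forall y \near z, rho < `|clamp (-1) 1 y.2 : R| by exact: (cvgr_gt _ absc _ rr').
apply: (@cvg_near_eq _ _ (nbhs z) _ (fun y => nu c0 Y0 e0)); last first.
  by rewrite (Sig0 _ _ hr); exact: cvg_cst.
apply: filterS near1 => y hy; case: (boolP (-1 < clamp (-1) 1 y.2 < 1)) => h; last by rewrite (Sig0 _ _ h).
have gy : good X J c0 Y0 (p (expi y.1, clamp (-1) 1 y.2)).
  apply: rho_good; rewrite (le_trans rho_ge (ltW hy)) ler_norml; exact: cl1.
rewrite ne0 (nSig c0 Y0 _ _ Xc0 gy h).
have hy1 : rho <= `|clamp (-1) 1 y.2 : R| < 1 by rewrite (ltW hy) ltr_norml.
have [k k0 kE] := Kend y.1 _ hy1.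
have gd0 : gdet X J Phi c0 Y0 (p (expi y.1, clamp (-1) 1 y.2)) != 0.
  exact: (gdet_neq0 hw hJ hcompat hPhi htorus horbit hregular Xc0 (oP _ _ h) gy).
rewrite kE; move: gd0; move: (gdet _ _ _ _ _ _) => x x0.
have -> : (x / (k%:C * x)) ^+ 2 = ((k^-1) ^+ 2)%:C * 1 :> C.
  by rewrite mulr1 invfM mulrCA divff // mulr1 -fmorphV -rmorphXn.
by rewrite normalizeZ // ?oner_eq0 // exprn_gt0 // invr_gt0.
Qed.

End global_sections.

Lemma winding_phase {R : realType} (g : R -> R[i]^o) d : (forall t, g t != 0) -> winding g d ->
  winding (fun t => val (normalize (g t)) : R[i]^o) d.
Proof.
move=> g0 [th [thc thg] thd]; exists th; last exact: thd.
split; first exact: thc.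
move=> t; rewrite S1_norm mul1r val_normalize // {1}(thg t) mulrC mulKf // normr_eq0.
exact: g0.
Qed.

(** * The indices and the trivialization deduced from the section *)

Section maslov_indices.
Context {R : realType} {M : topologicalType} (X : @manifold R M (2 + 2)).
Variables (w J : M -> 'M[R]_(2 + 2)) (Phi : 'rV[R]_2 -> M -> M).
Variables (p : S1 R * R -> M) (p0 : M).
Hypotheses (hw : symplectic X w) (hJ : almost_complex X J) (hcompat : compatible w J).
Hypothesis hPhi : hamiltonian_action X w Phi.
Hypothesis htorus : lagrangian_pinched_torus X w p p0.
Hypothesis horbit : exists2 q, (p @` open_cylinder (R := R)) q &
  p @` open_cylinder (R := R) = range (fun u => Phi u q).
Hypothesis hregular : forall q, (p @` open_cylinder (R := R)) q ->
  \rank (generators X Phi q) = 2%N.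
Local Notation o := (p @` open_cylinder (R := R)).
Local Notation C := (R[i]^o).
Local Notation Gam := (Gam X w J).
Local Notation Gam_base := (@Gam_base R M 2 X w J).

Variables (Sl : M -> Lam X w J) (K : R -> R -> C) (Sig : R -> R -> Gam) (e0 : Gam).
Hypothesis hSl : forall q, o q -> Gam_base (det2 (Sl q)) = q /\
  forall T : 'M[R]_(2, 2 + 2), (generators X Phi q :=: T)%MS -> is_plane (Sl q) q T.
Hypothesis Kc : continuous (fun z : R * R => K z.1 z.2).
Hypothesis K0 : forall t r, -1 < r < 1 -> K t r != 0.
Hypothesis Kp : forall t (n : int) r, K (t + n%:~R) r = K t r.
Hypothesis SigK : forall t r, -1 < r < 1 ->
  Gam_act (Sig t r) (normalize (K t r ^+ 2)) (det2 (Sl (p (expi t, r)))).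
Hypothesis be0 : Gam_base e0 = p0.
Hypothesis Sig0 : forall t r, ~~ (-1 < r < 1) -> Sig t r = e0.
Hypothesis Sigc : continuous (fun z : R * R => Sig z.1 (clamp (-1) 1 z.2)).

Lemma end_point z r : -1 <= r <= 1 -> ~~ (-1 < r < 1) -> p (z, r) = p0.
Proof.
move=> /andP[r1 r2]; rewrite negb_and -!leNgt => /orP[] h.
  have -> : r = -1 by lra.
  by have [] := pinched_point htorus z.
have -> : r = 1 by lra.
by have [] := pinched_point htorus z.
Qed.

Lemma Sig_base t r : -1 <= r <= 1 -> Gam_base (Sig t r) = p (expi t, r).
Proof.
move=> r1; case: (boolP (-1 < r < 1)) => h; last by rewrite (Sig0 _ h) be0 end_point.
have <- := Gam_act_base hw hJ hcompat (SigK t h).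
have oq : o (p (expi t, r)) by exists (expi t, r).
by have [] := hSl oq.
Qed.

Lemma Sig_period t (n : int) r : Sig (t + n%:~R) r = Sig t r.
Proof.
case: (boolP (-1 < r < 1)) => h; last by rewrite !Sig0.
have h1 := SigK (t + n%:~R) h; rewrite Kp expi_shift in h1.
exact: (Gam_act_inj_source hw hJ hcompat h1 (SigK t h)).
Qed.

Lemma Sig_well_defined t t' r r' : -1 <= r <= 1 -> -1 <= r' <= 1 ->
  p (expi t, r) = p (expi t', r') -> Sig t r = Sig t' r'.
Proof.
move=> r1 r1' e; case: (boolP (-1 < r < 1)) => h; case: (boolP (-1 < r' < 1)) => h'.
- have e2 := open_cylinder_injective htorus h h' e.
  have e1 : expi t = expi t' := congr1 fst e2.
  have e3 : r = r' := congr1 snd e2.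
  have [n ->] := expi_eq e1; rewrite e3.
  exact: Sig_period.
- by have := pinch_notin_orbit htorus (z := expi t) h; rewrite e end_point.
- by have := pinch_notin_orbit htorus (z := expi t') h'; rewrite -e end_point.
- by rewrite !Sig0.
Qed.

(** K has no zero on the open cylinder, so the radius can be moved from a through 0 to - a. *)
Lemma winding_K a : 0 < a < 1 -> exists d : R, [/\ winding (K ^~ a) d, winding (K ^~ (- a)) d &
  exists n : int, d = n%:~R].
Proof.
move=> /andP[a0 a1].
have Kr r : continuous (K ^~ r).
  move=> t; apply: (@continuous_comp _ _ _ (fun t => (t, r)) (fun z : R * R => K z.1 z.2) t); last exact: (@Kc _).
  exact: pairl_continuous.
have ra : -1 < a < 1 by apply/andP; split; lra.
have rb : -1 < - a < 1 by apply/andP; split; lra.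
have [d wd] := winding_exists (Kr a) (fun t => K0 t ra).
have [d' wd'] := winding_exists (Kr (- a)) (fun t => K0 t rb).
pose H t x := K t ((1 - 2 * clamp 0 1 x) * a).
have dd : d = d'.
  apply: (@winding_homotopy R H).
  - move=> z; apply: (@cvg_comp _ _ _ (fun z : R * R => (z.1, (1 - 2 * clamp 0 1 z.2) * a)) (fun z : R * R => K z.1 z.2) (nbhs z)
      (nbhs (z.1, (1 - 2 * clamp 0 1 z.2) * a))); last exact: (@Kc (z.1, (1 - 2 * clamp 0 1 z.2) * a)).
    apply: (@cvg_pairl _ _ _ (nbhs z) _ fst (fun z : R * R => (1 - 2 * clamp 0 1 z.2) * a)); first exact: cvg_fst.
    apply: cvgM; last exact: cvg_cst.
    apply: cvgB; first exact: cvg_cst.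
    apply: cvgM; first exact: cvg_cst.
    by apply: (@cvg_comp _ _ _ snd (clamp 0 1) (nbhs z) (nbhs z.2)); [exact: cvg_snd|exact: clamp_continuous].
  - move=> t x; apply: K0; have /andP[c0 c1] := clamp_itv x (@ler01 R).
    by apply/andP; split; nra.
  - by move=> x; rewrite /H; have := Kp 0 1 ((1 - 2 * clamp 0 1 x) * a); rewrite add0r.
  - have -> : H ^~ 0 = K ^~ a; last exact: wd.
    by apply/funext => t; rewrite /H clamp_id ?lexx ?ler01 // mulr0 subr0 mul1r.
  - have -> : H ^~ 1 = K ^~ (- a); last exact: wd'.
    by apply/funext => t; rewrite /H clamp_id ?lexx ?ler01 //; congr (K t _); lra.
exists d; split; [exact: wd|by rewrite dd|].
apply: winding_loop_int wd; first exact: K0.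
by have := Kp 0 1 a; rewrite add0r.
Qed.

(* At the pinch point both s and Sig are constant. *)
Lemma winding_ratio (B : set M) a (s : M -> Gam) (sg : R) : maslov_data p p0 B a s ->
  sg = 1 \/ sg = -1 ->
  winding (fun t => val (phase_ratio (s (p (expi t, sg * a))) (Sig t (sg * a))) : C) 0.
Proof.
move=> [[oB _] _ /andP[a0 a1] pB [sc sb]] sg1.
have sB q : B q -> {for q, continuous s}.
  by move=> Bq; move: sc; rewrite continuous_open_subspace // => h; exact: (h q (mem_set Bq)).
(* The radius runs from sg * a at x = 0 to the end sg at x = 1, where the circle collapses to p0. *)
pose rr x := sg * (a + clamp 0 1 x * (1 - a)).
have rr01 x : a <= a + clamp 0 1 x * (1 - a) <= 1.
  by have /andP[c0 c1] := clamp_itv x (@ler01 R); apply/andP; split; nra.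
have rr1 x : -1 <= rr x <= 1.
  by have /andP[h1 h2] := rr01 x; rewrite /rr; case: sg1 => ->; apply/andP; split; lra.
have rrB t x : B (p (expi t, rr x)).
  apply: pB; have /andP[h1 h2] := rr01 x; rewrite /rr; case: sg1 => ->; [left|right]; apply/andP; split; lra.
pose P (z : R * R) := unroll_clamp p (z.1, rr z.2).
have PE z : P z = p (expi z.1, rr z.2) by rewrite /P /unroll_clamp /= clamp_id.
pose S (z : R * R) := Sig z.1 (clamp (-1) 1 (rr z.2)).
have SE z : S z = Sig z.1 (rr z.2) by rewrite /S clamp_id.
have bS z : Gam_base (S z) = Gam_base (s (P z)) by rewrite SE (Sig_base _ (rr1 z.2)) sb PE //; exact: rrB.
pose H t x : C := val (phase_ratio (s (P (t, x))) (S (t, x))).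
have qc (z : R * R) : (fun z : R * R => (z.1, rr z.2)) @ nbhs z --> (z.1, rr z.2).
  apply: (@cvg_pairl _ _ _ (nbhs z) _ fst (fun z : R * R => rr z.2)); first exact: cvg_fst.
  apply: cvgM; first exact: cvg_cst.
  apply: cvgD; first exact: cvg_cst.
  apply: cvgM; last exact: cvg_cst.
  by apply: (@cvg_comp _ _ _ snd (clamp 0 1) (nbhs z) (nbhs z.2)); [exact: cvg_snd|exact: clamp_continuous].
have Pc (z : R * R) : P @ nbhs z --> P z.
  exact: (@cvg_comp _ _ _ (fun z : R * R => (z.1, rr z.2)) (unroll_clamp p) (nbhs z) _ _ (qc z) (unroll_clamp_continuous htorus (x := _))).
have sPc (z : R * R) : (fun y => s (P y)) @ nbhs z --> s (P z).
  have BP : B (P z) by rewrite PE; exact: rrB.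
  exact: (@cvg_comp _ _ _ P s (nbhs z) _ _ (Pc z) (sB _ BP)).
have Sc (z : R * R) : S @ nbhs z --> S z.
  exact: (@cvg_comp _ _ _ (fun z : R * R => (z.1, rr z.2)) (fun z : R * R => Sig z.1 (clamp (-1) 1 z.2)) (nbhs z) _ _ (qc z) (@Sigc _)).
have Hc : continuous (fun z : R * R => H z.1 z.2).
  have -> : (fun z : R * R => H z.1 z.2) = (fun z => val (phase_ratio (s (P z)) (S z)) : C) by apply/funext => -[].
  move=> z; have h : (fun y => phase_ratio (s (P y)) (S y)) @ nbhs z --> phase_ratio (s (P z)) (S z).
    exact: (phase_ratio_cvg hw hJ hcompat bS (bS z) (sPc z) (Sc z)).
  exact: (@cvg_comp _ _ _ (fun y => phase_ratio (s (P y)) (S y)) (fun z : S1 R => val z : C) (nbhs z) _ _ h (@val_S1_continuous R _)).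
have H0 t x : H t x != 0 by exact: S1_neq0.
have Hl x : H 0 x = H 1 x.
  have e1 : P (1, x) = P (0, x) by rewrite !PE /=; have := expi_shift (0 : R) 1; rewrite add0r => ->.
  have e2 : S (1, x) = S (0, x) by rewrite !SE /=; have := Sig_period 0 1 (rr x); rewrite add0r.
  by rewrite /H e1 e2.
have H0c : continuous (H ^~ 0).
  move=> t; apply: (@continuous_comp _ _ _ (fun t => (t, 0 : R)) (fun z : R * R => H z.1 z.2) t); last exact: Hc.
  exact: pairl_continuous.
have [d wd] := winding_exists H0c (fun t => H0 t 0).
have r1end : ~~ (-1 < rr 1 < 1).
  have c1 : clamp 0 1 1 = 1 :> R by rewrite clamp_id // lexx ler01.
  by rewrite /rr c1; apply/negP => /andP[]; case: sg1 => ->; lra.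
have H1 : H ^~ 1 = (fun=> val (phase_ratio (s p0) e0) : C).
  apply/funext => t; rewrite /H SE PE /= (Sig0 _ r1end) end_point //.
have w1 : winding (H ^~ 1) 0 by rewrite H1; apply: winding_cst; exact: S1_neq0.
have d0 : d = 0 := winding_homotopy Hc H0 Hl wd w1.
have rr0 : rr 0 = sg * a by rewrite /rr clamp_id ?lexx ?ler01 // mul0r addr0.
have <- : H ^~ 0 = (fun t => val (phase_ratio (s (p (expi t, sg * a))) (Sig t (sg * a))) : C).
  by apply/funext => t; rewrite /H SE PE /= rr0.
by rewrite d0 in wd; exact: wd.
Qed.

(** The plane T o is Sig times the phase of K^2, and Sig is the given section times a factor of
    winding number 0. The degree is therefore that of K^2, twice the winding number of K. *)
Lemma maslov_index_winding (B : set M) a (s : M -> Gam) (sg : R) (n : int) : maslov_data p p0 B a s ->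
  sg = 1 \/ sg = -1 -> winding (K ^~ (sg * a)) n%:~R -> is_maslov_index p s (sg * a) (n + n).
Proof.
move=> data sg1 wK; have w0 := winding_ratio data sg1.
have [[oB _] _ /andP[a0 a1] pB [sc sb]] := data.
set r := sg * a in w0 wK *.
have r1 : -1 < r < 1 by rewrite /r; case: sg1 => ->; apply/andP; split; lra.
have r1' : -1 <= r <= 1 by have /andP[h1 h2] := r1; rewrite !ltW.
have Br t : B (p (expi t, r)).
  by apply: pB; rewrite /r; case: sg1 => ->; [left|right]; apply/andP; split; lra.
have K20 t : K t r ^+ 2 != 0 := expf_neq0 2 (K0 t r1).
have wK2 : winding (fun t => K t r ^+ 2 : C) (n%:~R + n%:~R) := windingM wK wK.
pose rat t := phase_ratio (s (p (expi t, r))) (Sig t r).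
pose ph t := normalize (K t r ^+ 2).
pose e t := normalize (val (rat t) * val (ph t) : C).
have we : winding (fun t => val (e t) : C) (n + n)%:~R.
  have -> : (fun t => val (e t) : C) = (fun t => val (rat t)) \* (fun t => val (ph t)).
    by apply/funext => t; exact: normalize_mul.
  rewrite intrD -[_ + _]add0r; exact: windingM w0 (winding_phase K20 wK2).
have ep t (m : int) : e (t + m%:~R) = e t.
  by rewrite /e /rat /ph Kp Sig_period expi_shift.
(* The map on the circle is defined through a chosen argument of z; by the periodicity [ep] the
   choice does not matter. *)
have /choice[tau tauP] : forall z : S1 R, exists t : R, z = expi t := @expi_surj R.
have fE t : e (tau (expi t)) = e t.
  by have [m mE] := expi_eq (tauP (expi t)); rewrite [in RHS]mE ep.
exists (fun z => e (tau z)).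
  move=> t; exists (Sl (p (expi t, r))).
    have oq : o (p (expi t, r)) by exists (expi t, r).
    apply: (hSl oq).2.
    have uE : unroll p (cyl_coord t r) = p (expi t, r) by rewrite /unroll /cyl_coord !mxE.
    have x1 : -1 < (cyl_coord t r : 'rV[R]_2) 0 1 < 1 by rewrite /cyl_coord mxE.
    by have [] := generators_tangent hw hPhi htorus horbit hregular x1; rewrite uE.
  rewrite fE; apply: (Gam_act_comp hw hJ hcompat) (SigK t r1).
  by apply: (phase_ratioP hw hJ hcompat); rewrite Sig_base // sb.
have [th [thc thE] thd] := we; exists th; split; first exact: thc.
  move=> t; rewrite fE; apply: val_inj; apply: etrans (thE t) _.
  by rewrite S1_norm mul1r.
by rewrite -thd addrC subrK.
Qed.

Lemma maslov_indices_equal (B : set M) a (s : M -> Gam) : maslov_data p p0 B a s ->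
  exists mu : int, is_maslov_index p s a mu /\ is_maslov_index p s (- a) mu.
Proof.
move=> data; have [_ _ a01 _ _] := data.
have [d [w1 w2 [n dn]]] := winding_K a01; rewrite dn in w1 w2.
exists (n + n); split.
  rewrite -[a]mul1r; apply: (maslov_index_winding data); first by left.
  by rewrite mul1r.
rewrite -mulN1r; apply: (maslov_index_winding data); first by right.
by rewrite mulN1r.
Qed.

Local Notation A := (p @` cylinder (R := R)).

(** The pinched torus is the image of a compact rectangle in a Hausdorff space, so continuity
    descends to it. Parameters over q are handled by continuity of Sig, the others are separated
    from q, and [tube] makes both uniform over the rectangle. *)
Lemma section_extension : exists sigma : M -> Gam,
  (forall q, A q -> Gam_base (sigma q) = q) /\
  forall q (W : set Gam), A q -> nbhs (sigma q) W -> \forall q' \near q, A q' -> W (sigma q').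
Proof.
have : forall q, exists z : R * R, A q ->
    [/\ (`[0, 1]%classic `*` `[-1, 1]%classic) z, -1 <= z.2 <= 1 & p (expi z.1, z.2) = q].
  move=> q; have [[[z r] /= r1 <-]|nq] := pselect (A q); last by exists (0, 0).
  have [t t01 ->] := expi_surj01 z; exists (t, r) => _.
  by split; [split; rewrite /= in_itv|exact: r1|].
move=> /choice[tau tauP]; pose sigma q := Sig (tau q).1 (tau q).2.
have sigmaE t r : -1 <= r <= 1 -> sigma (p (expi t, r)) = Sig t r.
  move=> r1; have Aq : A (p (expi t, r)) by exists (expi t, r).
  by have [_ h1 h2] := tauP _ Aq; apply: Sig_well_defined.
have sigma_base q : A q -> Gam_base (sigma q) = q.
  by move=> /tauP[_ h1 h2]; rewrite /sigma Sig_base.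
exists sigma; split; first exact: sigma_base.
move=> q W Aq nW.
have cK : compact (`[0, 1]%classic `*` `[-1, 1]%classic : set (R * R)).
  by apply: compact_setX; exact: segment_compact.
pose P (x : R * R) q' := unroll_clamp p x = q' -> W (Sig x.1 (clamp (-1) 1 x.2)).
have : \forall q' \near q, forall x, (`[0, 1]%classic `*` `[-1, 1]%classic) x -> P x q'.
  apply: tube cK _ => x [_ x2].
  have fx : {for (x, q), continuous (fst : (R * R) * M -> R * R)} by exact: cvg_fst.
  have sx : {for (x, q), continuous (snd : (R * R) * M -> M)} by exact: cvg_snd.
  have [e|ne] := pselect (unroll_clamp p x = q).
    have x21 : -1 <= x.2 <= 1 by move: x2; rewrite /= in_itv.
    have eS : Sig x.1 (clamp (-1) 1 x.2) = sigma q.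
      by rewrite -e /unroll_clamp (clamp_id x21) sigmaE.
    have n1 : \forall y \near x, W (Sig y.1 (clamp (-1) 1 y.2)).
      by apply: (@Sigc x); rewrite /= eS.
    by apply: filterS (near_comp fx n1) => y Wy _.
  have [V1 [V2 [n1 n2 dis]]] : exists V1 V2, [/\ nbhs (unroll_clamp p x) V1, nbhs q V2 & ~ (V1 `&` V2 !=set0)].
    apply: contrapT => h; apply: ne; apply: (manifold_hausdorff X) => V1 V2 nV1 nV2.
    by apply: contrapT => nAB; apply: h; exists V1, V2.
  have m1 := near_comp fx (near_comp (unroll_clamp_continuous htorus (x := x)) n1).
  have m2 := near_comp sx n2.
  apply: filterS2 m1 m2 => y h1 h2 e; case: dis.
  by exists y.2; split; [rewrite -e|].
apply: filterS => q' h Aq'; have [h1 h2 h3] := tauP _ Aq'.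
have := h _ h1; rewrite /P /unroll_clamp (clamp_id h2) h3; exact.
Qed.

(** A principal bundle with a continuous section is trivial: an element is sent to its base point
    and to its quotient by the section. The inverse lets the circle act on the section, and its
    continuity is checked in coordinates with [Gam_cvg]. *)
Lemma Gam_trivial : Gam_trivial_over X w J A.
Proof.
have [sigma [sigma_base sigma_near]] := section_extension.
have sc : continuous (fun q : set_type A => sigma (val q)).
  move=> q W nW; have h := sigma_near (val q) W (set_valP q) nW.
  have h2 := near_comp (val_continuous (A := A) (x := q)) h.
  by apply: filterS h2 => q' h'; apply: h'; exact: (set_valP q').
pose hb (g : set_type (Gam_base @^-1` A)) : set_type A := to_set_type (set_valP g : A (Gam_base (val g))).
have hbE g : val (hb g) = Gam_base (val g) by [].
have hbc : continuous hb.
  move=> g; apply: (@set_type_cvg _ _ A (nbhs g) _ hb (hb g)).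
  have -> : (fun g => val (hb g)) = (fun g : set_type (Gam_base @^-1` A) => Gam_base (val g)) by apply/funext => g'; exact: hbE.
  have v : (fun g : set_type (Gam_base @^-1` A) => val g) @ nbhs g --> val g by exact: val_continuous.
  exact: (@cvg_comp _ _ _ (fun g : set_type (Gam_base @^-1` A) => val g) Gam_base (nbhs g) (nbhs (val g)) (nbhs (Gam_base (val g))) v
    (@Gam_base_continuous R M X w J (val g))).
pose h (g : set_type (Gam_base @^-1` A)) := (hb g, phase_ratio (sigma (val (hb g))) (val g)).
have sb g : Gam_base (val g) = Gam_base (sigma (val (hb g))).
  by rewrite sigma_base //; exact: (set_valP (hb g)).
have : forall y : set_type A * S1 R, exists g : set_type (Gam_base @^-1` A), Gam_act (sigma (val y.1)) y.2 (val g).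
  move=> y; have [g Hg] := Gam_act_total hw hJ hcompat (sigma (val y.1)) y.2.
  have bg : Gam_base g = val y.1.
    by rewrite (Gam_act_base hw hJ hcompat Hg) sigma_base //; exact: (set_valP y.1).
  have Ag : (Gam_base @^-1` A) g by rewrite /= bg; exact: (set_valP y.1).
  by exists (to_set_type Ag).
move=> /choice[k kP].
have kb y : Gam_base (val (k y)) = val y.1.
  by rewrite (Gam_act_base hw hJ hcompat (kP y)) sigma_base //; exact: (set_valP y.1).
have hbk y : hb (k y) = y.1 by apply: val_inj; rewrite hbE kb.
exists h, k; split.
- split.
    move=> g; apply: (@cvg_pairl _ _ _ (nbhs g) _ hb (fun g => phase_ratio (sigma (val (hb g))) (val g))); first exact: hbc.
    apply: (phase_ratio_cvg hw hJ hcompat) => //.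
      exact: (@cvg_comp _ _ _ hb (fun q : set_type A => sigma (val q)) (nbhs g) _ _ (hbc g) (@sc (hb g))).
    exact: val_continuous.
  move=> y; apply: set_type_cvg.
  have [Y gY] := good_chart hw hJ hcompat (val y.1).
  set c := chart_at X _ in gY; have Xc : atlas X c := chart_at_atlas X _.
  have gk : good X J c Y (Gam_base (val (k y))) by rewrite kb.
  have v1 : (fun y : set_type A * S1 R => val y.1) @ nbhs y --> val y.1.
    by apply: (@cvg_comp _ _ _ fst val (nbhs y) (nbhs y.1)); [exact: cvg_fst|exact: val_continuous].
  have s1 : (fun y : set_type A * S1 R => sigma (val y.1)) @ nbhs y --> sigma (val y.1).
    apply: (@cvg_comp _ _ _ fst (fun q : set_type A => sigma (val q)) (nbhs y) (nbhs y.1)); first exact: cvg_fst.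
    exact: (@sc _).
  have gs (y' : set_type A * S1 R) : good X J c Y (val y'.1) -> good X J c Y (Gam_base (sigma (val y'.1))).
    by rewrite sigma_base //; exact: (set_valP y'.1).
  apply: (@Gam_cvg _ _ X w J hw hJ hcompat c Xc Y _ (nbhs y) _ _ _ gk).
    by rewrite kb; under eq_fun do rewrite kb; exact: v1.
  have nk (y' : set_type A * S1 R) : good X J c Y (val y'.1) ->
      val (nu c Y (val (k y'))) = val (nu c Y (sigma (val y'.1))) * val y'.2 :> R[i].
    by move=> gy'; have [] := (Gam_actP hw hJ hcompat Xc _ y'.2 (gs _ gy')).1 (kP y').
  pose f (y' : set_type A * S1 R) : C := val (nu c Y (val (k y'))).
  pose l : C := val (nu c Y (sigma (val y.1))) * val y.2.
  have nky : l = f y := esym (nk y gY).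
  suff L : f @ nbhs y --> l.
    exact: (@S1_cvg R _ (nbhs y) _ (fun y' => nu c Y (val (k y'))) _ (eq_ind _ (fun l : C => f @ nbhs y --> l) L _ nky)).
  apply: (@cvg_near_eq _ _ (nbhs y) _ (fun y' : set_type A * S1 R => val (nu c Y (sigma (val y'.1))) * val y'.2 : C)).
    have near1 : nbhs y [set y' : set_type A * S1 R | good X J c Y (val y'.1)].
      have ng : nbhs (val y.1) (good X J c Y) by exact: (near_good hJ Xc gY).
      exact: (@cvg_preimage _ _ (nbhs y) (fun y : set_type A * S1 R => val y.1) _ (good X J c Y) v1 ng).
    by apply: filterS near1 => y' gy'; exact: nk.
  have n1 : (fun y' : set_type A * S1 R => nu c Y (sigma (val y'.1))) @ nbhs y --> nu c Y (sigma (val y.1)).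
    exact: (@cvg_comp _ _ _ (fun y : set_type A * S1 R => sigma (val y.1)) (nu c Y) (nbhs y) _ _ s1
      (nu_cvg hw hJ hcompat Xc (gs _ gY))).
  apply: cvgM.
    exact: (@cvg_comp _ _ _ (fun y' : set_type A * S1 R => nu c Y (sigma (val y'.1))) (fun z : S1 R => val z : C)
      (nbhs y) _ _ n1 (@val_S1_continuous R _)).
  by apply: (@cvg_comp _ _ _ snd (fun z : S1 R => val z : C) (nbhs y) (nbhs y.2)); [exact: cvg_snd|exact: val_S1_continuous].
- split.
    move=> g; apply: val_inj.
    exact: (Gam_act_inj_target hw hJ hcompat (kP (h g)) (phase_ratioP hw hJ hcompat (sb g))).
  move=> y; rewrite /h hbk (phase_ratioE hw hJ hcompat (kP y)).
  by case: y.
- by move=> g; exact: hbE.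
- move=> g z g' Hg; have bE := Gam_act_base hw hJ hcompat Hg.
  have e : sigma (val (hb g')) = sigma (val (hb g)) by rewrite !hbE bE.
  have := Gam_act_comp hw hJ hcompat (phase_ratioP hw hJ hcompat (sb g)) Hg; rewrite -e => /(phase_ratioE hw hJ hcompat) rE.
  by apply: etrans (congr1 val rE) _; rewrite normalize_mul e.
Qed.

End maslov_indices.

Theorem theorem34 (R : realType) (M : topologicalType)
  (X : @manifold R M (2 + 2)) (w J : M -> 'M[R]_(2 + 2))
  (Phi : 'rV[R]_2 -> M -> M) (F : M -> 'rV[R]_2)
  (p : S1 R * R -> M) (p0 : M)
  (hsystem : integrable_system X w Phi F)
  (hJ : almost_complex X J) (hcompat : compatible w J)
  (htorus : lagrangian_pinched_torus X w p p0)
  (hfiber : exists b, p @` cylinder = F @^-1` [set b])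
  (hsingular : exists2 q, (p @` cylinder) q & ~ independent_at X F q)
  (hfixed : forall u, Phi u p0 = p0)
  (horbit : exists2 q, (p @` open_cylinder) q &
              p @` open_cylinder = range (fun u => Phi u q))
  (hregular : forall q, (p @` open_cylinder) q ->
              \rank (generators X Phi q) = 2%N) :
  (forall (B : set M) (a : R) (s : M -> Gam X w J), maslov_data p p0 B a s ->
     exists mu : int, is_maslov_index p s a mu /\ is_maslov_index p s (- a) mu) /\
  Gam_trivial_over X w J (p @` cylinder).
Proof.
have [_ hw hPhi _ _ _ _] := hsystem.
have [Sl [K [Sig [hSl [Kc [K0 Kp]] SigK [e0 [be0 Sig0]] Sigc]]]] :=
  global_section hw hJ hcompat hPhi htorus hfixed horbit hregular.
split.
  move=> B a s data.
  exact: (maslov_indices_equal hw hJ hcompat hPhi htorus horbit hregular hSl Kc K0 Kp SigK be0 Sig0 Sigc data).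
exact: (Gam_trivial hw hJ hcompat htorus hSl Kp SigK be0 Sig0 Sigc).
Qed.
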